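(* Let $0<p\le\infty$, $0<\alpha<\infty$, and let $g\in\mathcal{B}\setminus\mathcal{B}_0$. Then the integral operator $T_g:H(p,0,\alpha)\to H(p,0,\alpha)$ fixes a copy of $c_0$, and the operator $T_g:H(p,\infty,\alpha)\to H(p,\infty,\alpha)$ fixes a copy of $\ell_\infty$. Consequently, $T_g(H(p,\infty,\alpha))$ is non-separable.
   Context: $T_g(f)(z)=\int_0^z f(\zeta)g'(\zeta)\,d\zeta$. For $f$ analytic on the unit disk $\mathbb{D}$, $M_p(r,f)=\left(\int_0^{2\pi}|f(re^{i\theta})|^p\frac{d\theta}{2\pi}\right)^{1/p}$ ($p<\infty$), $M_\infty(r,f)=\max_\theta|f(re^{i\theta})|$. $H(p,\infty,\alpha)$ is the space of analytic $f$ with $\|f\|_{p,\infty,\alpha}=\sup_{0\le r<1}(1-r)^\alpha M_p(r,f)<\infty$, and $H(p,0,\alpha)$ is its subspace where $\lim_{r\to1^-}(1-r)^\alpha M_p(r,f)=0$. $\mathcal{B}$ is the Bloch space ($\sup_z(1-|z|^2)|f'(z)|<\infty$) and $\mathcal{B}_0$ the little Bloch space ($(1-|z|^2)|f'(z)|\to0$ as $|z|\to1$). An operator $T:Z\to W$ fixes a copy of a space $Y$ if there is a closed subspace $Z_0\subseteq Z$ isomorphic to $Y$ such that $T|_{Z_0}$ is an isomorphism onto its image (i.e. $\|Tz\|\ge c\|z\|$ for some $c>0$ and all $z\in Z_0$). *)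

(* Defs.v *)
From Stdlib Require Import Reals.
From Coquelicot Require Import Coquelicot.
Open Scope R_scope.

Definition inD (z : C) : Prop := Cmod z < 1.

Definition analytic_on_D (f : C -> C) : Prop :=
  forall z : C, inD z -> ex_derive (K := C_AbsRing) (V := C_NormedModule) f z.

(* x^q for x >= 0, q > 0, with the convention 0^q = 0 *)
Definition rpow (x q : R) : R := if Rle_dec x 0 then 0 else Rpower x q.

Definition circ (r theta : R) : C := (r * cos theta, r * sin theta).

(* integral means M_p(r,f); p is an extended real, p = p_infty meaning p = oo.
   (The value for p <= 0 is irrelevant: we always assume 0 < p.) *)
Definition Mp (p : Rbar) (r : R) (f : C -> C) : R :=
  match p with
  | Finite q =>
      rpow (RInt (fun theta => rpow (Cmod (f (circ r theta))) q) 0 (2 * PI)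
              / (2 * PI)) (/ q)
  | _ => real (Lub_Rbar (fun x => exists theta : R, x = Cmod (f (circ r theta))))
  end.

Definition wMp (p : Rbar) (alpha r : R) (f : C -> C) : R :=
  Rpower (1 - r) alpha * Mp p r f.

Definition Hinf (p : Rbar) (alpha : R) (f : C -> C) : Prop :=
  analytic_on_D f /\
  exists K : R, forall r : R, 0 <= r < 1 -> wMp p alpha r f <= K.

Definition H0 (p : Rbar) (alpha : R) (f : C -> C) : Prop :=
  Hinf p alpha f /\
  forall eps : R, 0 < eps -> exists delta : R, 0 < delta /\
    forall r : R, 1 - delta < r < 1 -> wMp p alpha r f < eps.

Definition Hnorm (p : Rbar) (alpha : R) (f : C -> C) : R :=
  real (Lub_Rbar (fun x => exists r : R, 0 <= r < 1 /\ x = wMp p alpha r f)).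

Definition Bloch (g : C -> C) : Prop :=
  analytic_on_D g /\
  exists K : R, forall z : C, inD z -> (1 - Cmod z ^ 2) * Cmod (C_derive g z) <= K.

Definition little_Bloch (g : C -> C) : Prop :=
  analytic_on_D g /\
  forall eps : R, 0 < eps -> exists delta : R, 0 < delta /\
    forall z : C, inD z -> 1 - delta < Cmod z ->
      (1 - Cmod z ^ 2) * Cmod (C_derive g z) < eps.

(* T_g f (z) = int_0^z f(zeta) g'(zeta) dzeta, along the segment [0,z] *)
Definition Tg (g f : C -> C) (z : C) : C :=
  RInt (V := C_R_CompleteNormedModule)
    (fun t : R => Cmult (Cmult (f (Cmult (RtoC t) z)) (C_derive g (Cmult (RtoC t) z))) z)
    0 1.

Definition fadd (f h : C -> C) : C -> C := fun z => Cplus (f z) (h z).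
Definition fscal (l : C) (f : C -> C) : C -> C := fun z => Cmult l (f z).
Definition fsub (f h : C -> C) : C -> C := fun z => Cminus (f z) (h z).

Definition linf_seq (x : nat -> C) : Prop := exists K : R, forall n, Cmod (x n) <= K.
Definition c0_seq (x : nat -> C) : Prop := is_lim_seq (fun n => Cmod (x n)) 0.
Definition supnorm (x : nat -> C) : R :=
  real (Lub_Rbar (fun y => exists n : nat, y = Cmod (x n))).
Definition sadd (x y : nat -> C) : nat -> C := fun n => Cplus (x n) (y n).
Definition sscal (l : C) (x : nat -> C) : nat -> C := fun n => Cmult l (x n).

(* T : Z -> Z (Z = a space of analytic functions on D given by the predicate
   inZ, normed by nrm) fixes a copy of the sequence space Y (predicate inY,
   sup norm): there is a closed subspace Z0 of Z isomorphic to Y such that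
   T restricted to Z0 is an isomorphism onto its image.
   Functions are identified when they agree on D. *)
Definition fixes_copy (inZ : (C -> C) -> Prop) (nrm : (C -> C) -> R)
    (T : (C -> C) -> (C -> C)) (inY : (nat -> C) -> Prop) : Prop :=
  exists Z0 : (C -> C) -> Prop,
    (forall h, Z0 h -> inZ h) /\
    Z0 (fun _ => RtoC 0) /\
    (forall h k, Z0 h -> Z0 k -> Z0 (fadd h k)) /\
    (forall l h, Z0 h -> Z0 (fscal l h)) /\
    (forall (hs : nat -> C -> C) (h : C -> C), (forall n, Z0 (hs n)) -> inZ h ->
        is_lim_seq (fun n => nrm (fsub (hs n) h)) 0 -> Z0 h) /\
    (exists (J : (nat -> C) -> (C -> C)) (a b : R), 0 < a /\ 0 < b /\
       (forall x y, inY x -> inY y -> J (sadd x y) = fadd (J x) (J y)) /\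
       (forall l x, inY x -> J (sscal l x) = fscal l (J x)) /\
       (forall x, inY x -> Z0 (J x) /\
          a * supnorm x <= nrm (J x) <= b * supnorm x) /\
       (forall h, Z0 h -> exists x, inY x /\ forall z, inD z -> h z = J x z)) /\
    (exists c : R, 0 < c /\ forall h, Z0 h -> c * nrm h <= nrm (T h)).

(* a subset S of a space with norm nrm is separable: it has a countable dense
   subset (S is nonempty in our application, so "countable" = range of a sequence) *)
Definition separable_set (S : (C -> C) -> Prop) (nrm : (C -> C) -> R) : Prop :=
  exists s : nat -> C -> C, (forall n, S (s n)) /\
    forall h, S h -> forall eps, 0 < eps -> exists n, nrm (fsub h (s n)) < eps.

(* Main.v *)
(* Since g is not in the little Bloch space there are points a_k tending to the circle at which
   (1 - |a_k|^2) |g'(a_k)| stays above some delta > 0.  Functions peaking at the a_k, chosen sparsely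
   enough (gliding hump), make |sum_n x_n f_n - x_k f_k| small against (1 - |z|)^(-alpha) sup |x| on the k-th annulus,
   so J x = sum_n x_n f_n maps l_oo (c_0) boundedly into H(p,oo,alpha) (H(p,0,alpha)).  At a_k the derivative of
   T_g (J x) is J x (a_k) g'(a_k), of size about |x_k| (1 - |a_k|)^(-alpha-1/p-1), which by the sharp pointwise
   growth of functions in H(p,oo,alpha) bounds the norm of T_g (J x) below by a multiple of sup |x|.

   For p < 1 neither Minkowski's nor Jensen's inequality is available.  The pointwise growth, and the bound on
   radial maximal functions behind the boundedness of T_g, come instead from the Cauchy formula for f^n, n > p,
   through the factorisation |f|^n = |f|^p |f|^(n-p) and an absorption argument on shrinking circles. *)
Require Import Defs.
From Stdlib Require Import Reals ZArith Lra Lia Classical ClassicalEpsilon.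
From Stdlib Require Import FunctionalExtensionality PropExtensionality.
From Coquelicot Require Import Coquelicot.
Open Scope R_scope.

(** * Complex functions: continuity, derivatives, integrals *)

(** The hypothesis [analytic_on_D] is bare pointwise complex differentiability, so even continuity
    of the derivative has to be earned: Goursat by bisection, then Cauchy's formula and its
    estimates. Two obstacles shape the rest. For p < 1 the means [Mp] satisfy the triangle
    inequality only up to a constant, and such constants must not accumulate over infinitely many
    humps: on each annulus all humps but one are estimated by their moduli, and the quasi-triangle
    inequality is used once. Next, [Hnorm] is [real] of an extended supremum, so a lower bound for
    the norm of [Tg g f] can be drawn from pointwise growth only after [Tg g f] is known to lie in
    the space. This membership comes from comparing the circles of radius r and 2r - 1: the Bloch
    bound limits the increment of [Tg g f] along a ray by a multiple of the radial supremum of |f|,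
    while the target growth (1 - r)^(-alpha) drops by the factor 2^(-alpha) in passing to 2r - 1,
    which makes the recursion contract. *)

Lemma Cmod_minus_sym (a b : C) : Cmod (a - b) = Cmod (b - a).
Proof. rewrite <- Cmod_opp. f_equal. ring. Qed.

Lemma Cmod_triangle_minus (a b : C) : Cmod a - Cmod b <= Cmod (a - b).
Proof.
  assert (H := Cmod_triangle (a - b) b).
  replace (a - b + b)%C with a in H by ring. lra.
Qed.

Lemma Cmod_pair_le (x y : R) : Cmod (x, y) <= Rabs x + Rabs y.
Proof.
  unfold Cmod; simpl. assert (Hx := Rabs_pos x). assert (Hy := Rabs_pos y).
  rewrite <- (sqrt_Rsqr (Rabs x + Rabs y)) by lra.
  apply sqrt_le_1_alt. unfold Rsqr.
  assert (H1 : x * x = Rabs x * Rabs x) by (rewrite <- Rabs_mult; rewrite Rabs_pos_eq; nra).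
  assert (H2 : y * y = Rabs y * Rabs y) by (rewrite <- Rabs_mult; rewrite Rabs_pos_eq; nra).
  nra.
Qed.

Lemma Cmod_RtoC_pos (x : R) : 0 <= x -> Cmod (RtoC x) = x.
Proof. intro. rewrite Cmod_R. now apply Rabs_pos_eq. Qed.

Lemma Cmod_circ (r t : R) : 0 <= r -> Cmod (circ r t) = r.
Proof.
  intro Hr. unfold Cmod, circ; simpl.
  replace (r * cos t * (r * cos t * 1) + r * sin t * (r * sin t * 1))
    with (Rsqr r * (Rsqr (sin t) + Rsqr (cos t))) by (unfold Rsqr; ring).
  rewrite sin2_cos2, Rmult_1_r. now apply sqrt_Rsqr.
Qed.

Lemma circ_scal (r s t : R) : circ (r * s) t = (RtoC r * circ s t)%C.
Proof. unfold circ, Cmult, RtoC; simpl. f_equal; ring. Qed.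

Lemma circ_mult (r s t u : R) : (circ r t * circ s u)%C = circ (r * s) (t + u).
Proof.
  unfold circ, Cmult; simpl. rewrite cos_plus, sin_plus. f_equal; ring.
Qed.

Lemma circ_2PI (r : R) : circ r (2 * PI) = circ r 0.
Proof. unfold circ. rewrite cos_2PI, sin_2PI, cos_0, sin_0. reflexivity. Qed.

Lemma PI_pos2 : 0 < 2 * PI.
Proof. assert (H := PI_RGT_0); lra. Qed.

Definition Ccont (u : R -> C) (t : R) : Prop :=
  forall eps, 0 < eps -> exists d, 0 < d /\
    forall s, Rabs (s - t) < d -> Cmod (u s - u t) < eps.

Definition CCcont (f : C -> C) (z : C) : Prop :=
  forall eps, 0 < eps -> exists d, 0 < d /\
    forall w, Cmod (w - z) < d -> Cmod (f w - f z) < eps.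

Definition Cdiff (f : C -> C) (z l : C) : Prop :=
  forall eps, 0 < eps -> exists d, 0 < d /\
    forall w, Cmod (w - z) < d -> Cmod (f w - f z - l * (w - z)) <= eps * Cmod (w - z).

(** The bridge from the filter-based complex derivative of the definitions to the epsilon form;
    complex [is_derive] is met below only through it. *)
Lemma is_derive_Cdiff (f : C -> C) (z l : C) :
  is_derive (K := C_AbsRing) (V := C_NormedModule) f z l <-> Cdiff f z l.
Proof.
  split.
  - intros [_ H] eps Heps.
    specialize (H z (fun P h => h)).
    destruct (H (mkposreal _ Heps)) as [d Hd].
    exists d. split. apply cond_pos.
    intros w Hw. specialize (Hd w).
    assert (Hb : ball (M := AbsRing_UniformSpace C_AbsRing) z d w) by exact Hw.
    specialize (Hd Hb). simpl in Hd.
    replace (f w - f z - l * (w - z))%C with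
       (minus (G := C_AbelianGroup) (minus (G:= C_AbelianGroup) (f w) (f z)) (scal (K := C_Ring) (V := C_ModuleSpace) (minus (G := C_AbelianGroup) w z) l)).
    exact Hd.
    unfold minus, plus, opp, scal; simpl. unfold mult; simpl. ring.
  - intros H. split.
    + apply is_linear_scal_l.
    + intros x Hx.
      assert (Hxz : z = x).
      { apply (is_filter_lim_locally_unique (K := C_AbsRing) (V := AbsRing_NormedModule C_AbsRing) z x Hx). }
      subst x. intros eps.
      destruct (H eps (cond_pos eps)) as [d [Hd Hd']].
      exists (mkposreal d Hd). intros w Hw.
      specialize (Hd' w Hw).
      replace (f w - f z - l * (w - z))%C with
       (minus (G := C_AbelianGroup) (minus (G:= C_AbelianGroup) (f w) (f z)) (scal (K := C_Ring) (V := C_ModuleSpace) (minus (G := C_AbelianGroup) w z) l)) in Hd'.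
      exact Hd'.
      unfold minus, plus, opp, scal; simpl. unfold mult; simpl. ring.
Qed.

Lemma Cdiff_derive (f : C -> C) (z l : C) : Cdiff f z l -> C_derive f z = l.
Proof. intro H. apply is_C_derive_unique. now apply is_derive_Cdiff. Qed.

Lemma analytic_Cdiff (f : C -> C) (z : C) :
  analytic_on_D f -> inD z -> Cdiff f z (C_derive f z).
Proof.
  intros Hf Hz. destruct (Hf z Hz) as [l Hl].
  apply is_derive_Cdiff in Hl. now rewrite (Cdiff_derive _ _ _ Hl).
Qed.

Lemma Cdiff_analytic (f : C -> C) :
  (forall z, inD z -> exists l, Cdiff f z l) -> analytic_on_D f.
Proof.
  intros H z Hz. destruct (H z Hz) as [l Hl]. exists l. now apply is_derive_Cdiff.
Qed.

Lemma Cdiff_CCcont (f : C -> C) (z l : C) : Cdiff f z l -> CCcont f z.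
Proof.
  intros H eps Heps.
  destruct (H 1 Rlt_0_1) as [d [Hd H1]].
  assert (Hl := Cmod_ge_0 l).
  exists (Rmin d (eps / (2 * (1 + Cmod l)))). split.
  - apply Rmin_glb_lt; auto. apply Rdiv_lt_0_compat; lra.
  - intros w Hw.
    assert (Hw1 : Cmod (w - z) < d) by (eapply Rlt_le_trans; [apply Hw | apply Rmin_l]).
    assert (Hw2 : Cmod (w - z) < eps / (2 * (1 + Cmod l))) by (eapply Rlt_le_trans; [apply Hw | apply Rmin_r]).
    specialize (H1 w Hw1).
    assert (H2 := Cmod_triangle (f w - f z - l * (w - z)) (l * (w - z))).
    replace (f w - f z - l * (w - z) + l * (w - z))%C with (f w - f z)%C in H2 by ring.
    rewrite Cmod_mult in H2.
    assert (H3 : Cmod (w - z) * (2 * (1 + Cmod l)) < eps).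
    { apply Rlt_div_r in Hw2; lra. }
    assert (H4 := Cmod_ge_0 (w - z)). nra.
Qed.

Lemma Cdiff_plus (f h : C -> C) z l m :
  Cdiff f z l -> Cdiff h z m -> Cdiff (fun w => f w + h w)%C z (l + m).
Proof.
  intros Hf Hh eps He.
  destruct (Hf (eps / 2)) as [d1 [Hd1 H1]]; [lra|].
  destruct (Hh (eps / 2)) as [d2 [Hd2 H2]]; [lra|].
  exists (Rmin d1 d2). split. now apply Rmin_glb_lt.
  intros w Hw.
  specialize (H1 w (Rlt_le_trans _ _ _ Hw (Rmin_l _ _))).
  specialize (H2 w (Rlt_le_trans _ _ _ Hw (Rmin_r _ _))).
  replace (f w + h w - (f z + h z) - (l + m) * (w - z))%C
    with ((f w - f z - l * (w - z)) + (h w - h z - m * (w - z)))%C by ring.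
  eapply Rle_trans. apply Cmod_triangle. lra.
Qed.

Lemma Cdiff_const c z : Cdiff (fun _ => c) z 0.
Proof.
  intros eps He. exists 1. split. lra. intros w _.
  replace (c - c - 0 * (w - z))%C with (RtoC 0) by ring. rewrite Cmod_0.
  assert (H := Cmod_ge_0 (w - z)). nra.
Qed.

Lemma Cdiff_id z : Cdiff (fun w => w) z 1.
Proof.
  intros eps He. exists 1. split. lra. intros w _.
  replace (w - z - 1 * (w - z))%C with (RtoC 0) by ring. rewrite Cmod_0.
  assert (H := Cmod_ge_0 (w - z)). nra.
Qed.

Lemma Cdiff_mult (f h : C -> C) z l m :
  Cdiff f z l -> Cdiff h z m -> Cdiff (fun w => f w * h w)%C z (l * h z + f z * m).
Proof.
  intros Hf Hh eps He.
  assert (Hc := Cdiff_CCcont h z m Hh).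
  set (A := 1 + Cmod (h z) + Cmod (f z) + Cmod l).
  assert (A1 := Cmod_ge_0 (h z)). assert (A2 := Cmod_ge_0 (f z)). assert (A3 := Cmod_ge_0 l).
  assert (HA : 1 <= A) by (unfold A; lra).
  assert (Hq : 0 < eps / (4 * A)) by (apply Rdiv_lt_0_compat; lra).
  destruct (Hf (eps / (4 * A)) Hq) as [d1 [Hd1 H1]].
  destruct (Hh (eps / (4 * A)) Hq) as [d2 [Hd2 H2]].
  destruct (Hc (Rmin 1 (eps / (4 * A)))) as [d3 [Hd3 H3]]; [apply Rmin_glb_lt; lra|].
  exists (Rmin d1 (Rmin d2 d3)). split. now repeat apply Rmin_glb_lt.
  intros w Hw.
  assert (Hw1 := Rlt_le_trans _ _ _ Hw (Rmin_l _ _)).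
  assert (Hw2 := Rlt_le_trans _ _ _ Hw (Rmin_r _ _)).
  assert (Hw3 := Rlt_le_trans _ _ _ Hw2 (Rmin_r _ _)).
  apply (fun H => Rlt_le_trans _ _ _ H (Rmin_l _ _)) in Hw2.
  specialize (H1 w Hw1). specialize (H2 w Hw2). specialize (H3 w Hw3).
  assert (H3a := Rlt_le_trans _ _ _ H3 (Rmin_l _ _)).
  assert (H3b := Rlt_le_trans _ _ _ H3 (Rmin_r _ _)).
  (* Three error terms, each at most eps/4 times |w - z|; [A] dominates |h w|, |f z| and |l| at
     once. *)
  replace (f w * h w - f z * h z - (l * h z + f z * m) * (w - z))%C with
    ((f w - f z - l * (w - z)) * h w + (l * (w - z) * (h w - h z) + f z * (h w - h z - m * (w - z))))%C by ring.
  eapply Rle_trans. apply Cmod_triangle. rewrite !Cmod_mult.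
  assert (K1 := Cmod_triangle (l * (w - z) * (h w - h z)) (f z * (h w - h z - m * (w - z)))).
  rewrite !Cmod_mult in K1.
  assert (K2 : Cmod (h w) <= A).
  { assert (K := Cmod_triangle_minus (h w) (h z)). unfold A. lra. }
  set (e := eps / (4 * A)) in *. set (d := Cmod (w - z)) in *.
  assert (Hd0 : 0 <= d) by apply Cmod_ge_0.
  assert (HeA : e * A = eps / 4) by (unfold e; field; lra).
  assert (B1 : Cmod (f w - f z - l * (w - z)) * Cmod (h w) <= (e * d) * A).
  { apply Rmult_le_compat; auto using Cmod_ge_0. }
  assert (B2 : Cmod l * d * Cmod (h w - h z) <= A * d * e).
  { apply Rmult_le_compat; auto using Cmod_ge_0. apply Rmult_le_pos; auto.
    apply Rmult_le_compat_r; auto. unfold A; lra. lra. }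
  assert (B3 : Cmod (f z) * Cmod (h w - h z - m * (w - z)) <= A * (e * d)).
  { apply Rmult_le_compat; auto using Cmod_ge_0. unfold A; lra. }
  replace ((e * d) * A) with (eps / 4 * d) in B1 by (rewrite <- HeA; ring).
  replace (A * d * e) with (eps / 4 * d) in B2 by (rewrite <- HeA; ring).
  replace (A * (e * d)) with (eps / 4 * d) in B3 by (rewrite <- HeA; ring).
  nra.
Qed.

Lemma Cdiff_pow (f : C -> C) z l n : Cdiff f z l -> exists m, Cdiff (fun w => f w ^ n)%C z m.
Proof.
  intro Hf. induction n as [|n [m IH]].
  - exists 0%C. exact (Cdiff_const 1 z).
  - eexists. exact (Cdiff_mult _ _ _ _ _ Hf IH).
Qed.

Lemma Cdiff_inv (f : C -> C) z l :
  Cdiff f z l -> f z <> 0%C -> Cdiff (fun w => / f w)%C z (- l / (f z * f z)).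
Proof.
  intros Hf Hz eps He.
  assert (Hc := Cdiff_CCcont f z l Hf).
  assert (Hp : 0 < Cmod (f z)) by now apply Cmod_gt_0.
  set (A := Cmod (f z)) in *. assert (HL := Cmod_ge_0 l).
  (* The remainder has denominator (f z)^2 f w, of modulus above A^3/2 once |f w| > A/2. The
     tolerances make each of the two numerator terms at most eps A^3/4 times |w - z|. *)
  set (e1 := eps * (A * A) / 4). set (e2 := eps * (A * A * A) / (4 * (1 + Cmod l))).
  assert (He1 : 0 < e1) by (unfold e1; apply Rdiv_lt_0_compat; [repeat apply Rmult_lt_0_compat; auto|lra]).
  assert (He2 : 0 < e2).
  { unfold e2; apply Rdiv_lt_0_compat; [|lra]. repeat apply Rmult_lt_0_compat; auto. }
  destruct (Hf e1 He1) as [d1 [Hd1 H1]].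
  destruct (Hc (Rmin (A / 2) e2)) as [d2 [Hd2 H2]]; [apply Rmin_glb_lt; lra|].
  exists (Rmin d1 d2). split. now apply Rmin_glb_lt.
  intros w Hw.
  specialize (H1 w (Rlt_le_trans _ _ _ Hw (Rmin_l _ _))).
  specialize (H2 w (Rlt_le_trans _ _ _ Hw (Rmin_r _ _))).
  assert (H2a := Rlt_le_trans _ _ _ H2 (Rmin_l _ _)).
  assert (H2b := Rlt_le_trans _ _ _ H2 (Rmin_r _ _)).
  assert (Hfw : A / 2 < Cmod (f w)).
  { rewrite Cmod_minus_sym in H2a. assert (K := Cmod_triangle_minus (f z) (f w)). fold A in K. lra. }
  assert (Hw0 : f w <> 0%C) by (apply Cmod_gt_0; lra).
  replace (/ f w - / f z - - l / (f z * f z) * (w - z))%C with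
    ((l * (w - z) * (f w - f z) - f z * (f w - f z - l * (w - z))) / (f z * f z * f w))%C
    by (field; auto).
  rewrite Cmod_div by (repeat apply Cmult_neq_0; auto).
  rewrite !Cmod_mult. fold A.
  assert (Hd : 0 < A * A * Cmod (f w)) by (repeat apply Rmult_lt_0_compat; lra).
  apply Rle_div_l; auto.
  unfold Cminus at 1. eapply Rle_trans. apply Cmod_triangle. rewrite Cmod_opp, !Cmod_mult. fold A.
  set (d := Cmod (w - z)) in *. assert (Hd0 : 0 <= d) by apply Cmod_ge_0.
  assert (B1 : Cmod l * d * Cmod (f w - f z) <= Cmod l * d * e2).
  { apply Rmult_le_compat_l; [|lra]. apply Rmult_le_pos; auto. }
  assert (B2 : A * Cmod (f w - f z - l * (w - z)) <= A * (e1 * d)).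
  { apply Rmult_le_compat_l; lra. }
  assert (B3 : Cmod l * e2 <= eps * (A * A * A) / 4).
  { replace (eps * (A * A * A) / 4) with ((1 + Cmod l) * e2) by (unfold e2; field; lra).
    apply Rmult_le_compat_r; lra. }
  assert (B4 : Cmod l * d * e2 <= eps * (A * A * A) / 4 * d) by nra.
  assert (B5 : A * (e1 * d) = eps * (A * A * A) / 4 * d) by (unfold e1; field).
  assert (B6 : eps * (A * A * A) / 2 * d <= eps * d * (A * A * Cmod (f w))).
  { replace (eps * (A * A * A) / 2 * d) with (eps * d * (A * A * (A / 2))) by field.
    apply Rmult_le_compat_l. nra. apply Rmult_le_compat_l; nra. }
  lra.
Qed.

Lemma Cdiff_comp_affine (f : C -> C) (c k z l : C) :
  Cdiff f (c + k * z) l -> Cdiff (fun w => f (c + k * w)%C) z (k * l).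
Proof.
  intros Hf eps He. assert (Hk := Cmod_ge_0 k).
  destruct (Hf (eps / (1 + Cmod k))) as [d [Hd H]]; [apply Rdiv_lt_0_compat; lra|].
  exists (d / (1 + Cmod k)). split. apply Rdiv_lt_0_compat; lra.
  intros w Hw. apply Rlt_div_r in Hw; [|lra].
  assert (E : (c + k * w - (c + k * z))%C = (k * (w - z))%C) by ring.
  assert (H4 := Cmod_ge_0 (w - z)).
  specialize (H (c + k * w)%C). rewrite E, Cmod_mult in H.
  replace (k * l * (w - z))%C with (l * (k * (w - z)))%C by ring.
  eapply Rle_trans. apply H. nra.
  replace (eps / (1 + Cmod k) * (Cmod k * Cmod (w - z))) with
    (eps * Cmod (w - z) * (Cmod k / (1 + Cmod k))) by (field; lra).
  rewrite <- (Rmult_1_r (eps * Cmod (w - z))) at 2.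
  apply Rmult_le_compat_l. nra. apply Rle_div_l; lra.
Qed.

Lemma Cdiff_ext (f h : C -> C) z l d :
  0 < d -> (forall w, Cmod (w - z) < d -> f w = h w) -> Cdiff f z l -> Cdiff h z l.
Proof.
  intros Hd E H eps He. destruct (H eps He) as [d' [Hd' H']].
  exists (Rmin d d'). split. now apply Rmin_glb_lt. intros w Hw.
  rewrite <- !E. apply H'. exact (Rlt_le_trans _ _ _ Hw (Rmin_r _ _)).
  replace (z - z)%C with (RtoC 0) by ring. now rewrite Cmod_0.
  exact (Rlt_le_trans _ _ _ Hw (Rmin_l _ _)).
Qed.

(** Every derivative of a function given by an integral is obtained this way: the integrand's
    remainder is bounded quadratically and integrated, in place of a theorem on exchanging
    limits. *)
Lemma Cdiff_quad (f : C -> C) z l d K :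
  0 < d -> (forall w, Cmod (w - z) < d -> Cmod (f w - f z - l * (w - z)) <= K * Cmod (w - z) ^ 2) ->
  Cdiff f z l.
Proof.
  intros Hd H eps He. assert (HK := Rabs_pos K).
  exists (Rmin d (eps / (1 + Rabs K))). split. apply Rmin_glb_lt; auto. apply Rdiv_lt_0_compat; lra.
  intros w Hw.
  specialize (H w (Rlt_le_trans _ _ _ Hw (Rmin_l _ _))).
  apply (fun H => Rlt_le_trans _ _ _ H (Rmin_r _ _)) in Hw. apply Rlt_div_r in Hw; [|lra].
  eapply Rle_trans. apply H. assert (H4 := Cmod_ge_0 (w - z)).
  assert (K <= Rabs K) by apply Rle_abs. simpl. nra.
Qed.

(** * Continuity of curves in the plane *)

Lemma Ccont_const c t : Ccont (fun _ => c) t.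
Proof.
  intros eps He. exists 1. split. lra. intros w _.
  replace (c - c)%C with (RtoC 0) by ring. now rewrite Cmod_0.
Qed.

Lemma Ccont_comp (f : C -> C) (u : R -> C) t : Ccont u t -> CCcont f (u t) -> Ccont (fun s => f (u s)) t.
Proof.
  intros Hu Hf eps He. destruct (Hf eps He) as [d [Hd H]].
  destruct (Hu d Hd) as [d' [Hd' H']]. exists d'. split; auto.
Qed.

Lemma Ccont_plus (u v : R -> C) t : Ccont u t -> Ccont v t -> Ccont (fun s => u s + v s)%C t.
Proof.
  intros Hf Hh eps He.
  destruct (Hf (eps / 2)) as [d1 [Hd1 H1]]; [lra|].
  destruct (Hh (eps / 2)) as [d2 [Hd2 H2]]; [lra|].
  exists (Rmin d1 d2). split. now apply Rmin_glb_lt.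
  intros w Hw.
  specialize (H1 w (Rlt_le_trans _ _ _ Hw (Rmin_l _ _))).
  specialize (H2 w (Rlt_le_trans _ _ _ Hw (Rmin_r _ _))).
  replace (u w + v w - (u t + v t))%C with ((u w - u t) + (v w - v t))%C by ring.
  eapply Rle_lt_trans. apply Cmod_triangle. lra.
Qed.

Lemma Ccont_mult (u v : R -> C) t : Ccont u t -> Ccont v t -> Ccont (fun s => u s * v s)%C t.
Proof.
  intros Hf Hh eps He.
  set (A := 1 + Cmod (u t) + Cmod (v t)).
  assert (A1 := Cmod_ge_0 (u t)). assert (A2 := Cmod_ge_0 (v t)).
  assert (HA : 1 <= A) by (unfold A; lra).
  assert (Hq : 0 < eps / (2 * A)) by (apply Rdiv_lt_0_compat; lra).
  destruct (Hf (eps / (2 * A)) Hq) as [d1 [Hd1 H1]].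
  destruct (Hh (Rmin 1 (eps / (2 * A)))) as [d2 [Hd2 H2]]; [apply Rmin_glb_lt; lra|].
  exists (Rmin d1 d2). split. now apply Rmin_glb_lt.
  intros w Hw.
  specialize (H1 w (Rlt_le_trans _ _ _ Hw (Rmin_l _ _))).
  specialize (H2 w (Rlt_le_trans _ _ _ Hw (Rmin_r _ _))).
  assert (H2a := Rlt_le_trans _ _ _ H2 (Rmin_l _ _)).
  assert (H2b := Rlt_le_trans _ _ _ H2 (Rmin_r _ _)).
  replace (u w * v w - u t * v t)%C with ((u w - u t) * v w + u t * (v w - v t))%C by ring.
  eapply Rle_lt_trans. apply Cmod_triangle. rewrite !Cmod_mult.
  assert (K2 : Cmod (v w) <= A).
  { assert (K := Cmod_triangle_minus (v w) (v t)). unfold A. lra. }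
  assert (K3 : Cmod (u t) <= A) by (unfold A; lra).
  set (e := eps / (2 * A)) in *. assert (HeA : e * A = eps / 2) by (unfold e; field; lra).
  assert (Cmod (u w - u t) * Cmod (v w) <= Cmod (u w - u t) * A).
  { apply Rmult_le_compat_l; auto using Cmod_ge_0. }
  assert (Cmod (u w - u t) * A < e * A) by (apply Rmult_lt_compat_r; lra).
  assert (Cmod (u t) * Cmod (v w - v t) <= A * e).
  { apply Rmult_le_compat; auto using Cmod_ge_0. lra. }
  lra.
Qed.

Lemma Ccont_minus (u v : R -> C) t : Ccont u t -> Ccont v t -> Ccont (fun s => u s - v s)%C t.
Proof.
  intros Hu Hv. apply Ccont_plus; auto.
  intros eps He. destruct (Hv eps He) as [d [Hd H]]. exists d. split; auto. intros s Hs.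
  replace (- v s - - v t)%C with (- (v s - v t))%C by ring. rewrite Cmod_opp. auto.
Qed.

Lemma CCcont_inv (z : C) : z <> 0%C -> CCcont Cinv z.
Proof. intro Hz. exact (Cdiff_CCcont _ _ _ (Cdiff_inv (fun w => w) z 1 (Cdiff_id z) Hz)). Qed.

Lemma Ccont_inv (u : R -> C) t : Ccont u t -> u t <> 0%C -> Ccont (fun s => / u s)%C t.
Proof. intros Hu H0. apply (Ccont_comp Cinv); auto. now apply CCcont_inv. Qed.

Lemma Ccont_div (u v : R -> C) t : Ccont u t -> Ccont v t -> v t <> 0%C -> Ccont (fun s => u s / v s)%C t.
Proof. intros. apply Ccont_mult; auto. now apply Ccont_inv. Qed.

Lemma Ccont_pair (u v : R -> R) t :
  continuous u t -> continuous v t -> Ccont (fun s => (u s, v s)) t.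
Proof.
  intros Hu Hv eps He.
  assert (He2 : 0 < eps / 2) by lra.
  destruct (proj1 (filterlim_locally u (u t)) Hu (mkposreal _ He2)) as [d1 H1].
  destruct (proj1 (filterlim_locally v (v t)) Hv (mkposreal _ He2)) as [d2 H2].
  exists (Rmin d1 d2). split. apply Rmin_glb_lt; apply cond_pos.
  intros s Hs.
  assert (K1 : Rabs (u s - u t) < eps / 2) by (apply (H1 s); exact (Rlt_le_trans _ _ _ Hs (Rmin_l _ _))).
  assert (K2 : Rabs (v s - v t) < eps / 2) by (apply (H2 s); exact (Rlt_le_trans _ _ _ Hs (Rmin_r _ _))).
  unfold Cminus, Cplus, Copp; simpl. eapply Rle_lt_trans. apply Cmod_pair_le.
  unfold Rminus in *. lra.
Qed.

Lemma continuous_cos_at t : continuous cos t.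
Proof. apply (ex_derive_continuous cos). exists (- sin t). apply is_derive_cos. Qed.

Lemma continuous_sin_at t : continuous sin t.
Proof. apply (ex_derive_continuous sin). exists (cos t). apply is_derive_sin. Qed.

Lemma Ccont_circ r t : Ccont (circ r) t.
Proof.
  apply (Ccont_pair (fun s => r * cos s) (fun s => r * sin s)).
  - apply (continuous_scal_r r cos). apply continuous_cos_at.
  - apply (continuous_scal_r r sin). apply continuous_sin_at.
Qed.

Lemma Ccont_RtoC t : Ccont RtoC t.
Proof.
  intros eps He. exists eps. split; auto. intros s Hs.
  rewrite <- RtoC_minus, Cmod_R. auto.
Qed.

Lemma Ccont_continuous (u : R -> C) t :
  Ccont u t -> continuous (T := R_UniformSpace) (U := C_R_CompleteNormedModule) u t.
Proof.
  intros H. apply filterlim_locally. intros eps.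
  destruct (H eps (cond_pos eps)) as [d [Hd H']].
  exists (mkposreal d Hd). intros s Hs.
  apply (C_NormedModule_mixin_compat1 (u t) (u s) eps). apply H'. exact Hs.
Qed.

Lemma Ccont_Cmod (u : R -> C) t : Ccont u t -> continuous (fun s => Cmod (u s)) t.
Proof.
  intros H. apply filterlim_locally. intros eps.
  destruct (H eps (cond_pos eps)) as [d [Hd H']].
  exists (mkposreal d Hd). intros s Hs.
  specialize (H' s Hs). change (Rabs (Cmod (u s) - Cmod (u t)) < eps).
  assert (A := Cmod_triangle_minus (u s) (u t)).
  assert (B := Cmod_triangle_minus (u t) (u s)). rewrite Cmod_minus_sym in B.
  apply Rabs_lt_between. lra.
Qed.

Definition CI (u : R -> C) (a b : R) : C := RInt (V := C_R_CompleteNormedModule) u a b.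

Lemma CI_ex (u : R -> C) a b : (forall t, Rmin a b <= t <= Rmax a b -> Ccont u t) ->
  ex_RInt (V := C_R_CompleteNormedModule) u a b.
Proof. intro H. apply (ex_RInt_continuous (V := C_R_CompleteNormedModule)). intros. apply Ccont_continuous. auto. Qed.

Lemma CI_ext (u v : R -> C) a b :
  (forall t, Rmin a b < t < Rmax a b -> u t = v t) -> CI u a b = CI v a b.
Proof. exact (RInt_ext (V := C_R_CompleteNormedModule) u v a b). Qed.

Lemma CI_plus (u v : R -> C) a b :
  (forall t, Rmin a b <= t <= Rmax a b -> Ccont u t) ->
  (forall t, Rmin a b <= t <= Rmax a b -> Ccont v t) ->
  CI (fun t => u t + v t)%C a b = (CI u a b + CI v a b)%C.
Proof. intros. apply (RInt_plus (V := C_R_CompleteNormedModule)); now apply CI_ex. Qed.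

Lemma CI_minus (u v : R -> C) a b :
  (forall t, Rmin a b <= t <= Rmax a b -> Ccont u t) ->
  (forall t, Rmin a b <= t <= Rmax a b -> Ccont v t) ->
  CI (fun t => u t - v t)%C a b = (CI u a b - CI v a b)%C.
Proof. intros. apply (RInt_minus (V := C_R_CompleteNormedModule)); now apply CI_ex. Qed.

Lemma CI_Chasles (u : R -> C) a b c :
  (forall t, Rmin a b <= t <= Rmax a b -> Ccont u t) ->
  (forall t, Rmin b c <= t <= Rmax b c -> Ccont u t) ->
  (CI u a b + CI u b c)%C = CI u a c.
Proof. intros. apply (RInt_Chasles (V := C_R_CompleteNormedModule)); now apply CI_ex. Qed.

Lemma CI_const c a b : CI (fun _ => c) a b = (RtoC (b - a) * c)%C.
Proof. unfold CI. rewrite RInt_const. apply scal_R_Cmult. Qed.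

(** The integral lives in a normed module over the reals, so linearity over C is proved on real and
    imaginary parts. *)
Lemma CI_scal (k : C) (u : R -> C) a b :
  (forall t, Rmin a b <= t <= Rmax a b -> Ccont u t) ->
  CI (fun t => k * u t)%C a b = (k * CI u a b)%C.
Proof.
  intro H. apply CI_ex in H.
  apply (RInt_correct (V := C_R_CompleteNormedModule)) in H. fold (CI u a b) in H.
  apply (is_RInt_unique (V := C_R_CompleteNormedModule)).
  set (I := CI u a b) in *. clearbody I.
  assert (H1 := is_RInt_fct_extend_fst (U := R_NormedModule) (V := R_NormedModule) u a b I H).
  assert (H2 := is_RInt_fct_extend_snd (U := R_NormedModule) (V := R_NormedModule) u a b I H).
  apply (is_RInt_fct_extend_pair (U := R_NormedModule) (V := R_NormedModule)
    (fun t => (k * u t)%C) a b (fst k * fst I - snd k * snd I) (fst k * snd I + snd k * fst I)).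
  - exact (is_RInt_minus _ _ a b _ _ (is_RInt_scal _ a b (fst k) _ H1) (is_RInt_scal _ a b (snd k) _ H2)).
  - exact (is_RInt_plus _ _ a b _ _ (is_RInt_scal _ a b (fst k) _ H2) (is_RInt_scal _ a b (snd k) _ H1)).
Qed.

Lemma CI_norm (u : R -> C) a b :
  a <= b -> (forall t, a <= t <= b -> Ccont u t) ->
  Cmod (CI u a b) <= RInt (fun t => Cmod (u t)) a b.
Proof.
  intros Hab H.
  assert (Hm : forall t, Rmin a b <= t <= Rmax a b -> Ccont u t).
  { intros t. rewrite Rmin_left, Rmax_right by auto. auto. }
  rewrite Cmod_norm.
  eapply (norm_RInt_le (V := C_R_CompleteNormedModule) u (fun t => Cmod (u t)) a b); auto.
  - intros x _. rewrite Cmod_norm. apply Rle_refl.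
  - apply (RInt_correct (V := C_R_CompleteNormedModule)). now apply CI_ex.
  - apply (RInt_correct (V := R_CompleteNormedModule)). apply (ex_RInt_continuous (V := R_CompleteNormedModule)). intros. apply Ccont_Cmod. auto.
Qed.

Lemma CI_norm_const (u : R -> C) a b M :
  a <= b -> (forall t, a <= t <= b -> Ccont u t) -> (forall t, a <= t <= b -> Cmod (u t) <= M) ->
  Cmod (CI u a b) <= (b - a) * M.
Proof.
  intros Hab H HM.
  assert (Hm : forall t, Rmin a b <= t <= Rmax a b -> Ccont u t).
  { intros t. rewrite Rmin_left, Rmax_right by auto. auto. }
  rewrite Cmod_norm.
  eapply (norm_RInt_le_const (V := C_R_CompleteNormedModule) u a b); auto.
  - intros x Hx. specialize (HM x Hx). now rewrite Cmod_norm in HM.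
  - apply (RInt_correct (V := C_R_CompleteNormedModule)). now apply CI_ex.
Qed.

Definition Cderiv (u : R -> C) (t : R) (l : C) : Prop :=
  forall eps, 0 < eps -> exists d, 0 < d /\
    forall s, Rabs (s - t) < d -> Cmod (u s - u t - RtoC (s - t) * l) <= eps * Rabs (s - t).

Lemma Cderiv_is_derive (u : R -> C) t l :
  Cderiv u t l -> is_derive (K := R_AbsRing) (V := C_R_CompleteNormedModule) u t l.
Proof.
  intros H. split.
  - apply is_linear_scal_l.
  - intros x Hx.
    assert (Hxz : t = x) by exact (is_filter_lim_locally_unique (K := R_AbsRing) (V := R_NormedModule) t x Hx).
    subst x. intros eps.
    destruct (H eps (cond_pos eps)) as [d [Hd Hd']].
    exists (mkposreal d Hd). intros w Hw.
    specialize (Hd' w Hw). rewrite Cmod_norm in Hd'.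
    rewrite <- (scal_R_Cmult (w - t) l) in Hd'. exact Hd'.
Qed.

Lemma CI_FTC (u du : R -> C) a b :
  (forall t, Rmin a b <= t <= Rmax a b -> Cderiv u t (du t)) ->
  (forall t, Rmin a b <= t <= Rmax a b -> Ccont du t) ->
  CI du a b = (u b - u a)%C.
Proof.
  intros Hu Hd. apply (is_RInt_unique (V := C_R_CompleteNormedModule)).
  apply (is_RInt_derive (V := C_R_CompleteNormedModule) u du).
  - intros. apply Cderiv_is_derive. auto.
  - intros. apply Ccont_continuous. auto.
Qed.

Lemma Cderiv_pair (u v : R -> R) t du dv :
  is_derive u t du -> is_derive v t dv -> Cderiv (fun s => (u s, v s)) t (du, dv).
Proof.
  intros Hu Hv eps He. assert (He2 : 0 < eps / 2) by lra.
  destruct Hu as [_ Hu]. destruct Hv as [_ Hv].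
  destruct (Hu t (fun P h => h) (mkposreal _ He2)) as [d1 H1].
  destruct (Hv t (fun P h => h) (mkposreal _ He2)) as [d2 H2].
  exists (Rmin d1 d2). split. apply Rmin_glb_lt; apply cond_pos.
  intros s Hs.
  assert (K1 : Rabs (u s - u t - (s - t) * du) <= eps / 2 * Rabs (s - t)) by (apply (H1 s); exact (Rlt_le_trans _ _ _ Hs (Rmin_l _ _))).
  assert (K2 : Rabs (v s - v t - (s - t) * dv) <= eps / 2 * Rabs (s - t)) by (apply (H2 s); exact (Rlt_le_trans _ _ _ Hs (Rmin_r _ _))).
  replace ((u s, v s) - (u t, v t) - (s - t)%R * (du, dv))%C with
    (u s - u t - (s - t) * du, v s - v t - (s - t) * dv).
  eapply Rle_trans. apply Cmod_pair_le. lra.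
  unfold Cminus, Cplus, Copp, Cmult, RtoC; simpl. f_equal; ring.
Qed.

Lemma Cderiv_circ r t : Cderiv (circ r) t (Ci * circ r t).
Proof.
  replace (Ci * circ r t)%C with (r * - sin t, r * cos t).
  - apply (Cderiv_pair (fun s => r * cos s) (fun s => r * sin s)).
    + apply (is_derive_scal cos t r (- sin t)). apply is_derive_cos.
    + apply (is_derive_scal sin t r (cos t)). apply is_derive_sin.
  - unfold Ci, circ, Cmult; simpl. f_equal; ring.
Qed.

(** * Goursat's lemma *)

Lemma two_pow_pos n : 0 < 2 ^ n.
Proof. apply pow_lt; lra. Qed.

Lemma half_pow_S (S : R) n : S / 2 ^ n = S / 2 ^ (n + 1) + S / 2 ^ (n + 1).
Proof. rewrite pow_add. simpl. field. apply pow_nonzero; lra. Qed.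

(** The supremum of the increasing left ends is below every right end, because the right ends
    decrease. *)
Lemma nested_intervals (x : nat -> R) (S : R) :
  (forall n, x n <= x (Datatypes.S n)) ->
  (forall n, x (Datatypes.S n) + S / 2 ^ Datatypes.S n <= x n + S / 2 ^ n) -> 0 <= S ->
  exists l, forall n, x n <= l <= x n + S / 2 ^ n.
Proof.
  intros H1 H2 HS.
  assert (H0 : forall n, 0 <= S / 2 ^ n).
  { intro n. apply Rmult_le_pos; auto. left. apply Rinv_0_lt_compat, two_pow_pos. }
  assert (M1 : forall n k, x n <= x (n + k)%nat).
  { intros n k. induction k. rewrite Nat.add_0_r. lra. rewrite Nat.add_succ_r. specialize (H1 (n + k)%nat). lra. }
  assert (M2 : forall n k, x (n + k)%nat + S / 2 ^ (n + k) <= x n + S / 2 ^ n).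
  { intros n k. induction k. rewrite Nat.add_0_r. lra. rewrite Nat.add_succ_r. specialize (H2 (n + k)%nat). lra. }
  assert (M3 : forall n m, x m <= x n + S / 2 ^ n).
  { intros n m. destruct (Nat.le_ge_cases n m) as [L|L].
    - replace m with (n + (m - n))%nat by lia.
      specialize (M2 n (m - n)%nat). specialize (H0 (n + (m - n))%nat). lra.
    - specialize (M1 m (n - m)%nat). replace (m + (n - m))%nat with n in M1 by lia.
      specialize (H0 n). lra. }
  destruct (completeness (fun y => exists n, y = x n)) as [l [Hl1 Hl2]].
  - exists (x 0%nat + S / 2 ^ 0). intros y [n ->]. apply M3.
  - exists (x 0%nat). now exists 0%nat.
  - exists l. intro n. split.
    + apply Hl1. now exists n.
    + apply Hl2. intros y [m ->]. apply M3.
Qed.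

(** [P n x y] speaks of the rectangle with lower left corner (x, y) and sides S/2^n, T/2^n. If the
    initial rectangle were bad, some quarter of it would be bad, and so on; the bad rectangles
    shrink to a point, near which the local hypothesis makes small rectangles good. *)
Lemma bisection (P : nat -> R -> R -> Prop) (S T x0 y0 : R) :
  0 <= S -> 0 <= T ->
  (forall n x y, P (n + 1)%nat x y -> P (n + 1)%nat (x + S / 2 ^ (n + 1)) y ->
     P (n + 1)%nat x (y + T / 2 ^ (n + 1)) ->
     P (n + 1)%nat (x + S / 2 ^ (n + 1)) (y + T / 2 ^ (n + 1)) -> P n x y) ->
  (forall x y, x0 <= x <= x0 + S -> y0 <= y <= y0 + T -> exists N, forall n x' y', (N <= n)%nat ->
     x' <= x <= x' + S / 2 ^ n -> y' <= y <= y' + T / 2 ^ n -> P n x' y') ->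
  P 0%nat x0 y0.
Proof.
  intros HS HT Hsplit Hloc. apply NNPP. intro HN.
  (* The badness of the rectangle is a premise inside the existential, so that the choice of a bad
     quarter becomes a total function of level and corner. *)
  assert (Hch : forall a : nat * (R * R), exists b : R * R,
    ~ P (fst a) (fst (snd a)) (snd (snd a)) ->
    ~ P (fst a + 1)%nat (fst b) (snd b) /\
    (fst b = fst (snd a) \/ fst b = fst (snd a) + S / 2 ^ (fst a + 1)) /\
    (snd b = snd (snd a) \/ snd b = snd (snd a) + T / 2 ^ (fst a + 1))).
  { intros [n [x y]]; simpl.
    destruct (classic (P (n + 1)%nat x y)) as [A|A]; [|exists (x, y); simpl; auto].
    destruct (classic (P (n + 1)%nat (x + S / 2 ^ (n + 1)) y)) as [B|B]; [|eexists (_, _); simpl; split; [exact B|auto]].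
    destruct (classic (P (n + 1)%nat x (y + T / 2 ^ (n + 1)))) as [D|D]; [|eexists (_, _); simpl; split; [exact D|auto]].
    destruct (classic (P (n + 1)%nat (x + S / 2 ^ (n + 1)) (y + T / 2 ^ (n + 1)))) as [E|E]; [|eexists (_, _); simpl; split; [exact E|auto]].
    exists (x, y). intro F. exfalso. apply F. now apply Hsplit. }
  apply choice in Hch. destruct Hch as [nx Hnx].
  set (z := fix z n := match n with O => (x0, y0) | Datatypes.S m => nx (m, z m) end).
  assert (Hz : forall n, ~ P n (fst (z n)) (snd (z n))).
  { induction n; [exact HN|]. simpl. replace (Datatypes.S n) with (n + 1)%nat by lia.
    apply (Hnx (n, z n)). exact IHn. }
  assert (Hx : forall n, fst (z (Datatypes.S n)) = fst (z n) \/ fst (z (Datatypes.S n)) = fst (z n) + S / 2 ^ (n + 1)).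
  { intro n. apply (Hnx (n, z n)). apply Hz. }
  assert (Hy : forall n, snd (z (Datatypes.S n)) = snd (z n) \/ snd (z (Datatypes.S n)) = snd (z n) + T / 2 ^ (n + 1)).
  { intro n. apply (Hnx (n, z n)). apply Hz. }
  assert (HSn : forall n, 0 <= S / 2 ^ n).
  { intro n. apply Rmult_le_pos; auto. left. apply Rinv_0_lt_compat, two_pow_pos. }
  assert (HTn : forall n, 0 <= T / 2 ^ n).
  { intro n. apply Rmult_le_pos; auto. left. apply Rinv_0_lt_compat, two_pow_pos. }
  destruct (nested_intervals (fun n => fst (z n)) S) as [lx Hlx]; auto.
  { intro n. specialize (HSn (n + 1)%nat). destruct (Hx n); lra. }
  { intro n. replace (Datatypes.S n) with (n + 1)%nat at 2 by lia.
    rewrite (half_pow_S S n). specialize (HSn (n + 1)%nat). destruct (Hx n); lra. }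
  destruct (nested_intervals (fun n => snd (z n)) T) as [ly Hly]; auto.
  { intro n. specialize (HTn (n + 1)%nat). destruct (Hy n); lra. }
  { intro n. replace (Datatypes.S n) with (n + 1)%nat at 2 by lia.
    rewrite (half_pow_S T n). specialize (HTn (n + 1)%nat). destruct (Hy n); lra. }
  destruct (Hloc lx ly) as [N HNn].
  { specialize (Hlx 0%nat). simpl in Hlx. lra. }
  { specialize (Hly 0%nat). simpl in Hly. lra. }
  apply (Hz N). apply HNn; auto.
Qed.

(** A chord is at most its arc: [circ r] has speed r. *)
Lemma circ_lipschitz r t u : 0 <= r -> Cmod (circ r t - circ r u) <= r * Rabs (t - u).
Proof.
  intro Hr.
  assert (H : forall a b, a <= b -> Cmod (circ r b - circ r a) <= r * (b - a)).
  { intros a b Hab. rewrite <- (CI_FTC (circ r) (fun t => Ci * circ r t)%C a b).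
    - rewrite (Rmult_comm r). apply CI_norm_const; auto.
      + intros s _. apply Ccont_mult. apply Ccont_const. apply Ccont_circ.
      + intros s _. rewrite Cmod_mult, Cmod_Ci, Cmod_circ by auto. lra.
    - intros. apply Cderiv_circ.
    - intros s _. apply Ccont_mult. apply Ccont_const. apply Ccont_circ. }
  destruct (Rle_dec u t) as [L|L].
  - rewrite Rabs_pos_eq by lra. now apply H.
  - rewrite Cmod_minus_sym, Rabs_minus_sym, Rabs_pos_eq by lra. apply H. lra.
Qed.

Section Goursat.

Variables (rho : R) (a : C).
Hypothesis Hrho : 0 < rho.
Hypothesis Ha : Cmod a < rho.

(** [W] contracts the circle (s = 1) radially to [a] (s = 0), and [q] is the logarithmic derivative
    of [gam]. Under [W] the form dw/(w - a) becomes ds/s + q(t) dt: the two variables separate, and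
    the singularity at [a] appears only as 1/s. *)
Let gam (t : R) : C := (circ rho t - a)%C.
Let W (s t : R) : C := (a + RtoC s * gam t)%C.
Let q (t : R) : C := (Ci * circ rho t / gam t)%C.

Lemma gam_low t : rho - Cmod a <= Cmod (gam t).
Proof.
  assert (H := Cmod_triangle_minus (circ rho t) a). rewrite Cmod_circ in H by lra. exact H.
Qed.

Lemma gam_neq0 t : gam t <> 0%C.
Proof. apply Cmod_gt_0. assert (H := gam_low t). lra. Qed.

Lemma gam_up t : Cmod (gam t) <= 2 * rho.
Proof.
  unfold gam, Cminus. eapply Rle_trans. apply Cmod_triangle. rewrite Cmod_opp, Cmod_circ; lra.
Qed.

Lemma W_bound s t : 0 <= s <= 1 -> Cmod (W s t) <= rho.
Proof.
  intro Hs. replace (W s t) with (RtoC (1 - s) * a + RtoC s * circ rho t)%C.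
  - eapply Rle_trans. apply Cmod_triangle.
    rewrite !Cmod_mult, !Cmod_RtoC_pos, Cmod_circ by lra. nra.
  - unfold W, gam. rewrite RtoC_minus. ring.
Qed.

Lemma Ccont_gam t : Ccont gam t.
Proof. apply Ccont_minus. apply Ccont_circ. apply Ccont_const. Qed.

Lemma Ccont_q t : Ccont q t.
Proof.
  apply Ccont_div. apply Ccont_mult. apply Ccont_const. apply Ccont_circ. apply Ccont_gam. apply gam_neq0.
Qed.

Lemma q_bound t : Cmod (q t) <= rho / (rho - Cmod a).
Proof.
  unfold q. rewrite Cmod_div by apply gam_neq0. rewrite Cmod_mult, Cmod_Ci, Cmod_circ, Rmult_1_l by lra.
  apply Rmult_le_compat_l. lra. apply Rinv_le_contravar. lra. apply gam_low.
Qed.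

Definition okf (f : C -> C) := forall w, Cmod w <= rho -> CCcont f w.

Lemma Ccont_Ws f s t : okf f -> 0 <= s <= 1 -> Ccont (fun s => f (W s t)) s.
Proof.
  intros Hf Hs. apply (Ccont_comp f (fun s => W s t)).
  - apply Ccont_plus. apply Ccont_const. apply Ccont_mult. apply Ccont_RtoC. apply Ccont_const.
  - apply Hf. now apply W_bound.
Qed.

Lemma Ccont_Wt f s t : okf f -> 0 <= s <= 1 -> Ccont (fun t => f (W s t)) t.
Proof.
  intros Hf Hs. apply (Ccont_comp f (fun t => W s t)).
  - apply Ccont_plus. apply Ccont_const. apply Ccont_mult. apply Ccont_const. apply Ccont_gam.
  - apply Hf. now apply W_bound.
Qed.

(* The integral of the pullback of [f(w) dw / (w - a)] over the boundary of a parameter rectangle. *)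
Definition Phi (f : C -> C) (s0 s1 t0 t1 : R) : C :=
  (CI (fun s => (f (W s t0) - f (W s t1)) / RtoC s) s0 s1 +
   CI (fun t => (f (W s1 t) - f (W s0 t)) * q t) t0 t1)%C.

Lemma Ccont_Phi1 f s t0 t1 : okf f -> 0 < s <= 1 ->
  Ccont (fun s => (f (W s t0) - f (W s t1)) / RtoC s)%C s.
Proof.
  intros Hf Hs. apply Ccont_div. apply Ccont_minus; apply Ccont_Ws; auto; lra.
  apply Ccont_RtoC. intro E. apply RtoC_inj in E. lra.
Qed.

Lemma Ccont_Phi2 f s0 s1 t : okf f -> 0 <= s0 <= 1 -> 0 <= s1 <= 1 ->
  Ccont (fun t => (f (W s1 t) - f (W s0 t)) * q t)%C t.
Proof.
  intros Hf Hs Hs'. apply Ccont_mult. apply Ccont_minus; apply Ccont_Wt; auto. apply Ccont_q.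
Qed.

Lemma Phi_split_s f s0 s1 s2 t0 t1 : okf f -> 0 < s0 <= s1 -> s1 <= s2 <= 1 ->
  Phi f s0 s2 t0 t1 = (Phi f s0 s1 t0 t1 + Phi f s1 s2 t0 t1)%C.
Proof.
  intros Hf H1 H2. unfold Phi.
  rewrite <- (CI_Chasles _ s0 s1 s2).
  2,3: intros s; rewrite Rmin_left, Rmax_right by lra; intro; apply Ccont_Phi1; auto; lra.
  rewrite (CI_ext (fun t => (f (W s2 t) - f (W s0 t)) * q t)%C
     (fun t => (f (W s1 t) - f (W s0 t)) * q t + (f (W s2 t) - f (W s1 t)) * q t)%C).
  2: intros; ring.
  rewrite CI_plus. ring.
  all: intros; apply Ccont_Phi2; auto; lra.
Qed.

Lemma Phi_split_t f s0 s1 t0 t1 t2 : okf f -> 0 < s0 <= s1 -> s1 <= 1 ->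
  Phi f s0 s1 t0 t2 = (Phi f s0 s1 t0 t1 + Phi f s0 s1 t1 t2)%C.
Proof.
  intros Hf H1 H2. unfold Phi.
  rewrite <- (CI_Chasles _ t0 t1 t2).
  2,3: intros; apply Ccont_Phi2; auto; lra.
  rewrite (CI_ext (fun s => (f (W s t0) - f (W s t2)) / RtoC s)%C
     (fun s => (f (W s t0) - f (W s t1)) / RtoC s + (f (W s t1) - f (W s t2)) / RtoC s)%C).
  2: intros; unfold Cdiv; ring.
  rewrite CI_plus. ring.
  all: intros s; rewrite Rmin_left, Rmax_right by lra; intro; apply Ccont_Phi1; auto; lra.
Qed.

Lemma Phi_plus f h s0 s1 t0 t1 : okf f -> okf h -> 0 < s0 <= s1 -> s1 <= 1 ->
  Phi (fun w => f w + h w)%C s0 s1 t0 t1 = (Phi f s0 s1 t0 t1 + Phi h s0 s1 t0 t1)%C.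
Proof.
  intros Hf Hh H1 H2. unfold Phi.
  rewrite (CI_ext _ (fun s => (f (W s t0) - f (W s t1)) / RtoC s + (h (W s t0) - h (W s t1)) / RtoC s)%C).
  2: intros; unfold Cdiv; ring.
  rewrite (CI_ext (fun t => (f (W s1 t) + h (W s1 t) - (f (W s0 t) + h (W s0 t))) * q t)%C
    (fun t => (f (W s1 t) - f (W s0 t)) * q t + (h (W s1 t) - h (W s0 t)) * q t)%C).
  2: intros; ring.
  rewrite !CI_plus. ring.
  1,2: intros; apply Ccont_Phi2; auto; lra.
  all: intros s; rewrite Rmin_left, Rmax_right by lra; intro; apply Ccont_Phi1; auto; lra.
Qed.

Lemma okf_affine A l : okf (fun w => A + l * (w - a))%C.
Proof.
  intros w _. apply (Cdiff_CCcont _ _ (0 + (0 * (w - a) + l * (1 + 0)))).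
  apply Cdiff_plus. apply Cdiff_const. 
  apply (Cdiff_mult (fun _ => l) (fun w => w - a)%C). apply Cdiff_const.
  apply Cdiff_plus. apply Cdiff_id. apply Cdiff_const.
Qed.

(** The constant [A] drops out because values on opposite sides are subtracted; the linear part
    cancels the pole and leaves l dw, which is exact. *)
Lemma Phi_affine A l s0 s1 t0 t1 : 0 < s0 <= s1 -> s1 <= 1 ->
  Phi (fun w => A + l * (w - a))%C s0 s1 t0 t1 = 0.
Proof.
  intros H1 H2. unfold Phi.
  rewrite (CI_ext _ (fun s => l * (gam t0 - gam t1))%C).
  2:{ intros s. rewrite Rmin_left, Rmax_right by lra. intro Hs. unfold W. field.
      intro E. apply RtoC_inj in E. lra. }
  rewrite (CI_ext (fun t => (A + l * (W s1 t - a) - (A + l * (W s0 t - a))) * q t)%C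
    (fun t => l * RtoC (s1 - s0) * (Ci * circ rho t))%C).
  2:{ intros t _. unfold W, q. rewrite RtoC_minus. field. apply gam_neq0. }
  rewrite CI_const, CI_scal.
  2: intros; apply Ccont_mult; [apply Ccont_const | apply Ccont_circ].
  rewrite (CI_FTC (circ rho)).
  - unfold gam. ring.
  - intros; apply Cderiv_circ.
  - intros; apply Ccont_mult; [apply Ccont_const | apply Ccont_circ].
Qed.

(** Perimeter times size of f. The kernel 1/s is bounded only for s above [sig], which is why the
    deformation stops short of the centre. *)
Lemma Phi_bound f s0 s1 t0 t1 sig B : okf f -> 0 < sig -> sig <= s0 <= s1 -> s1 <= 1 -> t0 <= t1 ->
  (forall s t, s0 <= s <= s1 -> t0 <= t <= t1 -> Cmod (f (W s t)) <= B) ->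
  Cmod (Phi f s0 s1 t0 t1) <= (s1 - s0) * (2 * B / sig) + (t1 - t0) * (2 * B * (rho / (rho - Cmod a))).
Proof.
  intros Hf Hsig H1 H2 Ht HB.
  assert (HD : forall s t s' t', s0 <= s <= s1 -> t0 <= t <= t1 -> s0 <= s' <= s1 -> t0 <= t' <= t1 ->
     Cmod (f (W s t) - f (W s' t')) <= 2 * B).
  { intros. unfold Cminus. eapply Rle_trans. apply Cmod_triangle. rewrite Cmod_opp.
    assert (K1 := HB s t). assert (K2 := HB s' t'). 
    specialize (K1 ltac:(lra) ltac:(lra)). specialize (K2 ltac:(lra) ltac:(lra)). lra. }
  unfold Phi. eapply Rle_trans. apply Cmod_triangle. apply Rplus_le_compat.
  - apply CI_norm_const. lra. intros; apply Ccont_Phi1; auto; lra.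
    intros s Hs. rewrite Cmod_div by (intro E; apply RtoC_inj in E; lra).
    rewrite Cmod_RtoC_pos by lra. unfold Rdiv. apply Rmult_le_compat. apply Cmod_ge_0.
    left; apply Rinv_0_lt_compat; lra. apply HD; lra. apply Rinv_le_contravar; lra.
  - apply CI_norm_const. lra. intros; apply Ccont_Phi2; auto; lra.
    intros t Htt. rewrite Cmod_mult. apply Rmult_le_compat; auto using Cmod_ge_0. apply HD; lra. apply q_bound.
Qed.

Lemma W_near s t s' t' : 0 <= s' <= 1 ->
  Cmod (W s t - W s' t') <= 2 * rho * Rabs (s - s') + rho * Rabs (t - t').
Proof.
  intro Hs. replace (W s t - W s' t')%C with
    (RtoC (s - s') * gam t + RtoC s' * (circ rho t - circ rho t'))%C.
  - eapply Rle_trans. apply Cmod_triangle. rewrite !Cmod_mult, Cmod_R, (Cmod_RtoC_pos s') by lra.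
    assert (K1 := gam_up t). assert (K2 := circ_lipschitz rho t t').
    specialize (K2 ltac:(lra)). assert (K3 := Rabs_pos (s - s')).
    assert (K4 := Cmod_ge_0 (circ rho t - circ rho t')). nra.
  - unfold W, gam. rewrite RtoC_minus. ring.
Qed.

Lemma Goursat f sig : (forall w, Cmod w <= rho -> exists l, Cdiff f w l) -> 0 < sig < 1 ->
  Phi f sig 1 0 (2 * PI) = 0.
Proof.
  intros Hf Hsig.
  assert (Hok : okf f). { intros w Hw. destruct (Hf w Hw) as [l Hl]. eapply Cdiff_CCcont, Hl. }
  assert (HPI := PI_pos2).
  apply Cmod_eq_0. apply Rle_antisym; [|apply Cmod_ge_0]. apply le_epsilon. intros e He. rewrite Rplus_0_l.
  set (S := 1 - sig). set (T := 2 * PI).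
  assert (HS : 0 < S) by (unfold S; lra).
  (* The four quarters of a rectangle may each use a quarter of its budget, hence e/4^n. The side
     conditions keep s between [sig] and 1. *)
  set (P := fun n x y => sig <= x -> x + S / 2 ^ n <= 1 ->
      Cmod (Phi f x (x + S / 2 ^ n) y (y + T / 2 ^ n)) <= e / 4 ^ n).
  assert (HSn : forall n, 0 < S / 2 ^ n).
  { intro n. apply Rmult_lt_0_compat; auto. apply Rinv_0_lt_compat, two_pow_pos. }
  assert (HTn : forall n, 0 < T / 2 ^ n).
  { intro n. apply Rmult_lt_0_compat; auto. apply Rinv_0_lt_compat, two_pow_pos. }
  assert (HP : P 0%nat sig 0).
  { apply (bisection P S T sig 0); unfold P; try lra.
    - unfold T; lra.
    - intros n x y P1 P2 P3 P4 Hx1 Hx2.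
      assert (K := HSn (n + 1)%nat). assert (K' := half_pow_S S n).
      specialize (P1 ltac:(lra) ltac:(lra)). specialize (P2 ltac:(lra) ltac:(lra)).
      specialize (P3 ltac:(lra) ltac:(lra)). specialize (P4 ltac:(lra) ltac:(lra)).
      rewrite K', (half_pow_S T n), <- !Rplus_assoc.
      rewrite (Phi_split_s f x (x + S / 2 ^ (n + 1))) by (auto; lra).
      rewrite (Phi_split_t f x (x + S / 2 ^ (n + 1)) y (y + T / 2 ^ (n + 1))) by (auto; lra).
      rewrite (Phi_split_t f (x + S / 2 ^ (n + 1)) (x + S / 2 ^ (n + 1) + S / 2 ^ (n + 1)) y (y + T / 2 ^ (n + 1))) by (auto; lra).
      assert (E4 : e / 4 ^ n = 4 * (e / 4 ^ (n + 1))).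
      { rewrite pow_add. simpl. field. apply pow_nonzero; lra. }
      rewrite E4.
      eapply Rle_trans. apply Cmod_triangle.
      eapply Rle_trans. apply Rplus_le_compat; apply Cmod_triangle. lra.
    - intros x y Hx Hy.
      assert (Hx' : sig <= x <= 1) by (unfold S in Hx; lra).
      destruct (Hf (W x y)) as [l Hl]. { apply W_bound; lra. }
      (* M/2^n bounds the diameter of the image of a level-n rectangle. [K] below is chosen so that
         a differentiability error e/K times this diameter, multiplied by the level-n perimeter
         terms of [Phi_bound], is exactly e/4^n. *)
      set (M := rho * (2 * S + T)).
      set (Q := rho / (rho - Cmod a)).
      assert (HQ : 0 < Q) by (apply Rdiv_lt_0_compat; lra).
      assert (HM : 0 < M) by (unfold M; apply Rmult_lt_0_compat; unfold T; lra).
      set (K := 2 * M * (S / sig + T * Q)).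
      assert (HK : 0 < K).
      { unfold K. apply Rmult_lt_0_compat. lra. apply Rplus_lt_0_compat.
        apply Rdiv_lt_0_compat; lra. apply Rmult_lt_0_compat; unfold T; lra. }
      destruct (Hl (e / K)) as [d [Hd Hd']]. { apply Rdiv_lt_0_compat; lra. }
      destruct (pow_lt_1_zero (/ 2)) with (y := d / M) as [N HN].
      { rewrite Rabs_pos_eq; lra. } { apply Rdiv_lt_0_compat; lra. }
      exists N. intros n x' y' Hn Hxx Hyy Hs1 Hs2.
      specialize (HN n Hn). rewrite <- RPow_abs, Rabs_pos_eq, pow_inv in HN by lra.
      assert (HMd : M / 2 ^ n < d). { apply Rlt_div_r in HN; auto. unfold Rdiv. lra. }
      set (fs := f (W x y)).
      (* The affine part of f at W x y has zero boundary integral, so only the small remainder [E]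
         has to be estimated. *)
      set (E := fun w => (f w - fs - l * (w - W x y))%C).
      assert (HokE : okf E).
      { intros w Hw. destruct (Hf w Hw) as [m Hm].
        apply (Cdiff_CCcont _ _ (m + 0 + (- (l)) * 1 + 0)%C).
        apply (Cdiff_ext (fun w => ((f w + - fs) + (- l) * (w + 0)) + l * W x y)%C _ w _ 1). lra.
        intros; unfold E; ring.
        apply Cdiff_plus; [apply Cdiff_plus; [apply Cdiff_plus; [auto|apply Cdiff_const]|]|apply Cdiff_const].
        replace (- l * 1)%C with (0 * (w + 0) + - l * (1 + 0))%C by ring.
        apply (Cdiff_mult (fun _ => (- l)%C) (fun w => w + 0)%C). apply Cdiff_const.
        apply Cdiff_plus. apply Cdiff_id. apply Cdiff_const. }
      assert (HPE : Phi f x' (x' + S / 2 ^ n) y' (y' + T / 2 ^ n) = Phi E x' (x' + S / 2 ^ n) y' (y' + T / 2 ^ n)).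
      { replace f with (fun w => E w + ((fs + l * (a - W x y)) + l * (w - a)))%C at 1.
        rewrite Phi_plus, Phi_affine; try lra; try apply okf_affine; auto. ring.
        apply functional_extensionality. intro w. unfold E. ring. }
      rewrite HPE.
      assert (K1 := HSn n). assert (K2 := HTn n).
      eapply Rle_trans. apply (Phi_bound E _ _ _ _ sig (e / K * (M / 2 ^ n))); auto; try lra.
      + intros s t Hs Ht.
        assert (HW : Cmod (W s t - W x y) <= M / 2 ^ n).
        { eapply Rle_trans. apply W_near. lra.
          replace (M / 2 ^ n) with (2 * rho * (S / 2 ^ n) + rho * (T / 2 ^ n)).
          apply Rplus_le_compat; apply Rmult_le_compat_l; try lra; apply Rabs_le; lra.
          unfold M. field. apply pow_nonzero; lra. }
        unfold E, fs. eapply Rle_trans. apply Hd'. lra.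
        apply Rmult_le_compat_l; auto. left. apply Rdiv_lt_0_compat; lra.
      + right. fold Q. replace (x' + S / 2 ^ n - x') with (S / 2 ^ n) by ring.
        replace (y' + T / 2 ^ n - y') with (T / 2 ^ n) by ring.
        replace (4 ^ n) with (2 ^ n * 2 ^ n) by (rewrite <- Rpow_mult_distr; f_equal; lra).
        unfold K. field. repeat split; try lra. apply pow_nonzero; lra.
        apply Rgt_not_eq. apply Rplus_lt_0_compat. lra. apply Rmult_lt_0_compat; [|lra].
        apply Rmult_lt_0_compat; unfold T; lra. }
  specialize (HP ltac:(lra)). simpl in HP.
  replace (sig + S / 1) with 1 in HP by (unfold S; field).
  replace (0 + T / 1) with (2 * PI) in HP by (unfold T; field).
  specialize (HP ltac:(lra)). unfold Rdiv in HP; rewrite Rinv_1, Rmult_1_r in HP. exact HP.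
Qed.

(** Over a full turn the sides t = 0 and t = 2 PI cancel since [circ] closes up; only the two
    circles s = sig and s = 1 remain. *)
Lemma Cauchy_shrink f sig : (forall w, Cmod w <= rho -> exists l, Cdiff f w l) -> 0 < sig < 1 ->
  CI (fun t => f (W 1 t) * q t)%C 0 (2 * PI) = CI (fun t => f (W sig t) * q t)%C 0 (2 * PI).
Proof.
  intros Hf Hs. assert (H := Goursat f sig Hf Hs).
  assert (Hok : okf f). { intros w Hw. destruct (Hf w Hw) as [l Hl]. eapply Cdiff_CCcont, Hl. }
  unfold Phi in H.
  rewrite (CI_ext _ (fun _ => RtoC 0)) in H.
  2:{ intros s _. unfold W, gam. rewrite circ_2PI. unfold Cdiv. ring. }
  rewrite CI_const in H.
  rewrite (CI_ext _ (fun t => f (W 1 t) * q t - f (W sig t) * q t)%C) in H by (intros; ring).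
  rewrite CI_minus in H. 
  2,3: intros; apply Ccont_mult; [apply Ccont_Wt; auto; lra | apply Ccont_q].
  rewrite Cmult_0_r, Cplus_0_l in H. apply Ceq_minus in H. exact H.
Qed.

(** On the circle shrunk by a small [sig], f is uniformly close to f a by continuity at [a]. The
    winding integral of [q] is left unevaluated here; [kernel_int] supplies its value. *)
Lemma Cauchy_center f : (forall w, Cmod w <= rho -> exists l, Cdiff f w l) ->
  CI (fun t => f (W 1 t) * q t)%C 0 (2 * PI) = (f a * CI q 0 (2 * PI))%C.
Proof.
  intros Hf.
  assert (Hok : okf f). { intros w Hw. destruct (Hf w Hw) as [l Hl]. eapply Cdiff_CCcont, Hl. }
  rewrite <- CI_scal by (intros; apply Ccont_q).
  apply Ceq_minus. apply Cmod_eq_0. apply Rle_antisym; [|apply Cmod_ge_0].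
  apply le_epsilon. intros e He. rewrite Rplus_0_l.
  set (Q := rho / (rho - Cmod a)). assert (HQ : 0 < Q) by (apply Rdiv_lt_0_compat; lra).
  assert (HPI := PI_pos2).
  destruct (Hok a (Rlt_le _ _ Ha) (e / (2 * PI * Q))) as [d [Hd Hd']].
  { apply Rdiv_lt_0_compat; auto. apply Rmult_lt_0_compat; auto. }
  set (sig := Rmin (1 / 2) (d / (4 * rho))).
  assert (Hs : 0 < sig < 1).
  { split. apply Rmin_glb_lt. lra. apply Rdiv_lt_0_compat; lra. eapply Rle_lt_trans. apply Rmin_l. lra. }
  rewrite (Cauchy_shrink f sig Hf Hs).
  rewrite <- CI_minus.
  2,3: intros; apply Ccont_mult; [first [apply Ccont_Wt; auto; lra| apply Ccont_const] | apply Ccont_q].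
  eapply Rle_trans. apply (CI_norm_const _ _ _ (e / (2 * PI * Q) * Q)). lra.
  - intros; apply Ccont_minus; apply Ccont_mult; try apply Ccont_q; [apply Ccont_Wt; auto; lra| apply Ccont_const].
  - intros t _. replace (f (W sig t) * q t - f a * q t)%C with ((f (W sig t) - f a) * q t)%C by ring.
    rewrite Cmod_mult. apply Rmult_le_compat; auto using Cmod_ge_0.
    + left. apply Hd'. unfold W. replace (a + sig * gam t - a)%C with (sig * gam t)%C by ring.
      rewrite Cmod_mult, Cmod_RtoC_pos by lra.
      apply Rle_lt_trans with (d / (4 * rho) * (2 * rho)).
      apply Rmult_le_compat; auto using Cmod_ge_0, gam_up. lra. apply Rmin_r.
      replace (d / (4 * rho) * (2 * rho)) with (d / 2) by (field; lra). lra.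
    + apply q_bound.
  - right. field. split; lra.
Qed.

End Goursat.

(** * Cauchy's formula and its consequences *)

Lemma CI_conj (u : R -> C) a b :
  (forall t, Rmin a b <= t <= Rmax a b -> Ccont u t) ->
  CI (fun t => Cconj (u t)) a b = Cconj (CI u a b).
Proof.
  intro H. apply CI_ex in H.
  apply (RInt_correct (V := C_R_CompleteNormedModule)) in H. fold (CI u a b) in H.
  apply (is_RInt_unique (V := C_R_CompleteNormedModule)).
  set (I := CI u a b) in *. clearbody I.
  assert (H1 := is_RInt_fct_extend_fst (U := R_NormedModule) (V := R_NormedModule) u a b I H).
  assert (H2 := is_RInt_fct_extend_snd (U := R_NormedModule) (V := R_NormedModule) u a b I H).
  apply (is_RInt_fct_extend_pair (U := R_NormedModule) (V := R_NormedModule)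
    (fun t => Cconj (u t)) a b (fst I) (- snd I)).
  - exact H1.
  - exact (is_RInt_opp _ a b _ H2).
Qed.

Lemma circ_minus_neq0 rho a t : 0 <= rho -> Cmod a < rho -> (circ rho t - a)%C <> 0%C.
Proof.
  intros H0 H E. assert (K := Cmod_triangle_minus (circ rho t) a).
  rewrite E, Cmod_0, Cmod_circ in K by auto. lra.
Qed.

Lemma Ccont_kernel rho a t j : 0 <= rho -> Cmod a < rho ->
  Ccont (fun t => circ rho t / (circ rho t - a) ^ j)%C t.
Proof.
  intros H0 H. apply Ccont_div. apply Ccont_circ.
  - induction j as [|j IH]. exact (Ccont_const 1 t).
    apply Ccont_mult; auto. apply Ccont_minus. apply Ccont_circ. apply Ccont_const.
  - apply Cpow_nz. now apply circ_minus_neq0.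
Qed.

(** At the centre a = 0 the factor [q] is the constant [Ci], so the winding integral is immediate.
    This special case is what evaluates the winding integral around a general point. *)
Lemma mean_value f rho : 0 < rho -> (forall w, Cmod w <= rho -> exists l, Cdiff f w l) ->
  CI (fun t => f (circ rho t)) 0 (2 * PI) = (RtoC (2 * PI) * f 0)%C.
Proof.
  intros Hr Hf.
  assert (H := Cauchy_center rho 0 Hr).
  rewrite Cmod_0 in H. specialize (H Hr f Hf).
  rewrite (CI_ext _ (fun t => Ci * f (circ rho t))%C) in H.
  2:{ intros t _. replace (0 + 1 * (circ rho t - 0))%C with (circ rho t) by ring.
      field. rewrite <- (Cplus_0_r (circ rho t)). replace (circ rho t + 0)%C with (circ rho t - 0)%C by ring.
      apply circ_minus_neq0. lra. now rewrite Cmod_0. }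
  rewrite (CI_ext (fun t => Ci * circ rho t / (circ rho t - 0))%C (fun t => Ci)) in H.
  2:{ intros t _. field.
      replace (circ rho t) with (circ rho t - 0)%C by ring.
      apply circ_minus_neq0. lra. now rewrite Cmod_0. }
  rewrite CI_const, CI_scal in H.
  2:{ intros t _. apply Ccont_comp. apply Ccont_circ. destruct (Hf (circ rho t)) as [l Hl].
      rewrite Cmod_circ; lra. eapply Cdiff_CCcont, Hl. }
  assert (Hi := Ci_nz).
  replace (2 * PI - 0) with (2 * PI) in H by ring.
  set (I := CI _ _ _) in *.
  replace I with (Ci * I / Ci)%C by (field; auto). rewrite H. field; auto.
Qed.

(* On the circle [w = rho^2 / conj w], so the conjugate of the kernel is the analytic function [1 / (1 - conj a w / rho^2)]. *)
Lemma kernel_int rho a : 0 < rho -> Cmod a < rho ->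
  CI (fun t => circ rho t / (circ rho t - a))%C 0 (2 * PI) = RtoC (2 * PI).
Proof.
  intros Hr Ha.
  set (k := (- (Cconj a / RtoC (rho * rho)))%C).
  assert (Hrr : RtoC (rho * rho) <> 0%C). { intro E. apply RtoC_inj in E. nra. }
  assert (Hk : forall w, Cmod w <= rho -> (1 + k * w)%C <> 0%C).
  { intros w Hw E.
    assert (K := Cmod_triangle_minus 1 (- (k * w))). 
    replace (1 - - (k * w))%C with (1 + k * w)%C in K by ring.
    rewrite E, Cmod_0, Cmod_1, Cmod_opp, Cmod_mult in K. unfold k in K.
    rewrite Cmod_opp, Cmod_div, Cmod_conj, Cmod_RtoC_pos in K by (auto; nra).
    assert (Cmod a / (rho * rho) * Cmod w <= Cmod a / (rho * rho) * rho).
    { apply Rmult_le_compat_l; auto. apply Rmult_le_pos. apply Cmod_ge_0.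
      left. apply Rinv_0_lt_compat. nra. }
    replace (Cmod a / (rho * rho) * rho) with (Cmod a / rho) in H by (field; lra).
    assert (Cmod a / rho < 1) by (apply Rlt_div_l; lra). lra. }
  rewrite (CI_ext _ (fun t => Cconj (/ (1 + k * circ rho t)))).
  2:{ intros t _. assert (Hw : Cmod (circ rho t) <= rho) by (rewrite Cmod_circ; lra).
      assert (HN := circ_minus_neq0 rho a t ltac:(lra) Ha).
      assert (E : (circ rho t * Cconj (circ rho t))%C = RtoC (rho * rho)).
      { rewrite <- Cmod2_conj, Cmod_circ by lra. f_equal. ring. }
      rewrite Cinv_conj by auto.
      rewrite Cplus_conj, Cmult_conj. unfold k. rewrite Copp_conj, Cdiv_conj, Cconj_conj by auto.
      replace (Cconj 1) with (RtoC 1) by (unfold Cconj, RtoC; simpl; f_equal; ring).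
      replace (Cconj (RtoC (rho * rho))) with (RtoC (rho * rho)) by (unfold Cconj, RtoC; simpl; f_equal; ring).
      rewrite <- E.
      assert (Hc : circ rho t <> 0%C) by (apply Cmod_gt_0; rewrite Cmod_circ; lra).
      assert (Hc' : Cconj (circ rho t) <> 0%C) by (apply Cmod_gt_0; rewrite Cmod_conj, Cmod_circ; lra).
      field. repeat split; auto. }
  assert (Hd : forall w, Cmod w <= rho -> exists l, Cdiff (fun w => / (1 + k * w))%C w l).
  { intros w Hw. eexists. apply (Cdiff_inv (fun w => 1 + k * w)%C w (0 + (0 * w + k * 1))%C).
    - apply Cdiff_plus. apply Cdiff_const. apply (Cdiff_mult (fun _ => k) (fun w => w)). apply Cdiff_const. apply Cdiff_id.
    - now apply Hk. }
  rewrite CI_conj.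
  2:{ intros t _. destruct (Hd (circ rho t)) as [l Hl]. rewrite Cmod_circ; lra.
      apply (Ccont_comp (fun w => / (1 + k * w))%C). apply Ccont_circ. eapply Cdiff_CCcont, Hl. }
  rewrite (mean_value (fun w => / (1 + k * w))%C rho Hr Hd).
  replace (1 + k * 0)%C with (RtoC 1) by ring.
  replace (RtoC (2 * PI) * / RtoC 1)%C with (RtoC (2 * PI)) by field.
  unfold Cconj, RtoC; simpl. f_equal. ring.
Qed.

Lemma Cauchy_formula f rho a : 0 < rho -> Cmod a < rho ->
  (forall w, Cmod w <= rho -> exists l, Cdiff f w l) ->
  CI (fun t => f (circ rho t) * (circ rho t / (circ rho t - a)))%C 0 (2 * PI) = (RtoC (2 * PI) * f a)%C.
Proof.
  intros Hr Ha Hf.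
  assert (HN := fun t => circ_minus_neq0 rho a t (Rlt_le _ _ Hr) Ha).
  assert (Hc : forall t, Ccont (fun t => circ rho t / (circ rho t - a))%C t).
  { intro t. apply Ccont_div; auto. apply Ccont_circ. apply Ccont_minus. apply Ccont_circ. apply Ccont_const. }
  assert (H := Cauchy_center rho a Hr Ha f Hf).
  rewrite (CI_ext _ (fun t => Ci * (f (circ rho t) * (circ rho t / (circ rho t - a))))%C) in H.
  2:{ intros t _. replace (a + 1 * (circ rho t - a))%C with (circ rho t) by ring.
      field. auto. }
  rewrite (CI_ext (fun t => Ci * circ rho t / (circ rho t - a))%C (fun t => Ci * (circ rho t / (circ rho t - a)))%C) in H by (intros; field; auto).
  rewrite !CI_scal, kernel_int in H; auto.
  2:{ intros t _. apply Ccont_mult; auto. apply Ccont_comp. apply Ccont_circ. destruct (Hf (circ rho t)) as [l Hl].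
      rewrite Cmod_circ; lra. eapply Cdiff_CCcont, Hl. }
  assert (Hi := Ci_nz).
  set (I := CI _ _ _) in *.
  replace I with (Ci * I / Ci)%C by (field; auto). rewrite H. field; auto.
Qed.

Lemma Ccont_circle f rho t : 0 <= rho -> (forall w, Cmod w <= rho -> exists l, Cdiff f w l) ->
  Ccont (fun t => f (circ rho t)) t.
Proof.
  intros Hr Hf. apply Ccont_comp. apply Ccont_circ. destruct (Hf (circ rho t)) as [l Hl].
  rewrite Cmod_circ; lra. eapply Cdiff_CCcont, Hl.
Qed.

(** A Cauchy transform with unnormalised angle integral: since dw = i w dt, the values for j = 1, 2,
    3 with u the boundary values of f are 2 PI times f, f' and f''/2. The density [u] is arbitrary
    so that limits of analytic functions can be inserted. *)
Definition CT (rho : R) (u : R -> C) (j : nat) (a : C) : C :=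
  CI (fun t => u t * (circ rho t / (circ rho t - a) ^ j))%C 0 (2 * PI).

Lemma kernel_bound rho r a t j : 0 < rho -> Cmod a <= r -> r < rho ->
  Cmod (circ rho t / (circ rho t - a) ^ j)%C <= rho / (rho - r) ^ j.
Proof.
  intros H0 Ha Hr. rewrite Cmod_div, Cmod_circ, Cmod_pow by (try apply Cpow_nz; try apply circ_minus_neq0; lra).
  apply Rmult_le_compat_l. lra. apply Rinv_le_contravar. apply pow_lt; lra.
  apply pow_incr. split. lra. assert (K := Cmod_triangle_minus (circ rho t) a).
  rewrite Cmod_circ in K; lra.
Qed.

Lemma CT_bound rho r u U j a : 0 < rho -> Cmod a <= r -> r < rho ->
  (forall t, Ccont u t) -> (forall t, Cmod (u t) <= U) ->
  Cmod (CT rho u j a) <= 2 * PI * (U * (rho / (rho - r) ^ j)).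
Proof.
  intros H0 Ha Hr Hu HU. unfold CT. assert (HPI := PI_pos2).
  eapply Rle_trans. apply (CI_norm_const _ 0 (2 * PI) (U * (rho / (rho - r) ^ j))). lra.
  - intros. apply Ccont_mult; auto. apply Ccont_kernel; lra.
  - intros t _. rewrite Cmod_mult. apply Rmult_le_compat; auto using Cmod_ge_0. now apply kernel_bound.
  - right. ring.
Qed.

(** With k_a = 1/(w - a) and k_b = 1/(w - b), the remainder k_b - k_a - (b - a) k_a^2 equals (b -
    a)^2 k_a^2 k_b. *)
Lemma CT_quad1 rho r u U a b : 0 < rho -> Cmod a <= r -> Cmod b <= r -> r < rho ->
  (forall t, Ccont u t) -> (forall t, Cmod (u t) <= U) ->
  Cmod (CT rho u 1 b - CT rho u 1 a - CT rho u 2 a * (b - a)) <=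
  2 * PI * (U * (rho / (rho - r) ^ 3)) * Cmod (b - a) ^ 2.
Proof.
  intros H0 Ha Hb Hr Hu HU. assert (HPI := PI_pos2).
  assert (Hc : forall c j t, Cmod c <= r -> Ccont (fun t => u t * (circ rho t / (circ rho t - c) ^ j))%C t).
  { intros. apply Ccont_mult; auto. apply Ccont_kernel; lra. }
  assert (E : (CT rho u 1 b - CT rho u 1 a - CT rho u 2 a * (b - a))%C =
     CI (fun t => u t * (circ rho t / (circ rho t - a) ^ 2 / (circ rho t - b)) * ((b - a) * (b - a)))%C 0 (2 * PI)).
  { unfold CT. rewrite (Cmult_comm _ (b - a)), <- CI_scal, <- !CI_minus.
    - apply CI_ext. intros t _. simpl. field. split; apply circ_minus_neq0; lra.
    - intros; apply Ccont_minus; auto.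
    - intros; apply Ccont_mult. apply Ccont_const. auto.
    - auto.
    - auto.
    - auto. }
  rewrite E. eapply Rle_trans. apply (CI_norm_const _ 0 (2 * PI) (U * (rho / (rho - r) ^ 3) * Cmod (b - a) ^ 2)). lra.
  - intros. apply Ccont_mult; [|apply Ccont_const]. apply Ccont_mult; auto.
    apply Ccont_div. apply Ccont_kernel; lra. apply Ccont_minus. apply Ccont_circ. apply Ccont_const.
    apply circ_minus_neq0; lra.
  - intros t _. rewrite !Cmod_mult. replace (Cmod (b - a) ^ 2) with (Cmod (b - a) * Cmod (b - a)) by ring.
    apply Rmult_le_compat_r. apply Rmult_le_pos; apply Cmod_ge_0.
    apply Rmult_le_compat; auto using Cmod_ge_0.
    rewrite Cmod_div by (apply circ_minus_neq0; lra).
    replace (rho / (rho - r) ^ 3) with (rho / (rho - r) ^ 2 / (rho - r)) by (field; lra).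
    apply Rmult_le_compat; auto using Cmod_ge_0.
    left; apply Rinv_0_lt_compat; apply Cmod_gt_0; apply circ_minus_neq0; lra.
    apply kernel_bound; auto. apply Rinv_le_contravar. lra.
    assert (K := Cmod_triangle_minus (circ rho t) b). rewrite Cmod_circ in K; lra.
  - right. ring.
Qed.

(** The remainder of the squared kernel factors as (b - a)^2 k_a^2 k_b (k_b + 2 k_a); the last
    factor is the origin of the 3. *)
Lemma CT_quad2 rho r u U a b : 0 < rho -> Cmod a <= r -> Cmod b <= r -> r < rho ->
  (forall t, Ccont u t) -> (forall t, Cmod (u t) <= U) ->
  Cmod (CT rho u 2 b - CT rho u 2 a - 2 * CT rho u 3 a * (b - a)) <=
  2 * PI * (U * (3 * (rho / (rho - r) ^ 4))) * Cmod (b - a) ^ 2.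
Proof.
  intros H0 Ha Hb Hr Hu HU. assert (HPI := PI_pos2).
  assert (Hc : forall c j t, Cmod c <= r -> Ccont (fun t => u t * (circ rho t / (circ rho t - c) ^ j))%C t).
  { intros. apply Ccont_mult; auto. apply Ccont_kernel; lra. }
  set (ka := fun t => (/ (circ rho t - a))%C). set (kb := fun t => (/ (circ rho t - b))%C).
  assert (Ha' : forall t, (circ rho t - a)%C <> 0%C) by (intros; apply circ_minus_neq0; lra).
  assert (Hb' : forall t, (circ rho t - b)%C <> 0%C) by (intros; apply circ_minus_neq0; lra).
  assert (Cka : forall t, Ccont ka t).
  { intro. apply Ccont_inv; auto. apply Ccont_minus. apply Ccont_circ. apply Ccont_const. }
  assert (Ckb : forall t, Ccont kb t).
  { intro. apply Ccont_inv; auto. apply Ccont_minus. apply Ccont_circ. apply Ccont_const. }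
  assert (Bk : forall c t, Cmod c <= r -> Cmod (/ (circ rho t - c))%C <= / (rho - r)).
  { intros c t Hc'. rewrite Cmod_inv by (apply circ_minus_neq0; lra). apply Rinv_le_contravar. lra.
    assert (K := Cmod_triangle_minus (circ rho t) c). rewrite Cmod_circ in K; lra. }
  assert (E : (CT rho u 2 b - CT rho u 2 a - 2 * CT rho u 3 a * (b - a))%C =
     CI (fun t => u t * circ rho t * (ka t * kb t * ka t * (kb t + 2 * ka t)) * ((b - a) * (b - a)))%C 0 (2 * PI)).
  { unfold CT. replace (2 * CI (fun t => u t * (circ rho t / (circ rho t - a) ^ 3)) 0 (2 * PI) * (b - a))%C
    with ((2 * (b - a)) * CI (fun t => u t * (circ rho t / (circ rho t - a) ^ 3)) 0 (2 * PI))%C by ring.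
    rewrite <- CI_scal, <- !CI_minus.
    - apply CI_ext. intros t _. unfold ka, kb. simpl. field. split; apply circ_minus_neq0; lra.
    - intros; apply Ccont_minus; auto.
    - intros; apply Ccont_mult. apply Ccont_const. auto.
    - auto.
    - auto.
    - auto. }
  rewrite E. eapply Rle_trans. apply (CI_norm_const _ 0 (2 * PI) (U * (3 * (rho / (rho - r) ^ 4)) * Cmod (b - a) ^ 2)). lra.
  - intros. apply Ccont_mult; [|apply Ccont_const]. apply Ccont_mult. apply Ccont_mult; auto. apply Ccont_circ.
    repeat apply Ccont_mult; auto. apply Ccont_plus; auto. apply Ccont_mult; auto. apply Ccont_const.
  - intros t _. rewrite !Cmod_mult. replace (Cmod (b - a) ^ 2) with (Cmod (b - a) * Cmod (b - a)) by ring.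
    apply Rmult_le_compat_r. apply Rmult_le_pos; apply Cmod_ge_0.
    rewrite Cmod_circ by lra.
    set (e := / (rho - r)). assert (He : 0 < e) by (apply Rinv_0_lt_compat; lra).
    replace (U * (3 * (rho / (rho - r) ^ 4))) with (U * rho * (e * e * e * (3 * e))) by (unfold e; field; lra).
    assert (Ba : Cmod (ka t) <= e) by now apply Bk. assert (Bb : Cmod (kb t) <= e) by now apply Bk.
    assert (B2 : Cmod (kb t + 2 * ka t) <= 3 * e).
    { eapply Rle_trans. apply Cmod_triangle. rewrite Cmod_mult, Cmod_RtoC_pos by lra. lra. }
    assert (Q1 := Cmod_ge_0 (ka t)). assert (Q2 := Cmod_ge_0 (kb t)).
    apply Rmult_le_compat. apply Rmult_le_pos; [apply Cmod_ge_0|lra].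
    repeat apply Rmult_le_pos; auto using Cmod_ge_0.
    apply Rmult_le_compat_r; [lra|auto].
    apply Rmult_le_compat; auto using Cmod_ge_0. repeat apply Rmult_le_pos; auto.
    apply Rmult_le_compat; auto. repeat apply Rmult_le_pos; auto.
    apply Rmult_le_compat; auto.
  - right. ring.
Qed.

Lemma Ccont_bounded (u : R -> C) a b : a <= b -> (forall t, Ccont u t) ->
  exists U, forall t, a <= t <= b -> Cmod (u t) <= U.
Proof.
  intros Hab Hu.
  (* Boundedness is read off from Riemann integrability instead of compactness. *)
  destruct (ex_RInt_ub (V := R_NormedModule) (fun t => Cmod (u t)) a b) as [M HM].
  { apply (ex_RInt_continuous (V := R_CompleteNormedModule)). intros. apply Ccont_Cmod. auto. }
  exists M. intros t Ht. rewrite Rmin_left, Rmax_right in HM by auto. specialize (HM t Ht).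
  eapply Rle_trans; [|apply HM]. apply Rle_abs.
Qed.

Lemma angle_reduce (t : R) : exists s, 0 <= s <= 2 * PI /\ forall r, circ r t = circ r s.
Proof.
  assert (HPI := PI_pos2).
  destruct (archimed (t / (2 * PI))) as [A1 A2].
  set (k := (up (t / (2 * PI)) - 1)%Z).
  exists (t - 2 * IZR k * PI). 
  assert (HP : forall (x : R) (k : Z), cos (x + 2 * IZR k * PI) = cos x /\ sin (x + 2 * IZR k * PI) = sin x).
  { intros x m. destruct (Z.le_gt_cases 0 m) as [L|L].
    - rewrite <- (Z2Nat.id m L), <- INR_IZR_INZ. split. apply cos_period. apply sin_period.
    - set (n := Z.to_nat (- m)). assert (E : IZR m = - INR n).
      { unfold n. rewrite INR_IZR_INZ, Z2Nat.id by lia. rewrite opp_IZR. ring. }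
      rewrite E. split.
      + rewrite <- (cos_period (x + 2 * - INR n * PI) n). f_equal. ring.
      + rewrite <- (sin_period (x + 2 * - INR n * PI) n). f_equal. ring. }
  split.
  - unfold k. rewrite minus_IZR. set (q := t / (2 * PI)) in *.
    replace t with (q * (2 * PI)) by (unfold q; field; lra). simpl. nra.
  - intro r. unfold circ. destruct (HP (t - 2 * IZR k * PI) k) as [E1 E2].
    replace (t - 2 * IZR k * PI + 2 * IZR k * PI) with t in E1, E2 by ring. now rewrite E1, E2.
Qed.

Lemma circle_bounded f rho : 0 <= rho -> (forall w, Cmod w <= rho -> exists l, Cdiff f w l) ->
  exists U, 0 <= U /\ forall t, Cmod (f (circ rho t)) <= U.
Proof.
  intros Hr Hf. assert (HPI := PI_pos2).
  destruct (Ccont_bounded (fun t => f (circ rho t)) 0 (2 * PI)) as [U HU]. lra.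
  intro t. now apply Ccont_circle.
  assert (HU' : forall t, Cmod (f (circ rho t)) <= U).
  { intro t. destruct (angle_reduce t) as [s [Hs E]]. rewrite E. auto. }
  exists U. split; auto. eapply Rle_trans; [apply (Cmod_ge_0 (f (circ rho 0)))|auto].
Qed.

(** * Cauchy estimates and regularity of analytic functions *)

Lemma Cauchy_CT f rho a : 0 < rho -> Cmod a < rho -> (forall w, Cmod w <= rho -> exists l, Cdiff f w l) ->
  f a = (CT rho (fun t => f (circ rho t)) 1 a / RtoC (2 * PI))%C.
Proof.
  intros H0 Ha Hf. unfold CT.
  assert (HPI : RtoC (2 * PI) <> 0%C). { intro E. apply RtoC_inj in E. assert (H := PI_pos2). lra. }
  rewrite (CI_ext _ (fun t => f (circ rho t) * (circ rho t / (circ rho t - a)))%C).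
  2: intros; simpl; now rewrite Cmult_1_r.
  rewrite Cauchy_formula by auto. field. auto.
Qed.

(** The bound is by the mean of |f| and not by its maximum: applied to a power of f, it is the
    source of every estimate by q-means. *)
Lemma Cauchy_bound f rho r a : 0 < rho -> Cmod a <= r -> r < rho -> (forall w, Cmod w <= rho -> exists l, Cdiff f w l) ->
  Cmod (f a) <= rho / (rho - r) * (RInt (fun t => Cmod (f (circ rho t))) 0 (2 * PI) / (2 * PI)).
Proof.
  intros H0 Ha Hr Hf. assert (HPI := PI_pos2).
  assert (Hc := fun t => Ccont_circle f rho t (Rlt_le _ _ H0) Hf).
  rewrite (Cauchy_CT f rho) by (auto; lra).
  rewrite Cmod_div by (intro E; apply RtoC_inj in E; lra). rewrite Cmod_RtoC_pos by lra.
  unfold Rdiv at 1 3. rewrite <- Rmult_assoc. apply Rmult_le_compat_r. left; apply Rinv_0_lt_compat; auto.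
  unfold CT. eapply Rle_trans. apply CI_norm. lra.
  intros. apply Ccont_mult; auto. apply Ccont_kernel; lra.
  rewrite <- (RInt_scal (V := R_CompleteNormedModule)).
  2: apply (ex_RInt_continuous (V := R_CompleteNormedModule)); intros; now apply Ccont_Cmod.
  apply RInt_le. lra.
  - apply (ex_RInt_continuous (V := R_CompleteNormedModule)); intros; apply Ccont_Cmod.
    apply Ccont_mult; auto. apply Ccont_kernel; lra.
  - apply (ex_RInt_continuous (V := R_CompleteNormedModule)); intros.
    apply (continuous_scal_r (V := R_NormedModule)). now apply Ccont_Cmod.
  - intros t _. rewrite Cmod_mult, Rmult_comm. unfold scal; simpl; unfold mult; simpl.
    apply Rmult_le_compat_r. apply Cmod_ge_0.
    assert (K := kernel_bound rho r a t 1 H0 Ha Hr). now rewrite pow_1 in K.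
Qed.

Lemma Cauchy_derive f rho a : 0 < rho -> Cmod a < rho -> (forall w, Cmod w <= rho -> exists l, Cdiff f w l) ->
  Cdiff f a (CT rho (fun t => f (circ rho t)) 2 a / RtoC (2 * PI))%C.
Proof.
  intros H0 Ha Hf. assert (HPI := PI_pos2).
  assert (HPI' : RtoC (2 * PI) <> 0%C) by (intro E; apply RtoC_inj in E; lra).
  assert (Hc := fun t => Ccont_circle f rho t (Rlt_le _ _ H0) Hf).
  destruct (circle_bounded f rho (Rlt_le _ _ H0) Hf) as [U [HU0 HU]].
  set (r := (Cmod a + rho) / 2).
  apply (Cdiff_quad _ _ _ (r - Cmod a) (U * (rho / (rho - r) ^ 3))). unfold r; lra.
  intros b Hb.
  assert (Hbr : Cmod b <= r). { assert (K := Cmod_triangle_minus b a). lra. }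
  rewrite (Cauchy_CT f rho b), (Cauchy_CT f rho a) by (auto; unfold r in *; lra).
  replace (CT rho (fun t => f (circ rho t)) 1 b / (2 * PI)%R - CT rho (fun t => f (circ rho t)) 1 a / (2 * PI)%R -
     CT rho (fun t => f (circ rho t)) 2 a / (2 * PI)%R * (b - a))%C with
    ((CT rho (fun t => f (circ rho t)) 1 b - CT rho (fun t => f (circ rho t)) 1 a - CT rho (fun t => f (circ rho t)) 2 a * (b - a)) / (2 * PI)%R)%C by (field; auto).
  rewrite Cmod_div, Cmod_RtoC_pos by (auto; lra). apply Rle_div_l. lra.
  eapply Rle_trans. apply (CT_quad1 rho r _ U); auto; unfold r in *; lra. right. ring.
Qed.

Lemma analytic_closed_disc f rho : analytic_on_D f -> rho < 1 -> forall w, Cmod w <= rho -> exists l, Cdiff f w l.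
Proof.
  intros Hf Hr w Hw. exists (C_derive f w). apply analytic_Cdiff; auto. unfold inD. lra.
Qed.

(** One constant serves all pairs of points of a closed disc, because both points are represented on
    the same larger circle. The uniformity lets the estimate be integrated along rays. *)
Lemma analytic_quad f r : analytic_on_D f -> r < 1 -> exists K, 0 <= K /\ forall a b, Cmod a <= r -> Cmod b <= r ->
  Cmod (f b - f a - C_derive f a * (b - a)) <= K * Cmod (b - a) ^ 2.
Proof.
  intros Hf Hr1. 
  destruct (Rle_dec 0 r) as [Hr0|Hr0].
  2:{ exists 0. split. lra. intros a b Ha. assert (K := Cmod_ge_0 a). lra. }
  set (rho := (r + 1) / 2). assert (Hrho : 0 < rho < 1) by (unfold rho; lra). assert (HPI := PI_pos2).
  assert (HPI' : RtoC (2 * PI) <> 0%C) by (intro E; apply RtoC_inj in E; lra).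
  assert (Hd := analytic_closed_disc f rho Hf (proj2 Hrho)).
  assert (Hc := fun t => Ccont_circle f rho t (Rlt_le _ _ (proj1 Hrho)) Hd).
  destruct (circle_bounded f rho (Rlt_le _ _ (proj1 Hrho)) Hd) as [U [HU0 HU]].
  exists (U * (rho / (rho - r) ^ 3)). split.
  { apply Rmult_le_pos; auto. left. apply Rdiv_lt_0_compat. lra. apply pow_lt. unfold rho; lra. }
  intros a b Ha Hb.
  rewrite (Cdiff_derive _ _ _ (Cauchy_derive f rho a (proj1 Hrho) ltac:(unfold rho in *; lra) Hd)).
  rewrite (Cauchy_CT f rho b), (Cauchy_CT f rho a) by (auto; unfold rho in *; lra).
  replace (CT rho (fun t => f (circ rho t)) 1 b / (2 * PI)%R - CT rho (fun t => f (circ rho t)) 1 a / (2 * PI)%R -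
     CT rho (fun t => f (circ rho t)) 2 a / (2 * PI)%R * (b - a))%C with
    ((CT rho (fun t => f (circ rho t)) 1 b - CT rho (fun t => f (circ rho t)) 1 a - CT rho (fun t => f (circ rho t)) 2 a * (b - a)) / (2 * PI)%R)%C by (field; auto).
  rewrite Cmod_div, Cmod_RtoC_pos by (auto; lra). apply Rle_div_l. lra.
  eapply Rle_trans. apply (CT_quad1 rho r _ U); auto; unfold rho in *; lra. right. ring.
Qed.

(** Makes the derivative continuous, and thereby gives access to the fundamental theorem of calculus
    along segments. *)
Lemma analytic_derive f : analytic_on_D f -> analytic_on_D (C_derive f).
Proof.
  intros Hf. apply Cdiff_analytic. intros a Ha. unfold inD in Ha. assert (Ha0 := Cmod_ge_0 a).
  set (rho := (Cmod a + 1) / 2). assert (Hrho : 0 < rho < 1) by (unfold rho; lra).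
  assert (Hra : Cmod a < rho) by (unfold rho; lra). assert (HPI := PI_pos2).
  assert (HPI' : RtoC (2 * PI) <> 0%C) by (intro E; apply RtoC_inj in E; lra).
  assert (Hd := analytic_closed_disc f rho Hf (proj2 Hrho)).
  assert (Hc := fun t => Ccont_circle f rho t (Rlt_le _ _ (proj1 Hrho)) Hd).
  destruct (circle_bounded f rho (Rlt_le _ _ (proj1 Hrho)) Hd) as [U [HU0 HU]].
  set (u := fun t => f (circ rho t)) in *.
  exists (2 * CT rho u 3 a / RtoC (2 * PI))%C.
  set (r := (Cmod a + rho) / 2).
  apply (Cdiff_quad _ _ _ (r - Cmod a) (U * (3 * (rho / (rho - r) ^ 4)))). unfold r; lra.
  intros b Hb.
  assert (Hbr : Cmod b <= r). { assert (K := Cmod_triangle_minus b a). lra. }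
  rewrite (Cdiff_derive _ _ _ (Cauchy_derive f rho a (proj1 Hrho) Hra Hd)).
  rewrite (Cdiff_derive _ _ _ (Cauchy_derive f rho b (proj1 Hrho) ltac:(unfold r in *; lra) Hd)). fold u.
  replace (CT rho u 2 b / (2 * PI)%R - CT rho u 2 a / (2 * PI)%R - 2 * CT rho u 3 a / (2 * PI)%R * (b - a))%C with
    ((CT rho u 2 b - CT rho u 2 a - 2 * CT rho u 3 a * (b - a)) / (2 * PI)%R)%C by (field; auto).
  rewrite Cmod_div, Cmod_RtoC_pos by (auto; lra). apply Rle_div_l. lra.
  eapply Rle_trans. apply (CT_quad2 rho r _ U); auto; unfold r in *; lra. right. ring.
Qed.

Lemma analytic_bounded f r : analytic_on_D f -> r < 1 -> exists B, 0 <= B /\ forall w, Cmod w <= r -> Cmod (f w) <= B.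
Proof.
  intros Hf Hr1.
  destruct (Rle_dec 0 r) as [Hr0|Hr0].
  2:{ exists 0. split. lra. intros a Ha. assert (K := Cmod_ge_0 a). lra. }
  set (rho := (r + 1) / 2). assert (Hrho : 0 < rho < 1) by (unfold rho; lra). assert (HPI := PI_pos2).
  assert (HPI' : RtoC (2 * PI) <> 0%C) by (intro E; apply RtoC_inj in E; lra).
  assert (Hd := analytic_closed_disc f rho Hf (proj2 Hrho)).
  assert (Hc := fun t => Ccont_circle f rho t (Rlt_le _ _ (proj1 Hrho)) Hd).
  destruct (circle_bounded f rho (Rlt_le _ _ (proj1 Hrho)) Hd) as [U [HU0 HU]].
  exists (U * (rho / (rho - r) ^ 1)). split.
  { apply Rmult_le_pos; auto. left. apply Rdiv_lt_0_compat. lra. apply pow_lt. unfold rho; lra. }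
  intros a Ha. rewrite (Cauchy_CT f rho a) by (auto; unfold rho in *; lra).
  rewrite Cmod_div, Cmod_RtoC_pos by (auto; lra). apply Rle_div_l. lra.
  eapply Rle_trans. apply (CT_bound rho r _ U); auto; unfold rho in *; lra. right. ring.
Qed.

Lemma Cauchy_estimate f c d B : analytic_on_D f -> 0 < d -> Cmod c + d < 1 ->
  (forall w, Cmod (w - c) <= d -> Cmod (f w) <= B) -> Cmod (C_derive f c) <= B / d.
Proof.
  intros Hf Hd Hcd HB. assert (HPI := PI_pos2).
  (* Translation to centre 0, where the circles of [CT] live; the factor 1 fits the form of
     [Cdiff_comp_affine]. *)
  set (h := fun w => f (c + 1 * w)%C).
  assert (Hh : forall w, Cmod w <= d -> exists l, Cdiff h w l).
  { intros w Hw. eexists. apply Cdiff_comp_affine. apply analytic_Cdiff; auto. unfold inD.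
    eapply Rle_lt_trans. apply Cmod_triangle. rewrite Cmult_1_l. lra. }
  assert (H1 : Cdiff h 0 (1 * C_derive f c)).
  { apply Cdiff_comp_affine. replace (c + 1 * 0)%C with c by ring. apply analytic_Cdiff; auto. unfold inD. lra. }
  assert (H2 := Cauchy_derive h d 0 Hd). rewrite Cmod_0 in H2. specialize (H2 Hd Hh).
  apply Cdiff_derive in H1, H2. rewrite Cmult_1_l in H1. rewrite <- H1, H2.
  rewrite Cmod_div, Cmod_RtoC_pos by (try lra; intro E; apply RtoC_inj in E; lra). apply Rle_div_l. lra.
  eapply Rle_trans. apply (CT_bound d 0 _ B); auto. rewrite Cmod_0; lra.
  - intro t. apply Ccont_circle; auto; lra.
  - intro t. unfold h. apply HB. replace (c + 1 * circ d t - c)%C with (circ d t) by ring. rewrite Cmod_circ; lra.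
  - right. field. lra.
Qed.

Lemma Cderiv_comp_segment f a k t : Cdiff f (a + RtoC t * k)%C (C_derive f (a + RtoC t * k)) ->
  Cderiv (fun s => f (a + RtoC s * k)%C) t (C_derive f (a + RtoC t * k) * k).
Proof.
  intros Hf eps He. assert (Hk := Cmod_ge_0 k).
  destruct (Hf (eps / (1 + Cmod k))) as [d [Hd H]]; [apply Rdiv_lt_0_compat; lra|].
  exists (d / (1 + Cmod k)). split. apply Rdiv_lt_0_compat; lra.
  intros s Hs. apply Rlt_div_r in Hs; [|lra].
  assert (E : (a + RtoC s * k - (a + RtoC t * k))%C = (RtoC (s - t) * k)%C) by (rewrite RtoC_minus; ring).
  specialize (H (a + RtoC s * k)%C). rewrite E, Cmod_mult, Cmod_R in H.
  assert (H4 := Rabs_pos (s - t)).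
  replace (RtoC (s - t) * (C_derive f (a + RtoC t * k) * k))%C with (C_derive f (a + RtoC t * k) * (RtoC (s - t) * k))%C by ring.
  eapply Rle_trans. apply H. nra.
  replace (eps / (1 + Cmod k) * (Rabs (s - t) * Cmod k)) with
    (eps * Rabs (s - t) * (Cmod k / (1 + Cmod k))) by (field; lra).
  rewrite <- (Rmult_1_r (eps * Rabs (s - t))) at 2.
  apply Rmult_le_compat_l. nra. apply Rle_div_l; lra.
Qed.

Lemma segment_inD a b t : inD a -> inD b -> 0 <= t <= 1 -> inD (a + RtoC t * (b - a))%C.
Proof.
  unfold inD. intros Ha Hb Ht.
  replace (a + t * (b - a))%C with (RtoC (1 - t) * a + RtoC t * b)%C by (rewrite RtoC_minus; ring).
  eapply Rle_lt_trans. apply Cmod_triangle. rewrite !Cmod_mult, !Cmod_RtoC_pos by lra.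
  destruct (Rle_lt_dec t (1/2)); nra.
Qed.

Lemma Ccont_segment f a k t : CCcont f (a + RtoC t * k)%C -> Ccont (fun s => f (a + RtoC s * k)%C) t.
Proof.
  intro H. apply (Ccont_comp f (fun s => a + RtoC s * k)%C); auto.
  apply Ccont_plus. apply Ccont_const. apply Ccont_mult. apply Ccont_RtoC. apply Ccont_const.
Qed.

Lemma analytic_CCcont f z : analytic_on_D f -> inD z -> CCcont f z.
Proof. intros Hf Hz. eapply Cdiff_CCcont. apply (analytic_Cdiff f z Hf Hz). Qed.

Lemma mean_value_inequality f a b B : analytic_on_D f -> inD a -> inD b ->
  (forall t, 0 <= t <= 1 -> Cmod (C_derive f (a + RtoC t * (b - a))) <= B) ->
  Cmod (f b - f a) <= B * Cmod (b - a).
Proof.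
  intros Hf Ha Hb HB.
  assert (H := CI_FTC (fun s => f (a + RtoC s * (b - a)))%C (fun s => C_derive f (a + RtoC s * (b - a)) * (b - a))%C 0 1).
  rewrite Rmin_left, Rmax_right in H by lra.
  assert (Hcd : forall t, 0 <= t <= 1 -> Ccont (fun s => C_derive f (a + RtoC s * (b - a)) * (b - a))%C t).
  { intros t Ht. apply Ccont_mult; [|apply Ccont_const]. apply Ccont_segment.
    apply analytic_CCcont. now apply analytic_derive. now apply segment_inD. }
  replace (a + 1 * (b - a))%C with b in H by ring. replace (a + 0 * (b - a))%C with a in H by ring.
  rewrite <- H; auto.
  - eapply Rle_trans. apply (CI_norm_const _ 0 1 (B * Cmod (b - a))). lra. auto.
    intros t Ht. rewrite Cmod_mult. apply Rmult_le_compat_r. apply Cmod_ge_0. auto. lra.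
  - intros t Ht. apply Cderiv_comp_segment. apply analytic_Cdiff; auto. now apply segment_inD.
Qed.

(** The limit inherits Cauchy's formula, and a Cauchy transform of any continuous density is
    differentiable by [CT_quad1]. Continuity of F comes first so that it may serve as a density. *)
Lemma analytic_uniform_limit (F : C -> C) :
  (forall rho e, rho < 1 -> 0 < e -> exists f, analytic_on_D f /\ forall z, Cmod z <= rho -> Cmod (F z - f z) <= e) ->
  analytic_on_D F.
Proof.
  intros HF. apply Cdiff_analytic.
  assert (Hcont : forall z, inD z -> CCcont F z).
  { intros z Hz eps He. unfold inD in Hz.
    destruct (HF ((1 + Cmod z) / 2) (eps / 3)) as [f [Hf Hfz]]; try lra.
    destruct (analytic_CCcont f z Hf Hz (eps / 3)) as [d [Hd Hd']]. lra.
    exists (Rmin d ((1 - Cmod z) / 2)). split. apply Rmin_glb_lt; lra. intros w Hw.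
    assert (Hw1 := Rlt_le_trans _ _ _ Hw (Rmin_l _ _)). assert (Hw2 := Rlt_le_trans _ _ _ Hw (Rmin_r _ _)).
    assert (K := Cmod_triangle_minus w z).
    specialize (Hd' w Hw1). assert (K1 := Hfz w ltac:(lra)). assert (K2 := Hfz z ltac:(lra)).
    rewrite Cmod_minus_sym in K2.
    replace (F w - F z)%C with ((F w - f w) + ((f w - f z) + (f z - F z)))%C by ring.
    eapply Rle_lt_trans. apply Cmod_triangle.
    assert (K3 := Cmod_triangle (f w - f z) (f z - F z)). lra. }
  intros a Ha. unfold inD in Ha. assert (Ha0 := Cmod_ge_0 a).
  set (rho := (Cmod a + 1) / 2). assert (Hrho : 0 < rho < 1) by (unfold rho; lra).
  assert (Hra : Cmod a < rho) by (unfold rho; lra). assert (HPI := PI_pos2).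
  assert (HPI' : RtoC (2 * PI) <> 0%C) by (intro E; apply RtoC_inj in E; lra).
  set (u := fun t => F (circ rho t)).
  assert (Hu : forall t, Ccont u t).
  { intro t. apply Ccont_comp. apply Ccont_circ. apply Hcont. unfold inD. rewrite Cmod_circ; lra. }
  assert (HC : forall b, Cmod b < rho -> F b = (CT rho u 1 b / RtoC (2 * PI))%C).
  { intros b Hb. apply Ceq_minus. apply Cmod_eq_0. apply Rle_antisym; [|apply Cmod_ge_0].
    apply le_epsilon. intros e He. rewrite Rplus_0_l.
    (* The approximation error enters twice, once at b and once under the integral with the kernel
       bound as factor. *)
    set (Q := 1 + rho / (rho - Cmod b) ^ 1).
    assert (HQ : 0 < Q). { unfold Q. apply Rplus_lt_0_compat. lra. apply Rdiv_lt_0_compat. lra. apply pow_lt; lra. }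
    destruct (HF rho (e / Q)) as [f [Hf Hfz]]. lra. apply Rdiv_lt_0_compat; lra.
    assert (Hd := analytic_closed_disc f rho Hf (proj2 Hrho)).
    assert (Hc := fun t => Ccont_circle f rho t (Rlt_le _ _ (proj1 Hrho)) Hd).
    replace (F b - CT rho u 1 b / (2 * PI)%R)%C with
      ((F b - f b) + - (CT rho u 1 b - CT rho (fun t => f (circ rho t)) 1 b) / (2 * PI)%R)%C.
    2:{ rewrite (Cauchy_CT f rho b) by (auto; lra). field. auto. }
    eapply Rle_trans. apply Cmod_triangle.
    replace e with (e / Q + e / Q * (rho / (rho - Cmod b) ^ 1)).
    2:{ replace (e / Q + e / Q * (rho / (rho - Cmod b) ^ 1)) with (e / Q * Q) by (unfold Q; ring). field. lra. }
    apply Rplus_le_compat. apply Hfz. lra.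
    rewrite Cmod_div, Cmod_opp, Cmod_RtoC_pos by (auto; lra). apply Rle_div_l. lra.
    replace (CT rho u 1 b - CT rho (fun t => f (circ rho t)) 1 b)%C with (CT rho (fun t => u t - f (circ rho t))%C 1 b).
    - eapply Rle_trans. apply (CT_bound rho (Cmod b) _ (e / Q)); try lra.
      intro. apply Ccont_minus; auto. intro t. apply Hfz. rewrite Cmod_circ; lra. right. ring.
    - unfold CT. rewrite <- CI_minus. apply CI_ext. intros; ring.
      all: intros; apply Ccont_mult; auto; apply Ccont_kernel; lra. }
  exists (CT rho u 2 a / RtoC (2 * PI))%C.
  destruct (Ccont_bounded u 0 (2 * PI)) as [U HU]. lra. auto.
  assert (HU' : forall t, Cmod (u t) <= U).
  { intro t. destruct (angle_reduce t) as [s [Hs E]]. unfold u. rewrite E. apply HU. auto. }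
  set (r := (Cmod a + rho) / 2).
  apply (Cdiff_quad _ _ _ (r - Cmod a) (U * (rho / (rho - r) ^ 3))). unfold r; lra.
  intros b Hb.
  assert (Hbr : Cmod b <= r). { assert (K := Cmod_triangle_minus b a). lra. }
  rewrite (HC b), (HC a) by (auto; unfold r in *; lra).
  replace (CT rho u 1 b / (2 * PI)%R - CT rho u 1 a / (2 * PI)%R - CT rho u 2 a / (2 * PI)%R * (b - a))%C with
    ((CT rho u 1 b - CT rho u 1 a - CT rho u 2 a * (b - a)) / (2 * PI)%R)%C by (field; auto).
  rewrite Cmod_div, Cmod_RtoC_pos by (auto; lra). apply Rle_div_l. lra.
  eapply Rle_trans. apply (CT_quad1 rho r _ U); auto; unfold r in *; lra. right. ring.
Qed.

(** * Algebra of analytic functions, primitives and the derivative of [Tg] *)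

Lemma analytic_mult f h : analytic_on_D f -> analytic_on_D h -> analytic_on_D (fun z => f z * h z)%C.
Proof.
  intros Hf Hh. apply Cdiff_analytic. intros z Hz. eexists.
  apply Cdiff_mult; apply analytic_Cdiff; auto.
Qed.

Lemma analytic_plus f h : analytic_on_D f -> analytic_on_D h -> analytic_on_D (fun z => f z + h z)%C.
Proof.
  intros Hf Hh. apply Cdiff_analytic. intros z Hz. eexists.
  apply Cdiff_plus; apply analytic_Cdiff; auto.
Qed.

Lemma analytic_const c : analytic_on_D (fun _ => c).
Proof. apply Cdiff_analytic. intros z _. exists 0%C. apply Cdiff_const. Qed.

Lemma analytic_ext f h : (forall z, inD z -> f z = h z) -> analytic_on_D f -> analytic_on_D h.
Proof.
  intros E Hf. apply Cdiff_analytic. intros z Hz. exists (C_derive f z).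
  apply (Cdiff_ext f h z _ (1 - Cmod z)). unfold inD in Hz; lra.
  - intros w Hw. apply E. unfold inD in *. assert (K := Cmod_triangle_minus w z). lra.
  - now apply analytic_Cdiff.
Qed.

(** For F = f g' this unfolds to the same integral as [Tg g f], so facts about it apply to the
    operator directly. *)
Definition primitive (F : C -> C) (z : C) : C := CI (fun t => F (RtoC t * z) * z)%C 0 1.

Lemma scale_inD z t : inD z -> 0 <= t <= 1 -> inD (RtoC t * z)%C.
Proof. unfold inD. intros Hz Ht. rewrite Cmod_mult, Cmod_RtoC_pos by lra. assert (K := Cmod_ge_0 z). nra. Qed.

Lemma Ccont_scale F z t : CCcont F (RtoC t * z)%C -> Ccont (fun s => F (RtoC s * z)%C) t.
Proof.
  intro H. apply (Ccont_comp F (fun s => RtoC s * z)%C); auto.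
  apply Ccont_mult. apply Ccont_RtoC. apply Ccont_const.
Qed.

(* Since [d/dt (t F(ta)) = F(ta) + ta F'(ta)], differentiating under the integral sign gives back [F(a)]. *)
Lemma primitive_Cdiff F a : analytic_on_D F -> inD a -> Cdiff (primitive F) a (F a).
Proof.
  intros HF Ha. assert (HF' := analytic_derive F HF).
  assert (Hc : forall z t, inD z -> 0 <= t <= 1 -> Ccont (fun s => F (RtoC s * z)%C) t).
  { intros. apply Ccont_scale. apply analytic_CCcont; auto. now apply scale_inD. }
  assert (Hc' : forall z t, inD z -> 0 <= t <= 1 -> Ccont (fun s => C_derive F (RtoC s * z)%C) t).
  { intros. apply Ccont_scale. apply analytic_CCcont; auto. now apply scale_inD. }
  assert (HFa : F a = CI (fun t => F (RtoC t * a) + RtoC t * a * C_derive F (RtoC t * a))%C 0 1).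
  { rewrite (CI_FTC (fun t => RtoC t * F (RtoC t * a))%C).
    - replace (1 * a)%C with a by ring. ring.
    - intros t. rewrite Rmin_left, Rmax_right by lra. intro Ht.
      assert (HD := Cderiv_comp_segment F 0 a t).
      assert (Z : forall s, (0 + RtoC s * a)%C = (RtoC s * a)%C) by (intros; ring).
      rewrite Z in HD. specialize (HD ltac:(apply analytic_Cdiff; [auto|now apply scale_inD])).
      intros eps He. set (L := (C_derive F (RtoC t * a) * a)%C) in *.
      destruct (Hc a t Ha Ht (eps / 2) ltac:(lra)) as [d2 [Hd2 H2]].
      set (M := 1 + Rabs t). assert (HM : 0 < M) by (unfold M; assert (K := Rabs_pos t); lra).
      destruct (HD (eps / 2 / M) ltac:(apply Rdiv_lt_0_compat; lra)) as [d3 [Hd3 H3]].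
      exists (Rmin d2 d3). split. apply Rmin_glb_lt; auto. intros s Hs.
      specialize (H2 s (Rlt_le_trans _ _ _ Hs (Rmin_l _ _))). specialize (H3 s (Rlt_le_trans _ _ _ Hs (Rmin_r _ _))).
      rewrite !Z in H3.
      replace (RtoC s * F (RtoC s * a) - RtoC t * F (RtoC t * a) - RtoC (s - t) * (F (RtoC t * a) + RtoC t * a * C_derive F (RtoC t * a)))%C with
        (RtoC (s - t) * (F (RtoC s * a) - F (RtoC t * a)) + RtoC t * (F (RtoC s * a) - F (RtoC t * a) - RtoC (s - t) * L))%C.
      2:{ unfold L. rewrite RtoC_minus. ring. }
      eapply Rle_trans. apply Cmod_triangle. rewrite !Cmod_mult, !Cmod_R.
      assert (K0 := Rabs_pos (s - t)). assert (K1 := Rabs_pos t).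
      assert (A1 : Rabs (s - t) * Cmod (F (RtoC s * a)%C - F (RtoC t * a)%C) <= Rabs (s - t) * (eps / 2)) by (apply Rmult_le_compat_l; lra).
      assert (A2 : Rabs t * Cmod (F (RtoC s * a)%C - F (RtoC t * a)%C - RtoC (s - t) * L) <= M * (eps / 2 / M * Rabs (s - t))).
      { apply Rmult_le_compat; auto using Cmod_ge_0. unfold M; lra. }
      replace (M * (eps / 2 / M * Rabs (s - t))) with (eps / 2 * Rabs (s - t)) in A2 by (field; lra). lra.
    - intros t. rewrite Rmin_left, Rmax_right by lra. intro Ht. apply Ccont_plus. auto.
      apply Ccont_mult; auto. apply Ccont_mult. apply Ccont_RtoC. apply Ccont_const. }
  unfold inD in Ha. assert (Ha0 := Cmod_ge_0 a).
  set (r := (1 + Cmod a) / 2).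
  destruct (analytic_quad F r HF ltac:(unfold r; lra)) as [K [HK0 HK]].
  destruct (analytic_bounded _ r HF' ltac:(unfold r; lra)) as [B [HB0 HB]].
  (* [K] comes from the remainder of F between t a and t b, [B] from the left-over term t (b - a)^2
     F'(t a). *)
  apply (Cdiff_quad _ _ _ (r - Cmod a) (K + B)). unfold r; lra.
  intros b Hb.
  assert (Hbr : Cmod b <= r). { assert (K' := Cmod_triangle_minus b a). lra. }
  assert (Hbr' : inD b) by (unfold inD, r in *; lra).
  assert (Hm : forall t, Rmin 0 1 <= t <= Rmax 0 1 -> 0 <= t <= 1) by (intros t; rewrite Rmin_left, Rmax_right by lra; auto).
  unfold primitive. rewrite HFa at 1. rewrite (Cmult_comm _ (b - a)).
  rewrite <- CI_scal, <- !CI_minus.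
  - eapply Rle_trans. apply (CI_norm_const _ 0 1 ((K + B) * Cmod (b - a) ^ 2)). lra.
    + intros t Ht. repeat apply Ccont_minus; repeat apply Ccont_mult; auto; try apply Ccont_const.
      apply Ccont_plus; auto. apply Ccont_mult; auto. apply Ccont_mult. apply Ccont_RtoC. apply Ccont_const.
    + intros t Ht.
      replace (F (t * b) * b - F (t * a) * a - (b - a) * (F (t * a) + t * a * C_derive F (t * a)))%C with
        ((F (t * b) - F (t * a) - C_derive F (t * a) * (t * b - t * a)) * b + t * ((b - a) * (b - a)) * C_derive F (t * a))%C by ring.
      assert (Sc : forall z, Cmod z <= r -> Cmod (RtoC t * z) <= r).
      { intros z Hz. rewrite Cmod_mult, Cmod_RtoC_pos by lra. assert (K' := Cmod_ge_0 z). nra. }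
      assert (Har : Cmod a <= r) by (unfold r; lra).
      specialize (HK (t * a)%C (t * b)%C (Sc a Har) (Sc b Hbr)). specialize (HB (t * a)%C (Sc a Har)).
      assert (Et : (t * b - t * a)%C = (t * (b - a))%C) by ring.
      rewrite Et in HK |- *. rewrite (Cmod_mult t (b - a)), Cmod_RtoC_pos in HK by lra.
      eapply Rle_trans. apply Cmod_triangle. rewrite !Cmod_mult, Cmod_RtoC_pos by lra.
      set (d := Cmod (b - a)) in *. assert (Hd : 0 <= d) by apply Cmod_ge_0.
      assert (Hb1 : Cmod b <= 1) by (unfold r in *; lra).
      assert (Q1 : (t * d) ^ 2 <= d ^ 2) by (apply pow_incr; nra).
      assert (Q2 := Cmod_ge_0 (F (t * b)%C - F (t * a)%C - C_derive F (t * a) * (t * (b - a)))).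
      assert (Q3 := Cmod_ge_0 b). assert (Q4 := Cmod_ge_0 (C_derive F (t * a))).
      assert (Q5 : K * (t * d) ^ 2 <= K * d ^ 2) by now apply Rmult_le_compat_l.
      assert (Q6 : t * (d * d) * Cmod (C_derive F (t * a)) <= 1 * (d * d) * B).
      { apply Rmult_le_compat; auto. apply Rmult_le_pos. lra. nra. apply Rmult_le_compat_r. nra. lra. }
      simpl. simpl in Q5, HK. nra.
    + lra.
  - intros t Ht. apply Hm in Ht. apply Ccont_minus; apply Ccont_mult; auto; apply Ccont_const.
  - intros t Ht. apply Hm in Ht. apply Ccont_mult. apply Ccont_const. apply Ccont_plus; auto. apply Ccont_mult; auto.
    apply Ccont_mult. apply Ccont_RtoC. apply Ccont_const.
  - intros t Ht. apply Hm in Ht. apply Ccont_mult; auto. apply Ccont_const.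
  - intros t Ht. apply Hm in Ht. apply Ccont_mult; auto. apply Ccont_const.
  - intros t Ht. apply Hm in Ht. apply Ccont_plus; auto. apply Ccont_mult; auto.
    apply Ccont_mult. apply Ccont_RtoC. apply Ccont_const.
Qed.

Lemma Tg_Cdiff g f z : analytic_on_D g -> analytic_on_D f -> inD z ->
  Cdiff (Tg g f) z (f z * C_derive g z).
Proof.
  intros Hg Hf Hz. apply (primitive_Cdiff (fun w => f w * C_derive g w)%C); auto.
  apply analytic_mult; auto. now apply analytic_derive.
Qed.

Lemma Tg_analytic g f : analytic_on_D g -> analytic_on_D f -> analytic_on_D (Tg g f).
Proof. intros. apply Cdiff_analytic. intros z Hz. eexists. now apply Tg_Cdiff. Qed.

Lemma Tg_derive g f z : analytic_on_D g -> analytic_on_D f -> inD z ->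
  C_derive (Tg g f) z = (f z * C_derive g z)%C.
Proof. intros. apply Cdiff_derive. now apply Tg_Cdiff. Qed.

(** * Powers, circle means and the subharmonicity substitute *)

Lemma Rpower_pos x y : 0 < Rpower x y.
Proof. unfold Rpower. apply exp_pos. Qed.

Lemma rpow_0 q : rpow 0 q = 0.
Proof. unfold rpow. destruct (Rle_dec 0 0); lra. Qed.

Lemma rpow_pos x q : 0 < x -> rpow x q = Rpower x q.
Proof. intro. unfold rpow. destruct (Rle_dec x 0); lra. Qed.

Lemma rpow_gt0 x q : 0 < x -> 0 < rpow x q.
Proof. intro. rewrite rpow_pos by auto. apply Rpower_pos. Qed.

Lemma rpow_nonneg x q : 0 <= rpow x q.
Proof. unfold rpow. destruct (Rle_dec x 0); [lra|]. left. apply Rpower_pos. Qed.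

Lemma rpow_le x y q : 0 <= q -> x <= y -> rpow x q <= rpow y q.
Proof.
  intros Hq H. destruct (Rle_dec x 0) as [Hx|Hx].
  - unfold rpow at 1. destruct (Rle_dec x 0); [|lra]. apply rpow_nonneg.
  - rewrite !rpow_pos by lra. apply Rle_Rpower_l; lra.
Qed.

Lemma rpow_mult_distr x y q : 0 <= x -> 0 <= y -> rpow (x * y) q = rpow x q * rpow y q.
Proof.
  intros Hx Hy. destruct (Req_dec x 0) as [->|Nx]. rewrite Rmult_0_l, rpow_0. ring.
  destruct (Req_dec y 0) as [->|Ny]. rewrite Rmult_0_r, rpow_0. ring.
  rewrite !rpow_pos by nra. rewrite Rpower_mult_distr; lra.
Qed.

Lemma rpow_rpow x q s : 0 <= x -> rpow (rpow x q) s = rpow x (q * s).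
Proof.
  intro Hx. destruct (Req_dec x 0) as [->|Nx]. now rewrite !rpow_0.
  rewrite (rpow_pos x) by lra. rewrite rpow_pos by apply Rpower_pos.
  rewrite Rpower_mult, rpow_pos; lra.
Qed.

Lemma rpow_1 x : 0 <= x -> rpow x 1 = x.
Proof.
  intro Hx. destruct (Req_dec x 0) as [->|Nx]. apply rpow_0. rewrite rpow_pos, Rpower_1; lra.
Qed.

Lemma rpow_plus x a b : rpow x (a + b) = rpow x a * rpow x b.
Proof.
  unfold rpow. destruct (Rle_dec x 0). ring. apply Rpower_plus.
Qed.

Lemma rpow_INR x n : 0 <= x -> (0 < n)%nat -> rpow x (INR n) = x ^ n.
Proof.
  intros Hx Hn. destruct (Req_dec x 0) as [->|Nx]. rewrite rpow_0, pow_i; auto.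
  rewrite rpow_pos, Rpower_pow; lra.
Qed.

Lemma rpow_inv_cancel x q : 0 < q -> 0 <= x -> rpow (rpow x q) (/ q) = x.
Proof. intros. rewrite rpow_rpow by auto. rewrite Rinv_r by lra. now apply rpow_1. Qed.

Lemma rpow_cancel_inv x q : 0 < q -> 0 <= x -> rpow (rpow x (/ q)) q = x.
Proof. intros. rewrite rpow_rpow by auto. rewrite Rinv_l by lra. now apply rpow_1. Qed.

Lemma rpow_le_inv x y q : 0 < q -> 0 <= x -> rpow x q <= y -> x <= rpow y (/ q).
Proof.
  intros Hq Hx H. rewrite <- (rpow_inv_cancel x q) by auto. apply rpow_le; auto.
  left. now apply Rinv_0_lt_compat.
Qed.

(** From a + b at most twice the maximum; this crude constant serves q below and above 1 alike,
    without convexity. *)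
Lemma rpow_sum_le a b q : 0 < q -> 0 <= a -> 0 <= b -> rpow (a + b) q <= rpow 2 q * (rpow a q + rpow b q).
Proof.
  intros Hq Ha Hb.
  assert (Hm : forall x y, 0 <= x -> 0 <= y -> x <= y -> rpow (x + y) q <= rpow 2 q * rpow y q).
  { intros x y Hx Hy Hxy. rewrite <- rpow_mult_distr by lra. apply rpow_le; lra. }
  assert (P := rpow_nonneg 2 q). assert (P1 := rpow_nonneg a q). assert (P2 := rpow_nonneg b q).
  destruct (Rle_dec a b) as [L|L].
  - specialize (Hm a b Ha Hb L). nra.
  - assert (Hm' := Hm b a Hb Ha ltac:(lra)). rewrite Rplus_comm in Hm'. nra.
Qed.

Lemma rpow_lt_1 x q : 0 < q -> 0 <= x < 1 -> rpow x q < 1.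
Proof.
  intros Hq Hx. destruct (Req_dec x 0) as [->|Nx]. rewrite rpow_0; lra.
  rewrite rpow_pos by lra. unfold Rpower. rewrite <- exp_0. apply exp_increasing.
  assert (ln x < 0) by (rewrite <- ln_1; apply ln_increasing; lra). nra.
Qed.

Lemma rpow_lt x y q : 0 < q -> 0 <= x < y -> rpow x q < rpow y q.
Proof.
  intros Hq Hx. replace x with (y * (x / y)) by (field; lra).
  rewrite rpow_mult_distr; [|lra|apply Rmult_le_pos; [lra|left; apply Rinv_0_lt_compat; lra]].
  assert (P := rpow_gt0 y q ltac:(lra)).
  assert (rpow (x / y) q < 1).
  { apply rpow_lt_1; auto. split. apply Rmult_le_pos; [lra|left; apply Rinv_0_lt_compat; lra]. apply Rlt_div_l; lra. }
  nra.
Qed.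

Lemma rpow_continuous q x : 0 < q -> continuous (fun x => rpow x q) x.
Proof.
  intro Hq. destruct (Rtotal_order x 0) as [Hx|[->|Hx]].
  - apply (continuous_ext_loc _ (fun _ : R => 0)).
    + exists (mkposreal (- x) ltac:(lra)). intros y Hy.
      assert (Hy' : Rabs (y - x) < - x) by exact Hy. apply Rabs_lt_between in Hy'.
      unfold rpow. destruct (Rle_dec y 0); lra.
    + apply continuous_const.
  (* At 0 the radius eps^(1/q) works, since negative arguments give the value 0. *)
  - apply filterlim_locally. intros eps. assert (He := cond_pos eps).
    exists (mkposreal _ (rpow_gt0 eps (/ q) He)). intros y Hy.
    assert (Hy' : Rabs (y - 0) < rpow eps (/ q)) by exact Hy. rewrite Rminus_0_r in Hy'.
    change (Rabs (rpow y q - rpow 0 q) < eps). rewrite rpow_0, Rminus_0_r, Rabs_pos_eq by apply rpow_nonneg.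
    rewrite <- (rpow_cancel_inv eps q) by lra.
    eapply Rle_lt_trans. apply (rpow_le y (Rabs y)). lra. apply Rle_abs.
    apply rpow_lt; auto. split; auto. apply Rabs_pos.
  - apply (continuous_ext_loc _ (fun x : R => Rpower x q)).
    + exists (mkposreal x Hx). intros y Hy.
      assert (Hy' : Rabs (y - x) < x) by exact Hy. apply Rabs_lt_between in Hy'.
      rewrite rpow_pos; lra.
    + unfold Rpower. apply (continuous_comp (fun x => q * ln x) exp).
      * apply (continuous_scal_r (V := R_NormedModule) q ln). apply (ex_derive_continuous ln). exists (/ x). now apply is_derive_ln.
      * apply (ex_derive_continuous exp). exists (exp (q * ln x)). apply is_derive_exp.
Qed.

(** * Integral means over circles *)

Definition avg (phi : R -> R) : R := RInt phi 0 (2 * PI) / (2 * PI).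

Definition rcont (phi : R -> R) := forall t, continuous phi t.

Lemma rcont_ex phi a b : rcont phi -> ex_RInt phi a b.
Proof. intro H. apply (ex_RInt_continuous (V := R_CompleteNormedModule)). intros; apply H. Qed.

Lemma avg_le phi psi : rcont phi -> rcont psi -> (forall t, phi t <= psi t) -> avg phi <= avg psi.
Proof.
  intros H1 H2 H. assert (HPI := PI_pos2). unfold avg. apply Rmult_le_compat_r.
  left; now apply Rinv_0_lt_compat. apply RInt_le; auto using rcont_ex. lra.
Qed.

Lemma avg_const c : avg (fun _ => c) = c.
Proof.
  assert (HPI := PI_pos2). unfold avg. rewrite RInt_const. unfold scal; simpl; unfold mult; simpl. field. 
  apply PI_neq0.
Qed.

Lemma avg_plus phi psi : rcont phi -> rcont psi -> avg (fun t => phi t + psi t) = avg phi + avg psi.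
Proof.
  intros H1 H2. assert (HPI := PI_pos2). unfold avg.
  rewrite (RInt_plus (V := R_CompleteNormedModule)) by auto using rcont_ex.
  unfold plus; simpl. field. apply PI_neq0.
Qed.

Lemma avg_scal k phi : rcont phi -> avg (fun t => k * phi t) = k * avg phi.
Proof.
  intros H1. assert (HPI := PI_pos2). unfold avg.
  rewrite (RInt_scal (V := R_CompleteNormedModule)) by auto using rcont_ex.
  unfold scal; simpl; unfold mult; simpl. field. apply PI_neq0.
Qed.

Lemma rcont_const c : rcont (fun _ => c).
Proof. intro. apply continuous_const. Qed.

Lemma rcont_plus phi psi : rcont phi -> rcont psi -> rcont (fun t => phi t + psi t).
Proof. intros H1 H2 t. apply (continuous_plus (V := R_NormedModule) phi psi); auto. Qed.

Lemma rcont_scal k phi : rcont phi -> rcont (fun t => k * phi t).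
Proof. intros H1 t. apply (continuous_scal_r (V := R_NormedModule) k phi); auto. Qed.

Lemma avg_nonneg phi : rcont phi -> (forall t, 0 <= phi t) -> 0 <= avg phi.
Proof. intros H H0. rewrite <- (avg_const 0). apply avg_le; auto using rcont_const. Qed.

Definition ccont (r : R) (f : C -> C) := forall t, Ccont (fun t => f (circ r t)) t.

Lemma ccont_disc f rho : 0 <= rho -> (forall w, Cmod w <= rho -> exists l, Cdiff f w l) -> ccont rho f.
Proof. intros H1 H2 t. now apply Ccont_circle. Qed.

Lemma ccont_analytic f r : analytic_on_D f -> 0 <= r < 1 -> ccont r f.
Proof. intros Hf Hr. apply ccont_disc. lra. now apply analytic_closed_disc. Qed.

Lemma rcont_rpow r f q : 0 < q -> ccont r f -> rcont (fun t => rpow (Cmod (f (circ r t))) q).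
Proof.
  intros Hq Hf t. apply (continuous_comp (fun t => Cmod (f (circ r t))) (fun x => rpow x q)).
  apply Ccont_Cmod. apply Hf. now apply rpow_continuous.
Qed.

(** The q-th power of the mean. Without the outer root it is linear in the integrand |f|^q, so sums
    and absorption arguments lose no constant even for q < 1. *)
Definition Amean (q r : R) (f : C -> C) : R := avg (fun t => rpow (Cmod (f (circ r t))) q).

Lemma Amean_nonneg q r f : 0 < q -> ccont r f -> 0 <= Amean q r f.
Proof. intros. apply avg_nonneg. now apply rcont_rpow. intro; apply rpow_nonneg. Qed.

Lemma nat_above x : exists n, x < INR n /\ (0 < n)%nat.
Proof.
  destruct (archimed (Rmax x 1)) as [H _]. exists (Z.to_nat (up (Rmax x 1))).
  assert (H1 := Rmax_l x 1). assert (H2 := Rmax_r x 1).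
  assert (H3 : (0 < up (Rmax x 1))%Z) by (apply lt_IZR; lra).
  split. rewrite INR_IZR_INZ, Z2Nat.id by lia. lra. lia.
Qed.

(* With [n > q] the Cauchy formula for [f^n] together with [|f|^n = |f|^q |f|^(n-q)] bounds [|f(a)|^n]
   by [X^((n-q)/q)] times the [q]-mean; either [|f(a)|^q <= eta X], or [X] can be absorbed. *)
Lemma subharmonic_absorb q : 0 < q -> forall eta, 0 < eta -> exists K, 0 < K /\
  forall f rho r X a, 0 < rho -> (forall w, Cmod w <= rho -> exists l, Cdiff f w l) ->
    (forall t, rpow (Cmod (f (circ rho t))) q <= X) -> Cmod a <= r -> r < rho ->
    rpow (Cmod (f a)) q <= eta * X + K * (rho / (rho - r) * Amean q rho f).
Proof.
  intros Hq eta Heta.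
  destruct (nat_above q) as [n [Hn Hn0]].
  (* So that |f|^n = (|f|^q)^k |f|^q with k > 0. *)
  set (k := (INR n - q) / q). assert (Hk : 0 < k) by (apply Rdiv_lt_0_compat; lra).
  exists (rpow (/ eta) k). split. apply rpow_gt0. now apply Rinv_0_lt_compat.
  intros f rho r X a Hrho Hf HX Ha Hr.
  assert (Hcf := ccont_disc f rho (Rlt_le _ _ Hrho) Hf).
  assert (HX0 : 0 <= X) by (eapply Rle_trans; [apply (rpow_nonneg (Cmod (f (circ rho 0))) q)|auto]).
  assert (HA := Amean_nonneg q rho f Hq Hcf). set (A := Amean q rho f) in *.
  assert (Hrr : 0 < rho / (rho - r)) by (apply Rdiv_lt_0_compat; lra).
  set (Y := rho / (rho - r) * A). assert (HY : 0 <= Y) by (unfold Y; apply Rmult_le_pos; lra).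
  assert (HfX : forall w, 0 <= w -> rpow w q <= X -> w ^ n <= rpow X k * rpow w q).
  { intros w Hw HwX. rewrite <- rpow_INR by auto.
    replace (INR n) with (q * k + q) by (unfold k; field; lra).
    rewrite rpow_plus, <- rpow_rpow by auto. apply Rmult_le_compat_r. apply rpow_nonneg.
    apply rpow_le; lra. }
  assert (Hmain : Cmod (f a) ^ n <= rpow X k * Y).
  { assert (HH : forall w, Cmod w <= rho -> exists l, Cdiff (fun w => f w ^ n)%C w l).
    { intros w Hw. destruct (Hf w Hw) as [l Hl]. now apply (Cdiff_pow f w l). }
    assert (H := Cauchy_bound (fun w => f w ^ n)%C rho r a Hrho Ha Hr HH).
    cbv beta in H. rewrite Cmod_pow in H. eapply Rle_trans. apply H.
    unfold Y. rewrite <- Rmult_assoc, (Rmult_comm (rpow X k)), Rmult_assoc.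
    apply Rmult_le_compat_l. lra. unfold A, Amean.
    rewrite <- avg_scal by now apply rcont_rpow.
    apply avg_le.
    - intro t. apply (Ccont_Cmod (fun t => f (circ rho t) ^ n)%C). apply (Ccont_circle (fun w => f w ^ n)%C); auto; lra.
    - apply rcont_scal. now apply rcont_rpow.
    - intro t. rewrite Cmod_pow. apply HfX; auto. apply Cmod_ge_0. }
  set (v := Cmod (f a)) in *. assert (Hv : 0 <= v) by apply Cmod_ge_0.
  assert (Hq0 := rpow_nonneg v q). assert (Hk0 := rpow_nonneg (/ eta) k).
  (* In the second case X < v^q/eta, hence X^k is at most eta^(-k) (v^q)^k, and the factor (v^q)^k
     cancels against v^n. This is where the constant eta^(-k) comes from. *)
  destruct (Rle_lt_dec (rpow v q) (eta * X)) as [L|L].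
  { assert (0 <= rpow (/ eta) k * Y) by (apply Rmult_le_pos; auto). lra. }
  assert (HV : 0 < rpow v q) by nra.
  assert (E1 : v ^ n = rpow (rpow v q) k * rpow v q).
  { rewrite <- rpow_INR by auto. replace (INR n) with (q * k + q) by (unfold k; field; lra).
    rewrite rpow_plus, <- rpow_rpow by auto. reflexivity. }
  assert (E2 : rpow X k <= rpow (/ eta) k * rpow (rpow v q) k).
  { rewrite <- rpow_mult_distr; auto. apply rpow_le. lra.
    rewrite Rmult_comm. apply Rle_div_r; lra. left; now apply Rinv_0_lt_compat. }
  assert (P1 := rpow_gt0 _ k HV).
  assert (E3 : rpow (rpow v q) k * rpow v q <= rpow (rpow v q) k * (rpow (/ eta) k * Y)).
  { rewrite <- E1. eapply Rle_trans. apply Hmain. rewrite <- Rmult_assoc. apply Rmult_le_compat_r; auto. lra. }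
  apply Rmult_le_reg_l in E3; auto. assert (0 <= eta * X) by (apply Rmult_le_pos; lra). lra.
Qed.

Lemma Rpower_le_contra x y k : 0 < x <= y -> 0 <= k -> Rpower y (- k) <= Rpower x (- k).
Proof.
  intros Hx Hk. rewrite !Rpower_Ropp. apply Rinv_le_contravar. apply Rpower_pos. apply Rle_Rpower_l; lra.
Qed.

Lemma Rpower_half x k : 0 < x -> Rpower (x / 2) (- k) = Rpower 2 k * Rpower x (- k).
Proof.
  intros Hx. unfold Rdiv. rewrite <- Rpower_mult_distr by lra.
  rewrite Rmult_comm. f_equal. unfold Rpower. rewrite ln_Rinv by lra. f_equal. ring.
Qed.

Lemma pow_small eta M e : 0 <= eta < 1 -> 0 <= M -> 0 < e -> exists n, eta ^ n * M < e.
Proof.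
  intros He HM Hpos.
  destruct (pow_lt_1_zero eta) with (y := e / (M + 1)) as [N HN].
  rewrite Rabs_pos_eq; lra. apply Rdiv_lt_0_compat; lra.
  exists N. specialize (HN N (Nat.le_refl _)). rewrite Rabs_pos_eq in HN by (apply pow_le; lra).
  apply Rlt_div_r in HN; [|lra]. assert (0 <= eta ^ N) by (apply pow_le; lra). nra.
Qed.

(** The absorption estimate is iterated over circles whose distance to a fixed circle |w| = R0 < 1
    is halved each time. Analyticity gives some bound [M] on |w| <= R0, of uncontrolled size, but it
    enters only as eta^n M and vanishes in the limit, so the constant does not depend on f. The
    exponent exceeds alpha q by 1 because of the kernel factor rho/(rho - r). *)
Lemma pointwise_mean q alpha : 0 < q -> 0 < alpha -> exists K, 0 < K /\
  forall f N, 0 <= N -> analytic_on_D f ->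
   (forall r, 0 <= r < 1 -> Amean q r f <= N * Rpower (1 - r) (- (alpha * q))) ->
   forall z, inD z -> rpow (Cmod (f z)) q <= K * N * Rpower (1 - Cmod z) (- (alpha * q + 1)).
Proof.
  intros Hq Halpha. set (kap := alpha * q + 1).
  assert (Haq : 0 < alpha * q) by (apply Rmult_lt_0_compat; auto).
  (* Halving the distance multiplies the growth term by 2^kap; this [eta] turns the old bound 2 B
     into B, leaving room for the new contribution B. *)
  set (eta := / (2 * Rpower 2 kap)).
  assert (HP2 := Rpower_pos 2 kap).
  assert (HP1 : 1 <= Rpower 2 kap). { rewrite <- (Rpower_O 2) by lra. apply Rle_Rpower; unfold kap; lra. }
  assert (Heta : 0 < eta < 1).
  { unfold eta. split. apply Rinv_0_lt_compat; lra. rewrite <- Rinv_1. apply Rinv_lt_contravar; lra. }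
  destruct (subharmonic_absorb q Hq eta (proj1 Heta)) as [K [HK Hcore]].
  exists (4 * K * Rpower 2 kap * Rpower 2 kap). split. { repeat apply Rmult_lt_0_compat; lra. }
  intros f N HN Hf HA z Hz. unfold inD in Hz. assert (Hz0 := Cmod_ge_0 z).
  set (R0 := (1 + Cmod z) / 2). assert (HR0 : Cmod z < R0 < 1) by (unfold R0; lra).
  destruct (analytic_bounded f R0 Hf ltac:(lra)) as [B0 [HB0 HB]].
  set (M := rpow B0 q). assert (HM0 : 0 <= M) by apply rpow_nonneg.
  set (B := 2 * K * N * Rpower 2 kap). assert (HBp : 0 <= B) by (unfold B; repeat apply Rmult_le_pos; lra).
  (* The first term is a fixed point of the recursion and the second a geometrically decaying error.
     The intermediate radius is the midpoint between rho and R0. *)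
  assert (Hind : forall n rho w, 0 <= rho < R0 -> Cmod w <= rho ->
     rpow (Cmod (f w)) q <= 2 * B * Rpower (R0 - rho) (- kap) + eta ^ n * M).
  { induction n as [|n IH]; intros rho w Hrho Hw.
    - simpl. assert (rpow (Cmod (f w)) q <= M) by (apply rpow_le; [lra|]; apply HB; lra).
      assert (P := Rpower_pos (R0 - rho) (- kap)). nra.
    - set (rho' := (rho + R0) / 2). assert (Hrho' : rho < rho' < R0) by (unfold rho'; lra).
      set (X := 2 * B * Rpower (R0 - rho') (- kap) + eta ^ n * M).
      assert (H := Hcore f rho' rho X w ltac:(lra) (analytic_closed_disc f rho' Hf ltac:(lra))).
      assert (HX : forall t, rpow (Cmod (f (circ rho' t))) q <= X).
      { intro t. apply IH. lra. rewrite Cmod_circ; lra. }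
      specialize (H HX Hw (proj1 Hrho')). eapply Rle_trans. apply H.
      set (x := R0 - rho). assert (Hx : 0 < x) by (unfold x; lra).
      assert (Ex : R0 - rho' = x / 2) by (unfold rho', x; field).
      assert (Ex' : rho' - rho = x / 2) by (unfold rho', x; field).
      unfold X. rewrite Ex, Ex', Rpower_half by auto.
      set (P := Rpower x (- kap)). assert (HP := Rpower_pos x (- kap)). fold P in HP.
      assert (H1 : eta * (2 * B * (Rpower 2 kap * P) + eta ^ n * M) = B * P + eta ^ S n * M).
      { simpl. unfold eta. field. lra. }
      rewrite H1.
      assert (H2 : rho' / (x / 2) * Amean q rho' f <= 2 * N * Rpower 2 kap * P).
      { assert (HAr := HA rho' ltac:(lra)).
        assert (HAr2 : Amean q rho' f <= N * (Rpower 2 (alpha * q) * Rpower x (- (alpha * q)))).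
        { eapply Rle_trans. apply HAr. apply Rmult_le_compat_l; auto.
          rewrite <- Rpower_half by auto. apply Rpower_le_contra. lra. lra. }
        assert (EP : P = Rpower x (- (alpha * q)) * / x).
        { unfold P, kap. rewrite Ropp_plus_distr, Rpower_plus. f_equal. rewrite Rpower_Ropp, Rpower_1; auto. }
        assert (E2 : Rpower 2 (alpha * q) <= Rpower 2 kap) by (apply Rle_Rpower; unfold kap; lra).
        replace (rho' / (x / 2)) with (rho' * (2 * / x)) by (field; lra).
        assert (Hix : 0 < / x) by now apply Rinv_0_lt_compat.
        set (y := Rpower x (- (alpha * q))) in *. assert (Hy : 0 < y) by apply Rpower_pos.
        assert (HAn : 0 <= Amean q rho' f) by (apply Amean_nonneg; auto; apply ccont_analytic; auto; lra).
        assert (N * (Rpower 2 (alpha * q) * y) <= N * (Rpower 2 kap * y)).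
        { apply Rmult_le_compat_l; auto. apply Rmult_le_compat_r; lra. }
        rewrite EP.
        apply Rle_trans with (1 * (2 * / x) * (N * (Rpower 2 kap * y))).
        - apply Rmult_le_compat; auto. apply Rmult_le_pos; lra. apply Rmult_le_compat_r; lra. lra.
        - right. ring. }
      assert (H3 : K * (rho' / (x / 2) * Amean q rho' f) <= B * P).
      { eapply Rle_trans. apply Rmult_le_compat_l. lra. apply H2. unfold B. right. ring. }
      lra. }
  assert (Hfin : rpow (Cmod (f z)) q <= 2 * B * Rpower (R0 - Cmod z) (- kap)).
  { apply le_epsilon. intros e He. destruct (pow_small eta M e ltac:(lra) HM0 He) as [n Hn].
    specialize (Hind n (Cmod z) z ltac:(lra) ltac:(lra)). lra. }
  replace (R0 - Cmod z) with ((1 - Cmod z) / 2) in Hfin by (unfold R0; field).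
  rewrite Rpower_half in Hfin by lra. eapply Rle_trans. apply Hfin. unfold B. right. ring.
Qed.

(** * Mixed norms and pointwise growth *)

(** [real] maps an infinite least upper bound to 0, so the supremum properties require a member and
    an upper bound. *)
Lemma Lub_bounded (E : R -> Prop) (x0 B : R) : E x0 -> (forall x, E x -> x <= B) ->
  (forall x, E x -> x <= real (Lub_Rbar E)) /\
  (forall B', (forall x, E x -> x <= B') -> real (Lub_Rbar E) <= B').
Proof.
  intros H0 HB. destruct (Lub_Rbar_correct E) as [H1 H2].
  assert (K1 := H1 x0 H0). assert (K2 := H2 (Finite B) (fun x Hx => HB x Hx)).
  destruct (Lub_Rbar E) as [l| |]; simpl in *; try contradiction.
  split. exact H1. intros B' HB'. exact (H2 (Finite B') HB').
Qed.

Lemma ccont_bounded r f : ccont r f -> exists U, 0 <= U /\ forall t, Cmod (f (circ r t)) <= U.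
Proof.
  intros Hf. assert (HPI := PI_pos2).
  destruct (Ccont_bounded (fun t => f (circ r t)) 0 (2 * PI)) as [U HU]. lra. exact Hf.
  assert (HU' : forall t, Cmod (f (circ r t)) <= U).
  { intro t. destruct (angle_reduce t) as [s [Hs E]]. rewrite E. auto. }
  exists U. split; auto. eapply Rle_trans; [apply (Cmod_ge_0 (f (circ r 0)))|auto].
Qed.

Lemma polar (z : C) : exists t, z = circ (Cmod z) t.
Proof.
  destruct (Req_dec (Cmod z) 0) as [E|E].
  { exists 0. rewrite E. apply Cmod_eq_0 in E. rewrite E. unfold circ, RtoC. f_equal; ring. }
  assert (H0 := Cmod_ge_0 z). set (m := Cmod z) in *. assert (Hm : 0 < m) by lra.
  assert (Hsq : m ^ 2 = fst z ^ 2 + snd z ^ 2) by (unfold m; rewrite Cmod2_alt; reflexivity).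
  set (x := fst z / m). set (y := snd z / m).
  assert (Hxy : x * x + y * y = 1).
  { unfold x, y. replace (fst z / m * (fst z / m) + snd z / m * (snd z / m)) with ((fst z ^ 2 + snd z ^ 2) / m ^ 2) by (field; lra).
    rewrite <- Hsq. field. lra. }
  assert (Hx : -1 <= x <= 1) by nra.
  assert (Hc := cos_acos x Hx). assert (Hs := sin_acos x Hx).
  assert (Hy2 : sqrt (1 - x²) = Rabs y).
  { replace (1 - x²) with (y²) by (unfold Rsqr; lra). apply sqrt_Rsqr_abs. }
  rewrite Hy2 in Hs.
  assert (Ez : z = (m * x, m * y)).
  { unfold x, y. destruct z as [z1 z2]. simpl. f_equal; field; lra. }
  destruct (Rle_dec 0 y) as [L|L].
  - exists (acos x). unfold circ. rewrite Hc, Hs, Rabs_pos_eq by auto. exact Ez.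
  - exists (- acos x). unfold circ. rewrite cos_neg, sin_neg, Hc, Hs, Rabs_left by lra.
    rewrite Ropp_involutive. exact Ez.
Qed.

Section MeanNorm.

Variable p : Rbar.
Hypothesis Hp : Rbar_lt (Finite 0) p.

Lemma Mp_inf_spec r f : ccont r f ->
  (forall t, Cmod (f (circ r t)) <= Mp p_infty r f) /\
  (forall B, (forall t, Cmod (f (circ r t)) <= B) -> Mp p_infty r f <= B).
Proof.
  intro Hf. destruct (ccont_bounded r f Hf) as [U [_ HU]].
  destruct (Lub_bounded (fun x => exists theta : R, x = Cmod (f (circ r theta))) (Cmod (f (circ r 0))) U) as [H1 H2].
  - now exists 0.
  - intros x [t ->]. auto.
  - split.
    + intro t. apply H1. now exists t.
    + intros B HB. apply H2. intros x [t ->]. auto.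
Qed.

Lemma Mp_finite q r f : Mp (Finite q) r f = rpow (Amean q r f) (/ q).
Proof. reflexivity. Qed.

Lemma Mp_finite_le q r f B : 0 < q -> ccont r f -> 0 <= B ->
  Mp (Finite q) r f <= B <-> Amean q r f <= rpow B q.
Proof.
  intros Hq Hf HB. rewrite Mp_finite. assert (HA := Amean_nonneg q r f Hq Hf). split; intro H.
  - rewrite <- (rpow_cancel_inv (Amean q r f) q) by auto. apply rpow_le; lra.
  - rewrite <- (rpow_inv_cancel B q) by auto. apply rpow_le; auto. left; now apply Rinv_0_lt_compat.
Qed.

Lemma Amean_Mp q r f : 0 < q -> ccont r f -> Amean q r f = rpow (Mp (Finite q) r f) q.
Proof. intros Hq Hf. rewrite Mp_finite, rpow_cancel_inv; auto. now apply Amean_nonneg. Qed.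

Lemma Mp_nonneg r f : ccont r f -> 0 <= Mp p r f.
Proof.
  intro Hf. destruct p as [q| |]; [|destruct (Mp_inf_spec r f Hf) as [H _]|now simpl in Hp].
  - rewrite Mp_finite. apply rpow_nonneg.
  - eapply Rle_trans; [apply (Cmod_ge_0 (f (circ r 0)))|apply H].
Qed.

(** For finite q the constant is 2 from [rpow_sum_le] after the root, times 2^(1/q) from U^q + V^q
    <= 2 (U + V)^q. Pointwise domination instead of f = u + v lets a constant function stand for an
    error term. *)
Lemma Mp_quasi : exists K, 1 <= K /\ forall r f u v, ccont r f -> ccont r u -> ccont r v ->
  (forall t, Cmod (f (circ r t)) <= Cmod (u (circ r t)) + Cmod (v (circ r t))) ->
  Mp p r f <= K * (Mp p r u + Mp p r v).
Proof.
  assert (Hnn := Mp_nonneg).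
  destruct p as [q| |]; [|exists 1; split; [lra|]|now simpl in Hp].
  - simpl in Hp. set (K := rpow 2 (/ q)). assert (HK : 0 < K) by (apply rpow_gt0; lra).
    assert (HK1 : 1 <= K).
    { unfold K. rewrite rpow_pos by lra. rewrite <- (Rpower_O 2) by lra. apply Rle_Rpower. lra. left; now apply Rinv_0_lt_compat. }
    exists (2 * K). split. lra.
    intros r f u v Hf Hu Hv H.
    assert (Pu := Hnn r u Hu). assert (Pv := Hnn r v Hv).
    apply Mp_finite_le; auto. { apply Rmult_le_pos; lra. }
    assert (HA : Amean q r f <= rpow 2 q * (Amean q r u + Amean q r v)).
    { unfold Amean. rewrite <- avg_plus by now apply rcont_rpow.
      rewrite <- avg_scal by (apply rcont_plus; now apply rcont_rpow).
      apply avg_le. now apply rcont_rpow. apply rcont_scal, rcont_plus; now apply rcont_rpow.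
      intro t. eapply Rle_trans. apply (rpow_le _ _ q (Rlt_le _ _ Hp) (H t)).
      apply rpow_sum_le; auto using Cmod_ge_0. }
    eapply Rle_trans. apply HA.
    rewrite (Amean_Mp q r u), (Amean_Mp q r v) by auto.
    set (U := Mp q r u) in *. set (V := Mp q r v) in *.
    rewrite Rmult_assoc, rpow_mult_distr; [|lra|apply Rmult_le_pos; lra].
    apply Rmult_le_compat_l. apply rpow_nonneg.
    rewrite rpow_mult_distr by lra. unfold K. rewrite rpow_cancel_inv by lra.
    assert (rpow U q <= rpow (U + V) q) by (apply rpow_le; lra).
    assert (rpow V q <= rpow (U + V) q) by (apply rpow_le; lra). lra.
  - intros r f u v Hf Hu Hv H.
    destruct (Mp_inf_spec r f Hf) as [_ H1]. destruct (Mp_inf_spec r u Hu) as [H2 _]. destruct (Mp_inf_spec r v Hv) as [H3 _].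
    apply H1. intro t. specialize (H t). specialize (H2 t). specialize (H3 t). lra.
Qed.

Lemma Mp_mono_scal k r f u : 0 <= k -> ccont r f -> ccont r u ->
  (forall t, Cmod (f (circ r t)) <= k * Cmod (u (circ r t))) -> Mp p r f <= k * Mp p r u.
Proof.
  intros Hk Hf Hu H. assert (Pu := Mp_nonneg r u Hu).
  destruct p as [q| |]; [| |now simpl in Hp].
  - simpl in Hp. apply Mp_finite_le; auto. apply Rmult_le_pos; auto.
    rewrite rpow_mult_distr, <- Amean_Mp by auto. unfold Amean. rewrite <- avg_scal by now apply rcont_rpow.
    apply avg_le. now apply rcont_rpow. apply rcont_scal. now apply rcont_rpow.
    intro t. rewrite <- rpow_mult_distr; auto using Cmod_ge_0. apply rpow_le; auto. lra.
  - destruct (Mp_inf_spec r f Hf) as [_ H1]. destruct (Mp_inf_spec r u Hu) as [H2 _].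
    apply H1. intro t. specialize (H t). specialize (H2 t). nra.
Qed.

Lemma Mp_bound B r f : 0 <= B -> ccont r f -> (forall t, Cmod (f (circ r t)) <= B) -> Mp p r f <= B.
Proof.
  intros HB Hf H.
  destruct p as [q| |]; [| |now simpl in Hp].
  - simpl in Hp. apply Mp_finite_le; auto. rewrite <- (avg_const (rpow B q)).
    apply avg_le. now apply rcont_rpow. apply rcont_const. intro t. apply rpow_le; auto. lra.
  - now apply (Mp_inf_spec r f Hf).
Qed.

Lemma Mp_ext r f h : (forall t, f (circ r t) = h (circ r t)) -> Mp p r f = Mp p r h.
Proof.
  clear Hp. intro H. destruct p as [q| |]; simpl; [do 2 f_equal|f_equal|f_equal].
  - apply RInt_ext. intros t _. now rewrite H.
  - f_equal. apply functional_extensionality. intro x. f_equal. apply functional_extensionality. intro t. now rewrite H.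
  - f_equal. apply functional_extensionality. intro x. f_equal. apply functional_extensionality. intro t. now rewrite H.
Qed.

Variable alpha : R.
Hypothesis Halpha : 0 < alpha.

Lemma Hinf_ccont f r : Hinf p alpha f -> 0 <= r < 1 -> ccont r f.
Proof. intros [Hf _] Hr. now apply ccont_analytic. Qed.

Lemma wMp_nonneg r f : ccont r f -> 0 <= wMp p alpha r f.
Proof. intro H. apply Rmult_le_pos. left; apply Rpower_pos. now apply Mp_nonneg. Qed.

Lemma Hnorm_spec f : Hinf p alpha f ->
  (forall r, 0 <= r < 1 -> wMp p alpha r f <= Hnorm p alpha f) /\
  (forall B, (forall r, 0 <= r < 1 -> wMp p alpha r f <= B) -> Hnorm p alpha f <= B).
Proof.
  intros [Hf [K HK]].
  destruct (Lub_bounded (fun x => exists r : R, 0 <= r < 1 /\ x = wMp p alpha r f) (wMp p alpha 0 f) K) as [H1 H2].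
  - exists 0. split; [lra|auto].
  - intros x [r [Hr ->]]. auto.
  - split.
    + intros r Hr. apply H1. now exists r.
    + intros B HB. apply H2. intros x [r [Hr ->]]. auto.
Qed.

Lemma Hnorm_nonneg f : Hinf p alpha f -> 0 <= Hnorm p alpha f.
Proof.
  intro H. destruct (Hnorm_spec f H) as [H1 _]. eapply Rle_trans; [|apply (H1 0); lra].
  apply wMp_nonneg. apply Hinf_ccont; auto. lra.
Qed.

Lemma wMp_ext r f h : (forall z, inD z -> f z = h z) -> 0 <= r < 1 -> wMp p alpha r f = wMp p alpha r h.
Proof.
  intros H Hr. unfold wMp. f_equal. apply Mp_ext. intro t. apply H. unfold inD. rewrite Cmod_circ; lra.
Qed.

Lemma Hinf_ext f h : (forall z, inD z -> f z = h z) -> Hinf p alpha f -> Hinf p alpha h.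
Proof.
  intros E [Hf [K HK]]. split. now apply (analytic_ext f). exists K. intros r Hr.
  rewrite <- (wMp_ext r f); auto.
Qed.

Lemma H0_ext f h : (forall z, inD z -> f z = h z) -> H0 p alpha f -> H0 p alpha h.
Proof.
  intros E [Hf H]. split. now apply (Hinf_ext f). intros eps He. destruct (H eps He) as [d [Hd Hd']].
  exists (Rmin d 1). split. apply Rmin_glb_lt; lra. intros r Hr.
  assert (K1 := Rmin_l d 1). assert (K2 := Rmin_r d 1).
  rewrite <- (wMp_ext r f); auto. apply Hd'. lra. lra.
Qed.

Lemma Hnorm_ext f h : (forall z, inD z -> f z = h z) -> Hnorm p alpha f = Hnorm p alpha h.
Proof.
  intros E. unfold Hnorm. do 2 f_equal. apply functional_extensionality. intro x. f_equal.
  apply functional_extensionality. intro r.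
  apply propositional_extensionality. split; intros [H1 H2]; split; auto.
  now rewrite <- (wMp_ext r f h). now rewrite (wMp_ext r f h).
Qed.

Lemma Hinf_quasi_plus : exists K, 1 <= K /\ forall f u v, analytic_on_D f -> Hinf p alpha u -> Hinf p alpha v ->
  (forall z, inD z -> Cmod (f z) <= Cmod (u z) + Cmod (v z)) ->
  Hinf p alpha f /\ Hnorm p alpha f <= K * (Hnorm p alpha u + Hnorm p alpha v).
Proof.
  destruct Mp_quasi as [K [HK1 HK]]. exists K. split; auto. intros f u v Hf Hu Hv H.
  assert (HB : forall r, 0 <= r < 1 -> wMp p alpha r f <= K * (Hnorm p alpha u + Hnorm p alpha v)).
  { intros r Hr. destruct (Hnorm_spec u Hu) as [H1 _]. destruct (Hnorm_spec v Hv) as [H2 _].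
    specialize (H1 r Hr). specialize (H2 r Hr). unfold wMp in *.
    assert (P := Rpower_pos (1 - r) alpha).
    assert (HM := HK r f u v (ccont_analytic f r Hf Hr) (Hinf_ccont u r Hu Hr) (Hinf_ccont v r Hv Hr)).
    assert (HM' : Mp p r f <= K * (Mp p r u + Mp p r v)).
    { apply HM. intro t. apply H. unfold inD. rewrite Cmod_circ; lra. }
    apply Rmult_le_compat_l with (r := Rpower (1 - r) alpha) in HM'; [|lra]. nra. }
  assert (Hi : Hinf p alpha f) by (split; [auto|eexists; apply HB]).
  split; auto. now apply (Hnorm_spec f Hi).
Qed.

(* The exponent of the sharp pointwise growth of functions in H(p,oo,alpha). *)
Definition gexp : R := match p with Finite q => alpha + / q | _ => alpha end.

Lemma gexp_ge : alpha <= gexp.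
Proof.
  unfold gexp. destruct p as [q| |]; try lra. simpl in Hp. assert (0 < / q) by now apply Rinv_0_lt_compat. lra.
Qed.

Lemma Rpower_inv_mult x a b : 0 < x -> 0 <= b -> forall M, Rpower x a * M <= b -> M <= b * Rpower x (- a).
Proof.
  intros Hx Hb M H. rewrite Rpower_Ropp. assert (P := Rpower_pos x a). apply Rle_div_r; lra.
Qed.

Lemma Amean_of_norm q f N : 0 < q -> 0 <= N -> analytic_on_D f ->
  (forall r, 0 <= r < 1 -> wMp (Finite q) alpha r f <= N) ->
  forall r, 0 <= r < 1 -> Amean q r f <= rpow N q * Rpower (1 - r) (- (alpha * q)).
Proof.
  intros Hq HN Hf H r Hr. specialize (H r Hr). unfold wMp in H. apply Rpower_inv_mult in H; try lra.
  assert (Hc := ccont_analytic f r Hf Hr).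
  apply Mp_finite_le in H; auto.
  2: { apply Rmult_le_pos; auto. left; apply Rpower_pos. }
  rewrite rpow_mult_distr in H; [|lra|left; apply Rpower_pos].
  rewrite (rpow_pos (Rpower (1 - r) (- alpha))) in H by apply Rpower_pos. rewrite Rpower_mult in H.
  replace (- (alpha * q)) with (- alpha * q) by ring. auto.
Qed.

(** The q-th root turns the exponent alpha q + 1 into alpha + 1/q. For p infinite, a point lies on
    its own circle and the mean there already dominates it. *)
Lemma pointwise_norm : exists K, 0 < K /\ forall f, Hinf p alpha f ->
  forall z, inD z -> Cmod (f z) <= K * Hnorm p alpha f * Rpower (1 - Cmod z) (- gexp).
Proof.
  unfold gexp. 
  assert (HS := Hnorm_spec). assert (HN := Hnorm_nonneg).
  destruct p as [q| |]; [| |now simpl in Hp].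
  - simpl in Hp. destruct (pointwise_mean q alpha Hp Halpha) as [K [HK Hpt]].
    exists (rpow K (/ q)). split. now apply rpow_gt0. intros f Hf z Hz.
    destruct (HS f Hf) as [H1 _]. specialize (HN f Hf). destruct Hf as [Hf _]. set (N := Hnorm q alpha f) in *.
    assert (H := Hpt f (rpow N q) (rpow_nonneg _ _) Hf (Amean_of_norm q f N Hp HN Hf H1) z Hz).
    apply rpow_le_inv in H; auto using Cmod_ge_0. eapply Rle_trans. apply H.
    assert (P := Rpower_pos (1 - Cmod z) (- (alpha * q + 1))).
    rewrite rpow_mult_distr; [|apply Rmult_le_pos; [lra|apply rpow_nonneg]|lra].
    rewrite rpow_mult_distr; [|lra|apply rpow_nonneg].
    rewrite rpow_inv_cancel by auto. rewrite (rpow_pos (Rpower _ _)) by auto. rewrite Rpower_mult.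
    right. f_equal. f_equal. field. lra.
  - exists 1. split. lra. intros f Hf z Hz.
    destruct (HS f Hf) as [H1 _]. specialize (HN f Hf). 
    unfold inD in Hz. assert (Hz0 := Cmod_ge_0 z). specialize (H1 (Cmod z) ltac:(lra)). destruct Hf as [Hf _].
    unfold wMp in H1. apply Rpower_inv_mult in H1; try lra.
    destruct (Mp_inf_spec (Cmod z) f) as [H2 _]. apply ccont_analytic; auto; lra.
    destruct (polar z) as [t Ht]. specialize (H2 t). rewrite <- Ht in H2. lra.
Qed.

(** Cauchy's estimate on the disc of radius (1 - |z|)/2: the radius costs the factor 2 and one more
    power, the halved distance to the circle costs 2^gexp. *)
Lemma Hnorm_deriv_bound : exists K, 0 < K /\ forall f, Hinf p alpha f ->
  forall z, inD z -> Cmod (C_derive f z) <= K * Hnorm p alpha f * Rpower (1 - Cmod z) (- (gexp + 1)).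
Proof.
  destruct pointwise_norm as [K [HK H]]. assert (Hg := gexp_ge).
  exists (2 * Rpower 2 gexp * K). split. { assert (P := Rpower_pos 2 gexp). nra. }
  intros f Hf z Hz. assert (HN := Hnorm_nonneg f Hf). set (N := Hnorm p alpha f) in *.
  unfold inD in Hz. set (d := (1 - Cmod z) / 2). assert (Hd : 0 < d) by (unfold d; lra).
  eapply Rle_trans. apply (Cauchy_estimate f z d (K * N * Rpower d (- gexp))). apply Hf. auto. unfold d; lra.
  - intros w Hw. assert (K' := Cmod_triangle_minus w z).
    assert (Hw1 : inD w) by (unfold inD, d in *; lra).
    eapply Rle_trans. apply (H f Hf w Hw1). apply Rmult_le_compat_l. apply Rmult_le_pos; lra.
    apply Rpower_le_contra; [|lra]. unfold d in *; lra.
  - unfold d at 1. rewrite Rpower_half by lra. rewrite Ropp_plus_distr, Rpower_plus.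
    rewrite (Rpower_Ropp (1 - Cmod z) 1), Rpower_1 by lra. unfold d. right. field. lra.
Qed.

End MeanNorm.

(** * Boundedness of the integral operator *)

Fixpoint fsum (F : nat -> R) (n : nat) : R :=
  match n with O => 0 | S m => fsum F m + F m end.

Lemma fsum_le F G n : (forall j, F j <= G j) -> fsum F n <= fsum G n.
Proof. intro H. induction n; simpl. lra. specialize (H n). lra. Qed.

Lemma fsum_const c n : fsum (fun _ => c) n = INR n * c.
Proof. induction n. simpl; ring. rewrite S_INR. simpl fsum. rewrite IHn. ring. Qed.

Lemma fsum_lin a b F G n : fsum (fun j => a * F j + b * G j) n = a * fsum F n + b * fsum G n.
Proof. induction n; simpl. ring. rewrite IHn. ring. Qed.

Lemma fsum_ext F G n : (forall j, F j = G j) -> fsum F n = fsum G n.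
Proof. intro H. induction n; simpl; auto. now rewrite IHn, H. Qed.

Lemma rcont_fsum (phi : nat -> R -> R) n : (forall j, rcont (phi j)) -> rcont (fun t => fsum (fun j => phi j t) n).
Proof. intro H. induction n; simpl. apply rcont_const. now apply rcont_plus. Qed.

Lemma avg_fsum (phi : nat -> R -> R) n : (forall j, rcont (phi j)) ->
  avg (fun t => fsum (fun j => phi j t) n) = fsum (fun j => avg (phi j)) n.
Proof.
  intro H. induction n; simpl. apply avg_const.
  rewrite avg_plus; auto. now rewrite IHn. now apply rcont_fsum.
Qed.

Lemma Riemann_error phi a d e n : rcont phi -> 0 <= d ->
  (forall s t, Rabs (s - t) <= d -> Rabs (phi s - phi t) <= e) ->
  Rabs (RInt phi a (a + INR n * d) - d * fsum (fun j => phi (a + INR j * d)) n) <= INR n * d * e.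
Proof.
  intros Hc Hd He. induction n as [|n IH].
  - simpl. rewrite Rmult_0_l, Rplus_0_r, (RInt_point a phi). unfold zero; simpl.
    rewrite Rmult_0_r, Rminus_0_r, Rabs_R0. lra.
  - set (b := a + INR n * d) in *.
    assert (Eb : a + INR (S n) * d = b + d) by (rewrite S_INR; unfold b; ring). rewrite Eb.
    rewrite <- (RInt_Chasles phi a b (b + d)) by now apply rcont_ex.
    simpl fsum. fold b.
    change (plus (RInt phi a b) (RInt phi b (b + d))) with (RInt phi a b + RInt phi b (b + d)).
    assert (H1 : Rabs (RInt phi b (b + d) - d * phi b) <= d * e).
    { replace (RInt phi b (b + d) - d * phi b) with (RInt (fun t => phi t - phi b) b (b + d)).
      - replace (d * e) with ((b + d - b) * e) by ring.
        apply abs_RInt_le_const. lra. apply (rcont_ex (fun t => phi t - phi b)).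
        intro t. apply (continuous_minus (V := R_NormedModule)). apply Hc. apply continuous_const.
        intros t Ht. apply He. rewrite Rabs_pos_eq; lra.
      - rewrite (RInt_minus (V := R_CompleteNormedModule)); [|now apply rcont_ex|apply ex_RInt_const].
        rewrite RInt_const. unfold minus, plus, opp, scal; simpl. unfold mult; simpl. ring. }
    rewrite S_INR.
    replace (RInt phi a b + RInt phi b (b + d) - d * (fsum (fun j => phi (a + INR j * d)) n + phi b)) with
      ((RInt phi a b - d * fsum (fun j => phi (a + INR j * d)) n) + (RInt phi b (b + d) - d * phi b)) by ring.
    eapply Rle_trans. apply Rabs_triang. apply Rle_trans with (INR n * d * e + d * e). apply Rplus_le_compat; [exact IH|exact H1]. right; ring.
Qed.

Lemma RInt_period phi a : rcont phi -> (forall t, phi (t + 2 * PI) = phi t) ->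
  RInt phi a (a + 2 * PI) = RInt phi 0 (2 * PI).
Proof.
  intros Hc Hper.
  assert (H1 : RInt phi (2 * PI) (a + 2 * PI) = RInt phi 0 a).
  { assert (H := RInt_comp_lin phi 1 (2 * PI) 0 a).
    replace (1 * 0 + 2 * PI) with (2 * PI) in H by ring. replace (1 * a + 2 * PI) with (a + 2 * PI) in H by ring.
    rewrite <- H by now apply rcont_ex. apply RInt_ext. intros t _. unfold scal; simpl; unfold mult; simpl.
    rewrite !Rmult_1_l. apply Hper. }
  assert (H2 := RInt_Chasles phi a 0 (a + 2 * PI) (rcont_ex _ _ _ Hc) (rcont_ex _ _ _ Hc)).
  assert (H3 := RInt_Chasles phi 0 (2 * PI) (a + 2 * PI) (rcont_ex _ _ _ Hc) (rcont_ex _ _ _ Hc)).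
  assert (H4 := RInt_Chasles phi 0 a 0 (rcont_ex _ _ _ Hc) (rcont_ex _ _ _ Hc)).
  rewrite (RInt_point 0 phi) in H4.
  unfold plus, zero in *; simpl in *. rewrite H1 in H3. lra.
Qed.

(** By periodicity the sampling may start at any angle [psi]; this freedom is needed because the
    points to be rotated have arbitrary argument. *)
Lemma discrete_mean phi psi n e : rcont phi -> (forall t, phi (t + 2 * PI) = phi t) -> (0 < n)%nat ->
  (forall s t, Rabs (s - t) <= 2 * PI / INR n -> Rabs (phi s - phi t) <= e) ->
  Rabs (avg phi - fsum (fun j => phi (psi + INR j * (2 * PI / INR n))) n / INR n) <= e.
Proof.
  intros Hc Hper Hn He. assert (HPI := PI_pos2).
  assert (HnR : 0 < INR n) by now apply lt_0_INR.
  assert (Hd : 0 < 2 * PI / INR n) by (apply Rdiv_lt_0_compat; lra).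
  assert (H := Riemann_error phi psi (2 * PI / INR n) e n Hc ltac:(lra) He).
  replace (INR n * (2 * PI / INR n)) with (2 * PI) in H by (field; lra).
  rewrite RInt_period in H by auto. unfold avg.
  set (S := fsum _ n) in *.
  replace (RInt phi 0 (2 * PI) / (2 * PI) - S / INR n) with
    ((RInt phi 0 (2 * PI) - 2 * PI / INR n * S) / (2 * PI)) by (field; split; [lra|apply PI_neq0]).
  unfold Rdiv at 1. rewrite Rabs_mult, (Rabs_pos_eq (/ (2 * PI))) by (left; now apply Rinv_0_lt_compat).
  apply Rle_div_l; lra.
Qed.

Lemma circ_period r t : circ r (t + 2 * PI) = circ r t.
Proof. unfold circ. now rewrite cos_plus, sin_plus, cos_2PI, sin_2PI, !Rmult_0_r, !Rmult_1_r, Rminus_0_r, Rplus_0_r. Qed.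

(** The modulus of continuity in the angle is uniform over all radii up to R1, so one mesh serves
    all circles: f is Lipschitz on the disc and [rpow] is uniformly continuous on the range of
    |f|. *)
Lemma mean_modulus f q R1 e : 0 < q -> analytic_on_D f -> R1 < 1 -> 0 < e -> exists d, 0 < d /\
  forall r s t, 0 <= r <= R1 -> Rabs (s - t) <= d ->
   Rabs (rpow (Cmod (f (circ r s))) q - rpow (Cmod (f (circ r t))) q) <= e.
Proof.
  intros Hq Hf HR He.
  destruct (analytic_bounded f R1 Hf HR) as [M [HM0 HM]].
  destruct (analytic_bounded _ R1 (analytic_derive f Hf) HR) as [B [HB0 HB]].
  destruct (@Heine_cor2 (fun x => rpow x q) 0 M) with (eps := mkposreal e He) as [d Hd].
  { intros x Hx. apply continuity_pt_filterlim. now apply rpow_continuous. }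
  simpl in Hd. assert (Hd0 := cond_pos d).
  (* B + 1 avoids division by zero, and the extra half gives the strict inequality required by
     Heine's theorem. *)
  exists (d / (B + 1) / 2). split. { apply Rdiv_lt_0_compat; [|lra]. apply Rdiv_lt_0_compat; lra. }
  intros r s t Hr Hst. left.
  assert (Hin : forall u, inD (circ r u)) by (intro; unfold inD; rewrite Cmod_circ; lra).
  assert (Hle : forall u, 0 <= Cmod (f (circ r u)) <= M).
  { intro u. split. apply Cmod_ge_0. apply HM. rewrite Cmod_circ; lra. }
  apply Hd; auto.
  assert (HL : Cmod (f (circ r s) - f (circ r t)) <= B * Cmod (circ r s - circ r t)).
  { apply mean_value_inequality; auto. intros x Hx. apply HB.
    replace (circ r t + x * (circ r s - circ r t))%C with (RtoC (1 - x) * circ r t + RtoC x * circ r s)%C by (rewrite RtoC_minus; ring).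
    eapply Rle_trans. apply Cmod_triangle. rewrite !Cmod_mult, !Cmod_RtoC_pos, !Cmod_circ by lra. nra. }
  assert (HC := circ_lipschitz r s t ltac:(lra)).
  assert (HL2 : Cmod (f (circ r s) - f (circ r t)) <= (B + 1) * Rabs (s - t)).
  { assert (K := Rabs_pos (s - t)). eapply Rle_trans. apply HL. apply Rmult_le_compat; auto. apply Cmod_ge_0. lra. nra. }
  assert (HL3 : (B + 1) * Rabs (s - t) <= d / 2).
  { apply Rle_trans with ((B + 1) * (d / (B + 1) / 2)). apply Rmult_le_compat_l; lra. right. field. lra. }
  assert (A := Cmod_triangle_minus (f (circ r s)) (f (circ r t))).
  assert (A' := Cmod_triangle_minus (f (circ r t)) (f (circ r s))). rewrite Cmod_minus_sym in A'.
  apply Rabs_lt_between. lra.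
Qed.

Lemma mesh_small d : 0 < d -> exists n0, (0 < n0)%nat /\ forall n, (n0 <= n)%nat -> 2 * PI / INR n <= d.
Proof.
  intro Hd. assert (HPI := PI_pos2). destruct (nat_above (2 * PI / d)) as [n0 [H1 H2]].
  exists n0. split; auto. intros n Hn.
  assert (H3 : INR n0 <= INR n) by now apply le_INR. assert (0 < INR n0) by now apply lt_0_INR.
  apply Rlt_div_l in H1; auto. apply Rle_div_l; nra.
Qed.

Lemma rotate_split th c w : (circ 1 th * (c + w))%C = (circ 1 th * c + circ 1 th * w)%C.
Proof. ring. Qed.

(* The sup of [|f|^q] over a radial segment of hyperbolic length O(1), averaged over [n] equidistributed rays;
   discretising the angle makes the interchange with the circle means of [subharmonic_absorb] a finite sum. *)
Lemma radial_maximal q : 0 < q -> exists K, 0 < K /\ forall f r Q, analytic_on_D f -> 1 / 2 <= r < 1 ->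
  (forall s, 0 <= s <= 1 - 3 / 4 * (1 - r) -> Amean q s f <= Q) ->
  exists n0, (0 < n0)%nat /\ forall n, (n0 <= n)%nat -> exists X : nat -> R,
    (forall j s, 2 * r - 1 <= s <= r -> rpow (Cmod (f (circ s (INR j * (2 * PI / INR n))))) q <= X j) /\
    fsum X n / INR n <= K * (Q + 1) + 1.
Proof.
  intros Hq. destruct (subharmonic_absorb q Hq (1 / 4) ltac:(lra)) as [K [HK Hcore]].
  exists (12 * K). split. lra. intros f r Q Hf Hr HQ.
  set (d := 1 - r). assert (Hd : 0 < d <= 1 / 2) by (unfold d; lra).
  (* The segment [2r - 1, r] = [1 - 2d, 1 - d] has centre [c] and half-length d/2. The disc of
     radius R0 = 3d/4 about [c] contains it with room d/4 to spare and stays within |z| <= R1. *)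
  set (R1 := 1 - 3 / 4 * d). set (R0 := 3 / 4 * d). set (c := RtoC (1 - 3 / 2 * d)).
  assert (HR1 : 0 < R1 < 1) by (unfold R1; lra). assert (HR0 : 0 < R0) by (unfold R0; lra).
  destruct (mean_modulus f q R1 1 Hq Hf ltac:(lra) Rlt_0_1) as [dl [Hdl Hmod]].
  destruct (mesh_small dl Hdl) as [n0 [Hn0 Hmesh]].
  destruct (analytic_bounded f R1 Hf ltac:(lra)) as [B0 [HB0 HB]].
  assert (HQ0 : 0 <= Q). { eapply Rle_trans; [|apply (HQ 0); lra]. apply Amean_nonneg; auto. apply ccont_analytic; auto; lra. }
  exists n0. split; auto. intros n Hn. specialize (Hmesh n Hn).
  assert (HnR : 0 < INR n) by (apply lt_0_INR; lia).
  set (th := fun j => INR j * (2 * PI / INR n)).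
  (* Rotating a fixed w through the n angles samples the circle of radius |w|; the additional 1 is
     the mesh error. *)
  assert (Hmean : forall w, Cmod w <= R1 -> fsum (fun j => rpow (Cmod (f (circ 1 (th j) * w)%C)) q) n / INR n <= Q + 1).
  { intros w Hw. destruct (polar w) as [psi Hpsi]. assert (Hw0 := Cmod_ge_0 w). set (rho := Cmod w) in *.
    rewrite (fsum_ext _ (fun j => rpow (Cmod (f (circ rho (psi + INR j * (2 * PI / INR n))))) q)).
    2:{ intro j. rewrite Hpsi, circ_mult, Rmult_1_l. unfold th. now rewrite Rplus_comm. }
    assert (HD := discrete_mean (fun t => rpow (Cmod (f (circ rho t))) q) psi n 1).
    assert (Hcc : ccont rho f) by (apply ccont_analytic; auto; lra).
    specialize (HD (rcont_rpow rho f q Hq Hcc)). cbv beta in HD.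
    assert (HD' := HD ltac:(intro; now rewrite circ_period) ltac:(lia)).
    apply Rabs_le_between in HD'.
    2:{ intros s t Hst. apply Hmod; lra. }
    assert (HQr := HQ rho ltac:(unfold R1, d in *; lra)). unfold Amean in HQr. lra. }
  set (Phi := fun (j : nat) w => f (circ 1 (th j) * c + circ 1 (th j) * w)%C).
  assert (Hcw : forall w, Cmod w <= R0 -> Cmod (c + w) <= R1).
  { intros w Hw. eapply Rle_trans. apply Cmod_triangle. unfold c. rewrite Cmod_RtoC_pos by lra. unfold R1, R0 in *; lra. }
  assert (Hmod1 : forall j w, Cmod w <= R0 -> Cmod (circ 1 (th j) * c + circ 1 (th j) * w) <= R1).
  { intros j w Hw. rewrite <- rotate_split, Cmod_mult, Cmod_circ, Rmult_1_l by lra. auto. }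
  assert (HPhi : forall j w, Cmod w <= R0 -> exists l, Cdiff (Phi j) w l).
  { intros j w Hw. eexists. apply Cdiff_comp_affine. apply analytic_Cdiff; auto. unfold inD. specialize (Hmod1 j w Hw). lra. }
  set (M := rpow B0 q). assert (HM0 : 0 <= M) by apply rpow_nonneg.
  set (B := 2 * R0 * K * (Q + 1)).
  assert (HBp : 0 <= B) by (unfold B; repeat apply Rmult_le_pos; lra).
  (* One majorant [X j] per ray, all improved simultaneously. Here the growth exponent is 1, so
     halving the distance doubles the bound 2B/(R0 - rho); the absorption factor 1/4 reduces the
     result to half of the original, and the new mean term fills the other half. *)
  assert (Hind : forall m rho, 0 <= rho < R0 -> exists X : nat -> R,
     (forall j w, Cmod w <= rho -> rpow (Cmod (Phi j w)) q <= X j) /\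
     fsum X n / INR n <= 2 * B / (R0 - rho) + (1 / 4) ^ m * M).
  { induction m as [|m IH]; intros rho Hrho.
    - exists (fun _ => M). split.
      + intros j w Hw. apply rpow_le. lra. apply HB. apply Hmod1. lra.
      + rewrite fsum_const. simpl. replace (INR n * M / INR n) with M by (field; lra).
        assert (0 <= 2 * B / (R0 - rho)). { apply Rmult_le_pos. lra. left; apply Rinv_0_lt_compat; lra. } lra.
    - set (rho' := (rho + R0) / 2). assert (Hrho' : rho < rho' < R0) by (unfold rho'; lra).
      destruct (IH rho' ltac:(lra)) as [X' [HX' HS']].
      assert (HPhi' : forall j w, Cmod w <= rho' -> exists l, Cdiff (Phi j) w l) by (intros; apply HPhi; lra).
      assert (Hcc : forall j, ccont rho' (Phi j)) by (intro j; apply ccont_disc; auto; lra).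
      set (k := K * (rho' / (rho' - rho))).
      exists (fun j => 1 / 4 * X' j + k * Amean q rho' (Phi j)). split.
      + intros j w Hw. unfold k. rewrite Rmult_assoc. apply Hcore; auto. lra. 2: lra.
        intro t. apply HX'. rewrite Cmod_circ; lra.
      + rewrite fsum_lin. 
        assert (HA : fsum (fun j => Amean q rho' (Phi j)) n / INR n <= Q + 1).
        { unfold Amean. rewrite <- avg_fsum by (intro; now apply rcont_rpow).
          apply Rle_div_l; auto. rewrite <- (avg_const ((Q + 1) * INR n)). apply avg_le.
          - apply rcont_fsum. intro; now apply rcont_rpow.
          - apply rcont_const.
          - intro t. apply Rle_div_l; auto.
            assert (HH := Hmean (c + circ rho' t)%C ltac:(apply Hcw; rewrite Cmod_circ; lra)).
            rewrite (fsum_ext _ (fun j => rpow (Cmod (f (circ 1 (th j) * (c + circ rho' t))%C)) q)); auto.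
            intro j. unfold Phi. now rewrite rotate_split. }
        set (x := R0 - rho) in *. assert (Hx : 0 < x) by (unfold x; lra).
        assert (Ex : R0 - rho' = x / 2) by (unfold rho', x; field).
        assert (Ex' : rho' - rho = x / 2) by (unfold rho', x; field).
        rewrite Ex in HS'.
        assert (Hk : k <= K * (2 * R0 / x)).
        { unfold k. apply Rmult_le_compat_l. lra. rewrite Ex'.
          replace (rho' / (x / 2)) with (2 * rho' / x) by (field; lra).
          apply Rmult_le_compat_r. left; now apply Rinv_0_lt_compat. lra. }
        assert (Hk0 : 0 <= k).
        { unfold k. apply Rmult_le_pos. lra. apply Rmult_le_pos. lra. left; apply Rinv_0_lt_compat; lra. }
        set (SA := fsum (fun j => Amean q rho' (Phi j)) n) in *.
        replace ((1 / 4 * fsum X' n + k * SA) / INR n) with (1 / 4 * (fsum X' n / INR n) + k * (SA / INR n)) by (field; lra).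
        assert (HkA : k * (SA / INR n) <= K * (2 * R0 / x) * (Q + 1)).
        { apply Rle_trans with (k * (Q + 1)). apply Rmult_le_compat_l; auto. apply Rmult_le_compat_r; auto. lra. }
        replace (K * (2 * R0 / x) * (Q + 1)) with (B / x) in HkA by (unfold B; field; lra).
        replace (2 * B / (x / 2)) with (4 * (B / x)) in HS' by (field; lra).
        replace (2 * B / x) with (2 * (B / x)) by (field; lra). simpl. lra. }
  destruct (pow_small (1 / 4) M 1 ltac:(lra) HM0 Rlt_0_1) as [m Hm].
  (* At rho = d/2 the remaining room R0 - d/2 = d/4 is a third of R0, which yields the constant 12
     K. *)
  destruct (Hind m (d / 2) ltac:(unfold R0; lra)) as [X [HX HS]].
  exists X. split.
  - intros j s Hs.
    replace (circ s (INR j * (2 * PI / INR n))) with (circ 1 (th j) * c + circ 1 (th j) * RtoC (s - (1 - 3 / 2 * d)))%C.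
    + apply HX. rewrite Cmod_R. apply Rabs_le. unfold d in *; lra.
    + unfold c. rewrite <- rotate_split, <- RtoC_plus.
      replace (1 - 3 / 2 * d + (s - (1 - 3 / 2 * d))) with s by ring.
      rewrite Cmult_comm, <- circ_scal, Rmult_1_r. reflexivity.
  - eapply Rle_trans. apply HS.
    replace (2 * B / (R0 - d / 2)) with (12 * K * (Q + 1)) by (unfold B, R0; field; lra). lra.
Qed.

(** The factor of the first term can be brought as close to 1 as desired, at the expense of the
    second. The factor 2^q of [rpow_sum_le] could exceed the gain 2^(alpha q) of the recursion. *)
Lemma rpow_sum_le_eps eps a b q : 0 < eps -> 0 < q -> 0 <= a -> 0 <= b ->
  rpow (a + b) q <= rpow (1 + eps) q * rpow a q + rpow (1 + / eps) q * rpow b q.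
Proof.
  intros He Hq Ha Hb. assert (Hi : 0 < / eps) by now apply Rinv_0_lt_compat.
  assert (P1 : 0 <= rpow (1 + eps) q * rpow a q) by (apply Rmult_le_pos; apply rpow_nonneg).
  assert (P2 : 0 <= rpow (1 + / eps) q * rpow b q) by (apply Rmult_le_pos; apply rpow_nonneg).
  destruct (Rle_lt_dec b (eps * a)) as [L|L].
  - assert (rpow (a + b) q <= rpow (1 + eps) q * rpow a q); [|lra].
    rewrite <- rpow_mult_distr by lra. apply rpow_le; lra.
  - assert (rpow (a + b) q <= rpow (1 + / eps) q * rpow b q); [|lra].
    rewrite <- rpow_mult_distr by lra. apply rpow_le. lra.
    assert (a <= / eps * b). { rewrite Rmult_comm. apply Rle_div_r; lra. } lra.
Qed.

Lemma Rpower_neg_ge_1 x k : 0 < x <= 1 -> 0 <= k -> 1 <= Rpower x (- k).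
Proof.
  intros Hx Hk. assert (E : Rpower 1 (- k) = 1) by (unfold Rpower; rewrite ln_1, Rmult_0_r; apply exp_0).
  rewrite <- E at 1. now apply Rpower_le_contra.
Qed.

(** Passing from r to 2r - 1 doubles the distance to the circle and divides the target growth by
    2^beta, so lam < 2^beta makes the recursion contract. It takes the place of integrating the
    derivative along the whole radius. *)
Lemma doubling_growth (U : R -> R) U0 lam B beta : 0 < beta -> 0 <= lam < Rpower 2 beta -> 0 <= B -> 0 <= U0 ->
  (forall r, 0 <= r <= 1 / 2 -> U r <= U0) ->
  (forall r, 1 / 2 <= r < 1 -> U r <= lam * U (2 * r - 1) + B * Rpower (1 - r) (- beta)) ->
  exists B', 0 <= B' /\ forall r, 0 <= r < 1 -> U r <= B' * Rpower (1 - r) (- beta).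
Proof.
  intros Hb Hlam HB HU0 Hbase Hstep.
  assert (HP := Rpower_pos 2 beta).
  set (k := lam / Rpower 2 beta).
  assert (Hk : 0 <= k < 1).
  { unfold k. split. apply Rmult_le_pos. lra. left; now apply Rinv_0_lt_compat. apply Rlt_div_l; lra. }
  (* Large enough for the base range and stable under one step: k B' + B <= B'. *)
  set (B' := U0 + B / (1 - k)).
  assert (HBk : 0 <= B / (1 - k)). { apply Rmult_le_pos. lra. left; apply Rinv_0_lt_compat; lra. }
  exists B'. split. unfold B'; lra.
  assert (Hone : forall r, 0 <= r < 1 -> 1 <= Rpower (1 - r) (- beta)).
  { intros r Hr. apply Rpower_neg_ge_1; lra. }
  assert (Hlow : forall r, 0 <= r <= 1 / 2 -> U r <= B' * Rpower (1 - r) (- beta)).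
  { intros r Hr. specialize (Hbase r Hr). specialize (Hone r ltac:(lra)). unfold B'. nra. }
  (* The range r <= 1 - 2^(-J-1) is mapped by r -> 2r - 1 into r <= 1 - 2^(-J). *)
  assert (Hind : forall J r, 0 <= r <= 1 - (1 / 2) ^ J -> U r <= B' * Rpower (1 - r) (- beta)).
  { induction J as [|J IH]; intros r Hr.
    - simpl in Hr. apply Hlow. lra.
    - destruct (Rle_lt_dec r (1 / 2)) as [L|L]. apply Hlow; lra.
      assert (HJ : 0 < (1 / 2) ^ J) by (apply pow_lt; lra). simpl in Hr.
      specialize (Hstep r ltac:(lra)). specialize (IH (2 * r - 1) ltac:(lra)).
      replace (1 - (2 * r - 1)) with (2 * (1 - r)) in IH by ring.
      rewrite <- Rpower_mult_distr in IH by lra. rewrite (Rpower_Ropp 2) in IH.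
      assert (P := Rpower_pos (1 - r) (- beta)). set (y := Rpower (1 - r) (- beta)) in *.
      assert (H1 : lam * U (2 * r - 1) <= k * B' * y).
      { unfold k. apply Rle_trans with (lam * (B' * (/ Rpower 2 beta * y))). apply Rmult_le_compat_l; lra. right. field. lra. }
      assert (H2 : k * B' + B <= B').
      { unfold B'. assert (E : B = (1 - k) * (B / (1 - k))) by (field; lra). set (z := B / (1 - k)) in *. nra. }
      assert (H3 : (k * B' + B) * y <= B' * y) by (apply Rmult_le_compat_r; lra). lra. }
  intros r Hr. destruct (pow_small (1 / 2) 1 (1 - r) ltac:(lra) ltac:(lra) ltac:(lra)) as [J HJ].
  apply (Hind J). lra.
Qed.

Lemma Bloch_deriv g : Bloch g -> exists K, 0 < K /\ forall z, inD z -> Cmod (C_derive g z) <= K / (1 - Cmod z).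
Proof.
  intros [Hg [K HK]]. exists (Rabs K + 1). assert (H0 := Rabs_pos K). split. lra.
  intros z Hz. specialize (HK z Hz). unfold inD in Hz. assert (Hz0 := Cmod_ge_0 z).
  apply Rle_div_r. lra. assert (K0 := Cmod_ge_0 (C_derive g z)). assert (K <= Rabs K) by apply Rle_abs. nra.
Qed.

(** The segment has length 1 - r, which cancels the Bloch bound Kg/(1 - r) on g' along it. *)
Lemma Tg_radial_step g f Kg r x t : Bloch g -> (forall z, inD z -> Cmod (C_derive g z) <= Kg / (1 - Cmod z)) -> 0 < Kg ->
  analytic_on_D f -> 1 / 2 <= r < 1 -> 0 <= x ->
  (forall s, 2 * r - 1 <= s <= r -> Cmod (f (circ s t)) <= x) ->
  Cmod (Tg g f (circ r t)) <= Cmod (Tg g f (circ (2 * r - 1) t)) + Kg * x.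
Proof.
  intros [Hg _] HKg HK0 Hf Hr Hx0 Hx.
  assert (Hin : forall s, 0 <= s < 1 -> inD (circ s t)) by (intros; unfold inD; rewrite Cmod_circ; lra).
  assert (H : Cmod (Tg g f (circ r t) - Tg g f (circ (2 * r - 1) t)) <= x * (Kg / (1 - r)) * Cmod (circ r t - circ (2 * r - 1) t)).
  { apply mean_value_inequality. now apply Tg_analytic. apply Hin; lra. apply Hin; lra.
    intros u Hu. set (s := 2 * r - 1 + u * (1 - r)).
    replace (circ (2 * r - 1) t + u * (circ r t - circ (2 * r - 1) t))%C with (circ s t).
    2:{ unfold s, circ, Cplus, Cminus, Copp, Cmult, RtoC; simpl. f_equal; ring. }
    assert (Hs : 2 * r - 1 <= s <= r) by (unfold s; nra).
    rewrite Tg_derive, Cmod_mult by (auto; apply Hin; lra).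
    apply Rmult_le_compat; auto using Cmod_ge_0.
    eapply Rle_trans. apply HKg. apply Hin; lra. rewrite Cmod_circ by lra.
    apply Rmult_le_compat_l. lra. apply Rinv_le_contravar; lra. }
  replace (circ r t - circ (2 * r - 1) t)%C with (circ (1 - r) t) in H.
  2:{ unfold circ, Cplus, Cminus, Copp, Cplus; simpl. f_equal; ring. }
  rewrite Cmod_circ in H by lra. replace (x * (Kg / (1 - r)) * (1 - r)) with (Kg * x) in H by (field; lra).
  assert (K := Cmod_triangle_minus (Tg g f (circ r t)) (Tg g f (circ (2 * r - 1) t))). lra.
Qed.

(** The radial step is raised to the power q and summed over finitely many equidistributed rays;
    [radial_maximal] controls the sum of the radial suprema, and [doubling_growth] closes the
    recursion for the means. *)
Lemma Tg_mean_growth q alpha g f N : 0 < q -> 0 < alpha -> Bloch g -> analytic_on_D f -> 0 <= N ->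
  (forall r, 0 <= r < 1 -> Amean q r f <= N * Rpower (1 - r) (- (alpha * q))) ->
  exists B, 0 <= B /\ forall r, 0 <= r < 1 -> Amean q r (Tg g f) <= B * Rpower (1 - r) (- (alpha * q)).
Proof.
  intros Hq Ha Hg Hf HN HA.
  assert (Haq : 0 < alpha * q) by (apply Rmult_lt_0_compat; auto).
  destruct (Bloch_deriv g Hg) as [Kg [HKg0 HKg]].
  destruct (radial_maximal q Hq) as [K [HK Hmax]].
  set (h := Tg g f). assert (Hh : analytic_on_D h) by (apply Tg_analytic; auto; apply Hg).
  (* Choosing 1 + eps = 2^(alpha/2) gives lam = 2^(alpha q/2), strictly below the admissible
     2^(alpha q). *)
  set (P2 := Rpower 2 (alpha / 2)).
  assert (HP2 : 1 < P2). { unfold P2. rewrite <- (Rpower_O 2) by lra. apply Rpower_lt; lra. }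
  set (eps := P2 - 1). assert (Heps : 0 < eps) by (unfold eps; lra).
  set (lam := rpow (1 + eps) q).
  assert (Elam : lam = Rpower 2 (alpha / 2 * q)).
  { unfold lam, eps. replace (1 + (P2 - 1)) with P2 by ring. rewrite rpow_pos by lra. unfold P2. apply Rpower_mult. }
  set (cb := rpow (1 + / eps) q). assert (Hcb : 0 <= cb) by apply rpow_nonneg.
  set (kg := rpow Kg q). assert (Hkg : 0 <= kg) by apply rpow_nonneg.
  destruct (analytic_bounded h (1 / 2) Hh ltac:(lra)) as [M [HM0 HM]].
  assert (PP := Rpower_pos 2 (alpha * q)).
  set (B := cb * (kg * (K * (N * Rpower 2 (alpha * q) + 1) + 1))).
  assert (HB : 0 <= B).
  { unfold B. apply Rmult_le_pos; auto. apply Rmult_le_pos; auto. assert (0 <= N * Rpower 2 (alpha * q)) by nra. nra. }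
  apply (doubling_growth (fun r => Amean q r h) (rpow M q) lam B (alpha * q)); auto.
  - split. apply rpow_nonneg. rewrite Elam. apply Rpower_lt. lra. nra.
  - apply rpow_nonneg.
  - intros r Hr. rewrite <- (avg_const (rpow M q)). apply avg_le. apply rcont_rpow; auto. apply ccont_analytic; auto; lra.
    apply rcont_const. intro t. apply rpow_le. lra. apply HM. rewrite Cmod_circ; lra.
  - intros r Hr.
    set (d := 1 - r). assert (Hd : 0 < d <= 1 / 2) by (unfold d; lra).
    set (y := Rpower d (- (alpha * q))). 
    assert (Hy1 : 1 <= y).
    { apply Rpower_neg_ge_1; lra. }
    set (Q := N * Rpower 2 (alpha * q) * y).
    destruct (Hmax f r Q Hf Hr) as [n0 [Hn0 HX]].
    { intros s Hs. eapply Rle_trans. apply HA. fold d in Hs. lra. unfold Q. rewrite Rmult_assoc. apply Rmult_le_compat_l; auto.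
      unfold y. rewrite <- Rpower_half by lra. apply Rpower_le_contra; fold d in Hs; lra. }
    apply le_epsilon. intros e He.
    (* Discretising costs e' at radius r and lam e' at radius 2r - 1, in total e. The number of rays
       depends on e, but the constant [B] does not. *)
    set (e' := e / (1 + lam)). assert (Hlam0 : 0 <= lam) by apply rpow_nonneg.
    assert (He' : 0 < e') by (apply Rdiv_lt_0_compat; lra).
    destruct (mean_modulus h q r e' Hq Hh ltac:(lra) He') as [dl [Hdl Hmod]].
    destruct (mesh_small dl Hdl) as [n1 [Hn1 Hmesh]].
    set (n := Nat.max n0 n1). specialize (Hmesh n (Nat.le_max_r _ _)).
    destruct (HX n (Nat.le_max_l _ _)) as [X [HX1 HX2]].
    assert (Hn : (0 < n)%nat) by (unfold n; lia). assert (HnR : 0 < INR n) by now apply lt_0_INR.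
    set (dm := fun rr => fsum (fun j => rpow (Cmod (h (circ rr (INR j * (2 * PI / INR n))))) q) n / INR n).
    assert (Hdm : forall rr, 0 <= rr <= r -> Rabs (Amean q rr h - dm rr) <= e').
    { intros rr Hrr. assert (HD := discrete_mean (fun t => rpow (Cmod (h (circ rr t))) q) 0 n e').
      unfold Amean, dm. rewrite (fsum_ext _ (fun j => rpow (Cmod (h (circ rr (0 + INR j * (2 * PI / INR n))))) q)).
      2: intro; now rewrite Rplus_0_l.
      apply HD; auto. apply rcont_rpow; auto. apply ccont_analytic; auto; lra.
      intro; now rewrite circ_period. intros s t Hst. apply Hmod; lra. }
    assert (H1 := Hdm r ltac:(lra)). assert (H2 := Hdm (2 * r - 1) ltac:(lra)).
    apply Rabs_le_between in H1. apply Rabs_le_between in H2.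
    assert (H3 : dm r <= lam * dm (2 * r - 1) + cb * kg * (fsum X n / INR n)).
    { unfold dm. set (F1 := fun j => rpow (Cmod (h (circ (2 * r - 1) (INR j * (2 * PI / INR n))))) q).
      replace (lam * (fsum F1 n / INR n) + cb * kg * (fsum X n / INR n)) with ((lam * fsum F1 n + cb * kg * fsum X n) / INR n) by (field; lra).
      rewrite <- fsum_lin. apply Rmult_le_compat_r. left; now apply Rinv_0_lt_compat.
      apply fsum_le. intro j.
      assert (HX0 : 0 <= X j). { eapply Rle_trans; [|apply (HX1 j r); lra]. apply rpow_nonneg. }
      assert (HS := Tg_radial_step g f Kg r (rpow (X j) (/ q)) (INR j * (2 * PI / INR n)) Hg HKg HKg0 Hf Hr (rpow_nonneg _ _)).
      assert (HS' := HS ltac:(intros s Hs; apply rpow_le_inv; auto using Cmod_ge_0)). fold h in HS'.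
      eapply Rle_trans. apply (rpow_le _ _ q (Rlt_le _ _ Hq) HS').
      eapply Rle_trans. apply (rpow_sum_le_eps eps); auto using Cmod_ge_0.
      { apply Rmult_le_pos. lra. apply rpow_nonneg. }
      rewrite (rpow_mult_distr Kg), rpow_cancel_inv; [|auto|auto|lra|apply rpow_nonneg].
      unfold F1. fold lam cb kg. lra. }
    assert (H4 : cb * kg * (fsum X n / INR n) <= B * y).
    { unfold B. rewrite Rmult_assoc, (Rmult_assoc cb). apply Rmult_le_compat_l; auto. rewrite Rmult_assoc. apply Rmult_le_compat_l; auto.
      eapply Rle_trans. apply HX2. unfold Q. 
      assert (0 <= N * Rpower 2 (alpha * q)) by nra. set (z := N * Rpower 2 (alpha * q)) in *.
      replace ((K * (z + 1) + 1) * y) with (K * (z * y + y) + y) by ring.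
      assert (K * (z * y + 1) <= K * (z * y + y)) by (apply Rmult_le_compat_l; lra). lra. }
    assert (E : e = e' + lam * e') by (unfold e'; field; lra). rewrite E.
    fold d y. assert (lam * dm (2 * r - 1) <= lam * (Amean q (2 * r - 1) h + e')) by (apply Rmult_le_compat_l; lra).
    lra.
Qed.

(** Membership alone is asserted: it makes the norm of [Tg g f] a true supremum, so that
    [Hnorm_deriv_bound] can be applied to [Tg g f] itself. *)
Lemma Tg_bounded p alpha g f : Rbar_lt (Finite 0) p -> 0 < alpha -> Bloch g -> Hinf p alpha f -> Hinf p alpha (Tg g f).
Proof.
  intros Hp Ha Hg Hf. assert (Hfa := proj1 Hf).
  assert (Hh : analytic_on_D (Tg g f)) by (apply Tg_analytic; auto; apply Hg).
  split; auto.
  destruct (Hnorm_spec p alpha f Hf) as [HN1 _]. assert (HN0 := Hnorm_nonneg p Hp alpha f Hf).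
  set (N := Hnorm p alpha f) in *.
  destruct p as [q| |]; [| |now simpl in Hp].
  - simpl in Hp. destruct (Tg_mean_growth q alpha g f (rpow N q) Hp Ha Hg Hfa (rpow_nonneg _ _)) as [B [HB HBr]].
    { apply Amean_of_norm; auto. }
    exists (rpow B (/ q)). intros r Hr. specialize (HBr r Hr). unfold wMp. rewrite Mp_finite.
    assert (P := Rpower_pos (1 - r) alpha).
    rewrite <- (rpow_inv_cancel (Rpower (1 - r) alpha) q) by lra.
    rewrite <- rpow_mult_distr; [|apply rpow_nonneg|apply Amean_nonneg; auto; now apply ccont_analytic].
    apply rpow_le. left; now apply Rinv_0_lt_compat.
    rewrite rpow_pos by auto. rewrite Rpower_mult.
    assert (P' := Rpower_pos (1 - r) (alpha * q)).
    apply Rle_trans with (Rpower (1 - r) (alpha * q) * (B * Rpower (1 - r) (- (alpha * q)))).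
    apply Rmult_le_compat_l; lra. rewrite Rpower_Ropp. right. field. lra.
  - destruct (Bloch_deriv g Hg) as [Kg [HKg0 HKg]].
    destruct (analytic_bounded _ (1 / 2) Hh ltac:(lra)) as [M [HM0 HM]].
    (* The maximum modulus is subadditive with constant 1, so lam = 1 < 2^alpha and no rays are
       needed. *)
    destruct (doubling_growth (fun r => Mp p_infty r (Tg g f)) M 1 (Kg * N) alpha) as [B [HB HBr]]; auto.
    + split. lra. rewrite <- (Rpower_O 2) by lra. apply Rpower_lt; lra.
    + apply Rmult_le_pos; lra.
    + intros r Hr. apply (Mp_bound p_infty); auto. apply ccont_analytic; auto; lra. intro t. apply HM. rewrite Cmod_circ; lra.
    + intros r Hr. destruct (Mp_inf_spec r (Tg g f)) as [_ H1]. apply ccont_analytic; auto; lra.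
      apply H1. intro t.
      destruct (Mp_inf_spec (2 * r - 1) (Tg g f)) as [H2 _]. apply ccont_analytic; auto; lra. specialize (H2 t).
      assert (HS := Tg_radial_step g f Kg r (N * Rpower (1 - r) (- alpha)) t Hg HKg HKg0 Hfa Hr).
      assert (P := Rpower_pos (1 - r) (- alpha)).
      specialize (HS ltac:(apply Rmult_le_pos; lra)).
      assert (HS' : Cmod (Tg g f (circ r t)) <= Cmod (Tg g f (circ (2 * r - 1) t)) + Kg * (N * Rpower (1 - r) (- alpha))).
      { apply HS. intros s Hs. specialize (HN1 s ltac:(lra)). unfold wMp in HN1. apply Rpower_inv_mult in HN1; try lra.
        destruct (Mp_inf_spec s f) as [H3 _]. apply ccont_analytic; auto; lra. specialize (H3 t).
        assert (Rpower (1 - s) (- alpha) <= Rpower (1 - r) (- alpha)) by (apply Rpower_le_contra; lra).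
        assert (N * Rpower (1 - s) (- alpha) <= N * Rpower (1 - r) (- alpha)) by (apply Rmult_le_compat_l; lra). lra. }
      lra.
    + exists B. intros r Hr. specialize (HBr r Hr). cbv beta in HBr. unfold wMp.
      assert (P := Rpower_pos (1 - r) alpha).
      apply Rle_trans with (Rpower (1 - r) alpha * (B * Rpower (1 - r) (- alpha))).
      apply Rmult_le_compat_l; lra. rewrite Rpower_Ropp. right. field. lra.
Qed.

(** * Peaking functions and the gliding hump *)

Lemma CI_RtoC (phi : R -> R) a b : rcont phi -> CI (fun t => RtoC (phi t)) a b = RtoC (RInt phi a b).
Proof.
  intro H. apply (is_RInt_unique (V := C_R_CompleteNormedModule)).
  apply (is_RInt_fct_extend_pair (U := R_NormedModule) (V := R_NormedModule) (fun t => RtoC (phi t)) a b (RInt phi a b) 0).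
  - apply (RInt_correct (V := R_CompleteNormedModule)). now apply rcont_ex.
  - replace 0 with (scal (b - a) 0 : R_NormedModule). apply (is_RInt_const (V := R_NormedModule)).
    unfold scal; simpl; unfold mult; simpl. ring.
Qed.

Lemma one_minus_low (b w : C) : 1 - Cmod b * Cmod w <= Cmod (1 - Cconj b * w).
Proof.
  assert (K := Cmod_triangle_minus 1 (Cconj b * w)). rewrite Cmod_mult, Cmod_conj, Cmod_1 in K. lra.
Qed.

Lemma one_minus_neq0 (b w : C) : Cmod b < 1 -> Cmod w <= 1 -> (1 - Cconj b * w)%C <> 0%C.
Proof.
  intros Hb Hw. apply Cmod_gt_0. assert (K := one_minus_low b w).
  assert (K1 := Cmod_ge_0 b). assert (K2 := Cmod_ge_0 w). nra.
Qed.

Lemma Cdiff_one_minus b w : Cdiff (fun w => 1 - Cconj b * w)%C w (- Cconj b).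
Proof.
  replace (- Cconj b)%C with (0 + (0 * w + (- Cconj b) * 1))%C by ring.
  apply (Cdiff_ext (fun w => 1 + (- Cconj b) * w)%C _ w _ 1). lra. intros; ring.
  apply Cdiff_plus. apply Cdiff_const. apply (Cdiff_mult (fun _ => (- Cconj b)%C) (fun w => w)).
  apply Cdiff_const. apply Cdiff_id.
Qed.

(* The Cauchy formula for [1 / (1 - conj b w)], evaluated at [b] itself. *)
Lemma Szego_mean b : Cmod b < 1 ->
  avg (fun t => / Cmod (1 - Cconj b * circ 1 t) ^ 2) = / (1 - Cmod b ^ 2).
Proof.
  intro Hb. assert (HPI := PI_pos2). assert (Hb0 := Cmod_ge_0 b).
  assert (Hcirc : forall t, Cmod (circ 1 t) <= 1) by (intro; rewrite Cmod_circ; lra).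
  assert (Hne : forall t, (1 - Cconj b * circ 1 t)%C <> 0%C) by (intro; apply one_minus_neq0; auto).
  assert (Hd : forall w, Cmod w <= 1 -> exists l, Cdiff (fun w => / (1 - Cconj b * w))%C w l).
  { intros w Hw. eexists. apply Cdiff_inv. apply Cdiff_one_minus. now apply one_minus_neq0. }
  assert (H := Cauchy_formula _ 1 b Rlt_0_1 Hb Hd). cbv beta in H.
  rewrite (CI_ext _ (fun t => RtoC (/ Cmod (1 - Cconj b * circ 1 t) ^ 2))) in H.
  - rewrite CI_RtoC in H.
    + assert (E : (1 - Cconj b * b)%C = RtoC (1 - Cmod b ^ 2)).
      { rewrite RtoC_minus. f_equal. rewrite Cmod2_conj. ring. }
      rewrite E, <- RtoC_inv, <- RtoC_mult in H by nra. apply RtoC_inj in H.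
      unfold avg. rewrite H. field. split. nra. apply PI_neq0.
    + intro t. apply (continuous_comp (fun t => Cmod (1 - Cconj b * circ 1 t)) (fun x => / x ^ 2)).
      apply Ccont_Cmod. apply Ccont_minus. apply Ccont_const. apply Ccont_mult. apply Ccont_const. apply Ccont_circ.
      assert (Hp : 0 < Cmod (1 - Cconj b * circ 1 t)) by (apply Cmod_gt_0; auto).
      apply (ex_derive_continuous (fun x => / x ^ 2)). auto_derive. apply Rgt_not_eq. nra.
  - intros t _. set (u := (/ (1 - Cconj b * circ 1 t))%C).
    assert (E : (circ 1 t / (circ 1 t - b))%C = Cconj u).
    { unfold u. rewrite Cinv_conj by auto. rewrite Cminus_conj, Cmult_conj, Cconj_conj.
      replace (Cconj 1) with (RtoC 1) by (unfold Cconj, RtoC; simpl; f_equal; ring).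
      assert (E1 : (circ 1 t * Cconj (circ 1 t))%C = 1%C).
      { rewrite <- Cmod2_conj, Cmod_circ by lra. f_equal. ring. }
      assert (Hc : circ 1 t <> 0%C) by (apply Cmod_gt_0; rewrite Cmod_circ; lra).
      assert (Ec : Cconj (circ 1 t) = (/ circ 1 t)%C).
      { replace (/ circ 1 t)%C with (circ 1 t * Cconj (circ 1 t) / circ 1 t)%C by (rewrite E1; field; auto). field; auto. }
      rewrite Ec. assert (Hcb := circ_minus_neq0 1 b t ltac:(lra) Hb). field. split; auto. }
    rewrite E, <- Cmod2_conj. unfold u. rewrite Cmod_inv by auto. f_equal. rewrite pow_inv. reflexivity.
Qed.

Lemma small_power s tau : 0 < s -> 0 < tau -> exists d, 0 < d /\ forall x, 0 < x <= d -> Rpower x s <= tau.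
Proof.
  intros Hs Ht. exists (rpow tau (/ s)). split. now apply rpow_gt0. intros x Hx.
  rewrite <- rpow_pos by lra. rewrite <- (rpow_cancel_inv tau s) by lra. apply rpow_le; lra.
Qed.

Section TestFunctions.

Variable p : Rbar.
Hypothesis Hp : Rbar_lt (Finite 0) p.
Variable alpha : R.
Hypothesis Halpha : 0 < alpha.
Variable m : nat.
Let gam := gexp p alpha.
Hypothesis Hm : gam < INR m.
Hypothesis Hmp : match p with Finite q => 2 < INR m * q | _ => True end.

(* The numerator makes the weighted norm at most 1 while the value at [a] keeps the maximal order
   [(1 - |a|)^(- gexp)]; an integral exponent [m] avoids branches of complex powers. *)
Definition tf (a z : C) : C :=
  (RtoC (Rpower (1 - Cmod a) (INR m - gexp p alpha)) / (1 - Cconj a * z) ^ m)%C.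

Lemma tf_analytic a : inD a -> analytic_on_D (tf a).
Proof.
  intros Ha. apply Cdiff_analytic. intros z Hz. unfold inD in *.
  destruct (Cdiff_pow (fun w => 1 - Cconj a * w)%C z _ m (Cdiff_one_minus a z)) as [l Hl].
  eexists. apply (Cdiff_mult (fun _ => RtoC _) (fun w => / (1 - Cconj a * w) ^ m)%C).
  apply Cdiff_const. apply (Cdiff_inv (fun w => (1 - Cconj a * w) ^ m)%C). exact Hl.
  apply Cpow_nz. apply one_minus_neq0; auto; lra.
Qed.

Lemma tf_mod a z : inD a -> inD z ->
  Cmod (tf a z) = Rpower (1 - Cmod a) (INR m - gam) * / Cmod (1 - Cconj a * z) ^ m.
Proof.
  intros Ha Hz. unfold inD in *. unfold tf. rewrite Cmod_div, Cmod_pow, Cmod_RtoC_pos.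
  reflexivity. left; apply Rpower_pos. apply Cpow_nz. apply one_minus_neq0; auto; lra.
Qed.

(** Since m exceeds [gexp], the numerator tends to 0 as the peak moves to the circle, while the
    denominator stays bounded below on |z| <= rho. *)
Lemma tf_small a z rho : inD a -> rho < 1 -> Cmod z <= rho ->
  Cmod (tf a z) <= Rpower (1 - Cmod a) (INR m - gam) * / (1 - rho) ^ m.
Proof.
  intros Ha Hr Hz. rewrite tf_mod by (auto; unfold inD; lra). apply Rmult_le_compat_l. left; apply Rpower_pos.
  apply Rinv_le_contravar. apply pow_lt; lra. apply pow_incr. split. lra.
  assert (K := one_minus_low a z). unfold inD in Ha. assert (K1 := Cmod_ge_0 a). assert (K2 := Cmod_ge_0 z). nra.
Qed.

Lemma Rpower_split_pow x s : 0 < x -> Rpower x (INR m - s) * / x ^ m = Rpower x (- s).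
Proof.
  intros Hx. rewrite <- (Rpower_pow m x) by auto. rewrite <- Rpower_Ropp, <- Rpower_plus. f_equal. ring.
Qed.

Lemma tf_sup a z : inD a -> inD z -> Cmod (tf a z) <= Rpower (1 - Cmod a) (- gam).
Proof.
  intros Ha Hz. rewrite tf_mod by auto. unfold inD in *. rewrite <- Rpower_split_pow by lra.
  apply Rmult_le_compat_l. left; apply Rpower_pos.
  apply Rinv_le_contravar. apply pow_lt; lra. apply pow_incr. split. lra.
  assert (K := one_minus_low a z). assert (K1 := Cmod_ge_0 a). assert (K2 := Cmod_ge_0 z). nra.
Qed.

Lemma tf_peak a : inD a -> Rpower (1 - Cmod a) (- gam) / 2 ^ m <= Cmod (tf a a).
Proof.
  intros Ha. rewrite tf_mod by auto. unfold inD in *. rewrite <- Rpower_split_pow by lra.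
  assert (K1 := Cmod_ge_0 a).
  unfold Rdiv. rewrite Rmult_assoc. apply Rmult_le_compat_l. left; apply Rpower_pos.
  rewrite <- Rinv_mult, <- Rpow_mult_distr. 
  assert (Hp0 : 0 < Cmod (1 - Cconj a * a)) by (apply Cmod_gt_0; apply one_minus_neq0; lra).
  apply Rinv_le_contravar. now apply pow_lt. apply pow_incr. split. lra.
  replace (1 - Cconj a * a)%C with (RtoC (1 - Cmod a ^ 2)).
  rewrite Cmod_RtoC_pos by nra. nra. rewrite RtoC_minus. f_equal. rewrite Cmod2_conj. ring.
Qed.

(** The quantity y = 1 - r|a| dominates both 1 - |a| and 1 - r. The power of 1/y is split in two:
    one part is cancelled by the numerator through y >= 1 - |a|, the other becomes the weight
    through y >= 1 - r. *)
Lemma tf_norm a r : inD a -> 0 <= r < 1 -> Mp p r (tf a) <= Rpower (1 - r) (- alpha).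
Proof.
  intros Ha Hr. assert (Hc : ccont r (tf a)) by (apply ccont_analytic; auto; now apply tf_analytic).
  unfold inD in Ha. assert (Ha0 := Cmod_ge_0 a).
  set (e := 1 - Cmod a). assert (He : 0 < e) by (unfold e; lra).
  set (y := 1 - r * Cmod a). assert (Hy : 0 < y) by (unfold y; nra).
  assert (Hye : e <= y) by (unfold y, e; nra). assert (Hyr : 1 - r <= y) by (unfold y; nra).
  assert (HD : forall t, y <= Cmod (1 - Cconj a * circ r t)).
  { intro t. assert (K := one_minus_low a (circ r t)). rewrite Cmod_circ in K by lra. unfold y. lra. }
  assert (Hin : forall t, inD (circ r t)) by (intro; unfold inD; rewrite Cmod_circ; lra).
  assert (Hgm : forall s, 0 <= s -> Rpower y (- s) <= Rpower e (- s)) by (intros; apply Rpower_le_contra; auto).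
  assert (Hgr : forall s, 0 <= s -> Rpower y (- s) <= Rpower (1 - r) (- s)) by (intros; apply Rpower_le_contra; auto; lra).
  assert (Htm := fun t => tf_mod a (circ r t) Ha (Hin t)). fold e in Htm.
  unfold gam, gexp in *. destruct p as [q| |]; [| |now simpl in Hp].
  - simpl in Hp. set (mg := INR m - (alpha + / q)) in *. assert (Hmg : 0 < mg) by (unfold mg; lra).
    apply Mp_finite_le; auto. left; apply Rpower_pos.
    rewrite (rpow_pos (Rpower _ _)) by apply Rpower_pos. rewrite Rpower_mult.
    (* Of the m q powers of the denominator, two are kept for the Szego integral and k > 0 are
       estimated by their minimum y. *)
    set (k := INR m * q - 2). assert (Hk : 0 < k) by (unfold k; lra).
    (* Moving the dilation from the circle to the parameter puts the integral on the unit circle, as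
       [Szego_mean] requires. *)
    set (b := (RtoC r * a)%C).
    assert (Hb : Cmod b = r * Cmod a) by (unfold b; rewrite Cmod_mult, Cmod_RtoC_pos by lra; auto).
    assert (HDb : forall t, (1 - Cconj a * circ r t)%C = (1 - Cconj b * circ 1 t)%C).
    { intro t. replace (circ r t) with (RtoC r * circ 1 t)%C by (rewrite <- circ_scal; now rewrite Rmult_1_r). unfold b. rewrite Cmult_conj.
      replace (Cconj r) with (RtoC r) by (unfold Cconj, RtoC; simpl; f_equal; ring). ring. }
    assert (Hpt : forall t, rpow (Cmod (tf a (circ r t))) q <=
       Rpower e (mg * q) * Rpower y (- k) * / Cmod (1 - Cconj b * circ 1 t) ^ 2).
    { intro t. rewrite Htm, HDb. specialize (HD t). rewrite HDb in HD. set (D := Cmod (1 - Cconj b * circ 1 t)) in *.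
      assert (HD0 : 0 < D) by lra. 
      rewrite <- (Rpower_pow m D), <- Rpower_Ropp by auto.
      assert (Q1 := Rpower_pos e mg). assert (Q2 := Rpower_pos D (- INR m)).
      rewrite rpow_mult_distr, !rpow_pos, !Rpower_mult by lra.
      rewrite Rmult_assoc. apply Rmult_le_compat_l. left; apply Rpower_pos.
      replace (- INR m * q) with (- k + - INR 2) by (unfold k; simpl; ring).
      rewrite Rpower_plus, (Rpower_Ropp D (INR 2)), Rpower_pow by auto.
      apply Rmult_le_compat_r. left; apply Rinv_0_lt_compat; apply pow_lt; auto.
      apply Rpower_le_contra; lra. }
    assert (Hb1 : Cmod b < 1) by (rewrite Hb; nra).
    apply Rle_trans with (Rpower e (mg * q) * Rpower y (- k) * / (1 - Cmod b ^ 2)).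
    + rewrite <- Szego_mean by auto. unfold Amean.
      assert (Hrc : rcont (fun t => / Cmod (1 - Cconj b * circ 1 t) ^ 2)).
      { intro t. apply (continuous_comp (fun t => Cmod (1 - Cconj b * circ 1 t)) (fun x => / x ^ 2)).
        apply Ccont_Cmod. apply Ccont_minus. apply Ccont_const. apply Ccont_mult. apply Ccont_const. apply Ccont_circ.
        assert (Hp0 : 0 < Cmod (1 - Cconj b * circ 1 t)) by (rewrite <- HDb; specialize (HD t); lra).
        apply (ex_derive_continuous (fun x => / x ^ 2)). auto_derive. apply Rgt_not_eq. nra. }
      rewrite <- avg_scal by auto. apply avg_le; auto. now apply rcont_rpow. now apply rcont_scal.
    + assert (Hb2 : / (1 - Cmod b ^ 2) <= Rpower y (- (1))).
      { rewrite Rpower_Ropp, Rpower_1 by auto. apply Rinv_le_contravar; auto. rewrite Hb. unfold y. assert (Hu : 0 <= r * Cmod a < 1) by nra. set (u := r * Cmod a) in *. nra. }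
      assert (Q1 := Rpower_pos e (mg * q)). assert (Q2 := Rpower_pos y (- k)).
      apply Rle_trans with (Rpower e (mg * q) * (Rpower y (- k) * Rpower y (- (1)))).
      { rewrite <- Rmult_assoc. apply Rmult_le_compat_l; auto. apply Rmult_le_pos; lra. }
      rewrite <- Rpower_plus.
      replace (- k + - (1)) with (- (mg * q) + - (alpha * q)) by (unfold k, mg; field; lra).
      rewrite Rpower_plus. 
      assert (Q3 := Hgm (mg * q) ltac:(nra)). assert (Q4 := Hgr (alpha * q) ltac:(nra)).
      replace (- alpha * q) with (- (alpha * q)) by ring.
      assert (Q5 := Rpower_pos y (- (mg * q))). assert (Q6 := Rpower_pos y (- (alpha * q))).
      assert (Q7 : Rpower e (mg * q) * Rpower y (- (mg * q)) <= 1).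
      { apply Rle_trans with (Rpower e (mg * q) * Rpower e (- (mg * q))). apply Rmult_le_compat_l; lra. rewrite Rpower_Ropp. right; field; lra. }
      rewrite <- Rmult_assoc. nra.
  - apply (Mp_bound p_infty); auto. left; apply Rpower_pos.
    intro t. rewrite Htm. specialize (HD t). set (D := Cmod (1 - Cconj a * circ r t)) in *.
    assert (HD0 : 0 < D) by lra.
    set (mg := INR m - alpha) in *. assert (Hmg : 0 < mg) by (unfold mg; lra).
    rewrite <- (Rpower_pow m D), <- Rpower_Ropp by auto.
    assert (Q1 := Rpower_pos e mg).
    apply Rle_trans with (Rpower e mg * Rpower y (- INR m)).
    { apply Rmult_le_compat_l. lra. apply Rpower_le_contra; lra. }
    replace (- INR m) with (- mg + - alpha) by (unfold mg; ring). rewrite Rpower_plus.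
    assert (Q3 := Hgm mg ltac:(lra)). assert (Q4 := Hgr alpha ltac:(lra)).
    assert (Q7 : Rpower e mg * Rpower y (- mg) <= 1).
    { apply Rle_trans with (Rpower e mg * Rpower e (- mg)). apply Rmult_le_compat_l; lra. rewrite Rpower_Ropp. right; field; lra. }
    assert (Q6 := Rpower_pos y (- alpha)). rewrite <- Rmult_assoc. nra.
Qed.

Variable big : C -> Prop.
Hypothesis Hbig : forall rho, rho < 1 -> exists z, inD z /\ rho < Cmod z /\ big z.
Variable eta : R.
Hypothesis Heta : 0 < eta.

(** First the peak is pushed so close to the circle that the new function is tiny on |z| <= r. Then
    r' is taken so close to 1 that [S], the sum of the suprema of the earlier humps, together with
    the new supremum is negligible against (1 - x)^(-alpha). The bound 1 - 2^(-k) forces the radii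
    to tend to 1. *)
Lemma hump_step k r S : 0 <= r < 1 -> 0 <= S -> exists a r',
  inD a /\ r < Cmod a /\ big a /\ (forall z, Cmod z <= r -> Cmod (tf a z) <= eta / 2 ^ k) /\
  Cmod a < r' < 1 /\ 1 - / 2 ^ k <= r' /\
  forall x, r' <= x < 1 -> Rpower (1 - x) alpha * (S + Rpower (1 - Cmod a) (- gam)) <= eta / 2 ^ (k + 1).
Proof.
  intros Hr HS. assert (H2k := two_pow_pos k). assert (H2k1 := two_pow_pos (k + 1)).
  assert (Hrm : 0 < (1 - r) ^ m) by (apply pow_lt; lra).
  assert (Hek : 0 < eta / 2 ^ k) by (apply Rdiv_lt_0_compat; auto).
  destruct (small_power (INR m - gam) (eta / 2 ^ k * (1 - r) ^ m)) as [d [Hd Hsm]]. lra. now apply Rmult_lt_0_compat.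
  destruct (Hbig (Rmax r (1 - d))) as [a [Ha [Har Hab]]]. apply Rmax_lub_lt; lra.
  assert (Ha1 := Rle_lt_trans _ _ _ (Rmax_l _ _) Har). assert (Ha2 := Rle_lt_trans _ _ _ (Rmax_r _ _) Har).
  assert (Ha' := Ha). unfold inD in Ha'.
  assert (HP := Rpower_pos (1 - Cmod a) (- gam)). set (T := S + Rpower (1 - Cmod a) (- gam)).
  assert (HT : 0 < T) by (unfold T; lra).
  destruct (small_power alpha (eta / 2 ^ (k + 1) / T)) as [d' [Hd' Hsm']]. lra. apply Rdiv_lt_0_compat; auto. apply Rdiv_lt_0_compat; auto.
  set (x0 := Rmin ((1 - Cmod a) / 2) (Rmin (/ 2 ^ k) d')).
  assert (Hx0 : 0 < x0). { repeat apply Rmin_glb_lt; auto. lra. now apply Rinv_0_lt_compat. }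
  assert (Hx1 : x0 <= (1 - Cmod a) / 2) by apply Rmin_l.
  assert (Hx2 : x0 <= / 2 ^ k) by (eapply Rle_trans; [apply Rmin_r|apply Rmin_l]).
  assert (Hx3 : x0 <= d') by (eapply Rle_trans; [apply Rmin_r|apply Rmin_r]).
  exists a, (1 - x0). repeat split; auto; try lra.
  - intros z Hz. eapply Rle_trans. apply (tf_small a z r); auto. lra. apply Rle_div_l; auto.
    apply Hsm. lra.
  - intros x Hx. fold T. specialize (Hsm' (1 - x) ltac:(lra)).
    apply Rle_div_r in Hsm'; auto.
Qed.

Lemma hump_sequence : exists (a : nat -> C) (r S : nat -> R),
  r 0%nat = 0 /\ S 0%nat = 0 /\ forall k, inD (a k) /\ big (a k) /\ 0 <= r k /\ r k < Cmod (a k) < r (k + 1)%nat /\ r (k + 1)%nat < 1 /\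
   1 - / 2 ^ k <= r (k + 1)%nat /\ S (k + 1)%nat = S k + Rpower (1 - Cmod (a k)) (- gam) /\
   (forall z, Cmod z <= r k -> Cmod (tf (a k) z) <= eta / 2 ^ k) /\
   (forall x, r k <= x < 1 -> Rpower (1 - x) alpha * S k <= eta / 2 ^ k).
Proof.
  (* The state consists of the index, the current radius and the accumulated supremum; its validity
     is a premise, so that choice yields a total step function. *)
  assert (Hch : forall s : nat * (R * R), exists b : C * R, 0 <= fst (snd s) < 1 -> 0 <= snd (snd s) ->
    let k := fst s in let r := fst (snd s) in let S := snd (snd s) in let a := fst b in let r' := snd b in
     inD a /\ r < Cmod a /\ big a /\ (forall z, Cmod z <= r -> Cmod (tf a z) <= eta / 2 ^ k) /\
     Cmod a < r' < 1 /\ 1 - / 2 ^ k <= r' /\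
     forall x, r' <= x < 1 -> Rpower (1 - x) alpha * (S + Rpower (1 - Cmod a) (- gam)) <= eta / 2 ^ (k + 1)).
  { intros [k [r S]]. simpl. destruct (classic (0 <= r < 1 /\ 0 <= S)) as [[H1 H2]|H].
    - destruct (hump_step k r S H1 H2) as [a [r' H']]. exists (a, r'). intros _ _. exact H'.
    - exists (RtoC 0, 0). intros H1 H2. exfalso; auto. }
  apply choice in Hch. destruct Hch as [nx Hnx].
  set (st := fix st k := match k with O => (0, 0) | Datatypes.S j =>
     let b := nx (j, st j) in (snd b, snd (st j) + Rpower (1 - Cmod (fst b)) (- gam)) end).
  assert (Hst : forall k, 0 <= fst (st k) < 1 /\ 0 <= snd (st k) /\ 
      (forall x, fst (st k) <= x < 1 -> Rpower (1 - x) alpha * snd (st k) <= eta / 2 ^ k)).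
  { induction k as [|k [I1 [I2 I3]]].
    - simpl. split; [lra|]. split; [lra|]. intros x _. rewrite Rmult_0_r. unfold Rdiv. rewrite Rinv_1. lra.
    - destruct (Hnx (k, st k) I1 I2) as [A1 [A2 [A3 [A4 [A5 [A6 A7]]]]]]. simpl fst in *. simpl snd in *.
      assert (P := Rpower_pos (1 - Cmod (fst (nx (k, st k)))) (- gam)).
      assert (A1' := Cmod_ge_0 (fst (nx (k, st k)))).
      split; [lra|]. split; [lra|]. intros x Hx. replace (Datatypes.S k) with (k + 1)%nat by lia. apply A7. exact Hx. }
  exists (fun k => fst (nx (k, st k))), (fun k => fst (st k)), (fun k => snd (st k)).
  split; [reflexivity|]. split; [reflexivity|]. intro k. destruct (Hst k) as [I1 [I2 I3]].
  destruct (Hnx (k, st k) I1 I2) as [A1 [A2 [A3 [A4 [A5 [A6 A7]]]]]]. simpl fst in *. simpl snd in *.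
  replace (k + 1)%nat with (Datatypes.S k) by lia. simpl.
  repeat split; auto; try lra; try apply A5.
Qed.

End TestFunctions.

(** * The embedding of the sequence spaces *)

Lemma Series_split (v : nat -> R) N : ex_series v -> Series v = fsum v N + Series (fun k => v (N + k)%nat).
Proof.
  intro H. induction N as [|N IH].
  - simpl. rewrite Rplus_0_l. reflexivity.
  - rewrite IH. simpl fsum. rewrite Rplus_assoc. f_equal.
    rewrite Series_incr_1.
    + rewrite Nat.add_0_r. f_equal. apply Series_ext. intro k. f_equal. lia.
    + now apply ex_series_incr_n.
Qed.

Lemma geometric_tail (v : nat -> R) N B : (forall n, (N <= n)%nat -> Rabs (v n) <= B / 2 ^ n) ->
  ex_series v /\ Rabs (Series v - fsum v N) <= 2 * B / 2 ^ N.
Proof.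
  intro H. assert (H2 := two_pow_pos N).
  set (w := fun k => v (N + k)%nat). set (b := fun k => B / 2 ^ N * (1 / 2) ^ k).
  assert (Hw : forall k, Rabs (w k) <= b k).
  { intro k. unfold w, b. eapply Rle_trans. apply H. lia. right.
    replace ((1 / 2) ^ k) with (/ 2 ^ k) by (unfold Rdiv; now rewrite Rmult_1_l, pow_inv).
    rewrite pow_add. field. split; apply pow_nonzero; lra. }
  assert (Hg : is_series (fun k => (1 / 2) ^ k) (/ (1 - 1 / 2))) by (apply is_series_geom; rewrite Rabs_pos_eq; lra).
  assert (Hb : ex_series b).
  { exact (ex_series_scal_l (B / 2 ^ N) (fun k => (1 / 2) ^ k) (ex_intro _ _ Hg)). }
  assert (HwA : ex_series (fun k => Rabs (w k))).
  { apply (ex_series_le (K := R_AbsRing) (V := R_CompleteNormedModule) _ b); auto. intro k. unfold norm; simpl. unfold abs; simpl.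
    rewrite Rabs_Rabsolu. apply Hw. }
  assert (Hex : ex_series w) by now apply ex_series_Rabs.
  assert (Hv : ex_series v) by now apply (ex_series_incr_n v N).
  split; auto. rewrite (Series_split v N Hv). fold w.
  replace (fsum v N + Series w - fsum v N) with (Series w) by ring.
  eapply Rle_trans. now apply Series_Rabs.
  eapply Rle_trans. apply (Series_le _ b); auto. intro k. split. apply Rabs_pos. apply Hw.
  assert (E : Series b = B / 2 ^ N * Series (fun k => (1 / 2) ^ k)) by apply Series_scal_l.
  rewrite E, (is_series_unique _ _ Hg). right. field. lra.
Qed.

(** Componentwise real series give a total function; convergence is proved where linearity or tail
    bounds are used. *)
Definition CSeries (u : nat -> C) : C := (Series (fun n => fst (u n)), Series (fun n => snd (u n))).
Definition Cpart (u : nat -> C) (N : nat) : C := (fsum (fun n => fst (u n)) N, fsum (fun n => snd (u n)) N).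

Lemma Cpart_S u N : Cpart u (S N) = (Cpart u N + u N)%C.
Proof. unfold Cpart, Cplus; simpl. reflexivity. Qed.

Lemma fst_le_Cmod (z : C) : Rabs (fst z) <= Cmod z.
Proof. eapply Rle_trans; [|apply Rmax_Cmod]. apply Rmax_l. Qed.

Lemma snd_le_Cmod (z : C) : Rabs (snd z) <= Cmod z.
Proof. eapply Rle_trans; [|apply Rmax_Cmod]. apply Rmax_r. Qed.

(** The 4 is a factor 2 from the geometric series and 2 from the two components. *)
Lemma CSeries_tail u N B : (forall n, (N <= n)%nat -> Cmod (u n) <= B / 2 ^ n) ->
  ex_series (fun n => fst (u n)) /\ ex_series (fun n => snd (u n)) /\ Cmod (CSeries u - Cpart u N) <= 4 * B / 2 ^ N.
Proof.
  intro H.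
  destruct (geometric_tail (fun n => fst (u n)) N B) as [E1 B1].
  { intros n Hn. eapply Rle_trans. apply fst_le_Cmod. auto. }
  destruct (geometric_tail (fun n => snd (u n)) N B) as [E2 B2].
  { intros n Hn. eapply Rle_trans. apply snd_le_Cmod. auto. }
  split; auto. split; auto. unfold CSeries, Cpart, Cminus, Cplus, Copp; simpl.
  eapply Rle_trans. apply Cmod_pair_le. unfold Rminus in *.
  replace (4 * B / 2 ^ N) with (2 * B / 2 ^ N + 2 * B / 2 ^ N) by (field; apply pow_nonzero; lra). lra.
Qed.

Lemma supnorm_spec x : linf_seq x ->
  (forall n, Cmod (x n) <= supnorm x) /\ (forall B, (forall n, Cmod (x n) <= B) -> supnorm x <= B).
Proof.
  intros [K HK]. destruct (Lub_bounded (fun y => exists n : nat, y = Cmod (x n)) (Cmod (x 0%nat)) K) as [H1 H2].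
  - now exists 0%nat.
  - intros y [n ->]. auto.
  - split. intro n. apply H1. now exists n. intros B HB. apply H2. intros y [n ->]. auto.
Qed.

Lemma supnorm_nonneg x : linf_seq x -> 0 <= supnorm x.
Proof. intro H. eapply Rle_trans; [apply (Cmod_ge_0 (x 0%nat))|]. now apply supnorm_spec. Qed.

Lemma supnorm_near x : linf_seq x -> exists n, supnorm x / 2 <= Cmod (x n).
Proof.
  intro H. apply NNPP. intro HN.
  assert (H1 : supnorm x <= supnorm x / 2).
  { apply supnorm_spec; auto. intro n. destruct (Rle_lt_dec (supnorm x / 2) (Cmod (x n))); [|lra]. exfalso; apply HN; now exists n. }
  assert (H0 := supnorm_nonneg x H). apply HN. exists 0%nat. assert (K := Cmod_ge_0 (x 0%nat)). lra.
Qed.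

Lemma c0_linf x : c0_seq x -> linf_seq x.
Proof.
  intro H. apply is_lim_seq_spec in H. destruct (H (mkposreal 1 Rlt_0_1)) as [N HN]. simpl in HN.
  assert (HF : exists B, forall n, (n < N)%nat -> Cmod (x n) <= B).
  { clear. induction N as [|N [B HB]]. exists 0. lia. exists (Rmax B (Cmod (x N))). intros n Hn.
    destruct (Nat.eq_dec n N) as [->|Hne]. apply Rmax_r. eapply Rle_trans; [|apply Rmax_l]. apply HB. lia. }
  destruct HF as [B HB]. exists (Rmax B 1). intro n. destruct (Nat.lt_ge_cases n N) as [L|L].
  - eapply Rle_trans; [|apply Rmax_l]. auto.
  - eapply Rle_trans; [|apply Rmax_r]. specialize (HN n L). rewrite Rminus_0_r, Rabs_pos_eq in HN by apply Cmod_ge_0. lra.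
Qed.

Section Embedding.

Variable p : Rbar.
Hypothesis Hp : Rbar_lt (Finite 0) p.
Variable alpha : R.
Hypothesis Halpha : 0 < alpha.
Variable g : C -> C.
Hypothesis Hg : Bloch g.
Variable delta : R.
Hypothesis Hdelta : 0 < delta.
Variable m : nat.
Let gam := gexp p alpha.
Hypothesis Hm : gam < INR m.
Hypothesis Hmp : match p with Finite q => 2 < INR m * q | _ => True end.
Variables (a : nat -> C) (r S : nat -> R).
(** Small against the peak height 2^(-m) of a test function, so that the sum of the other humps
    cannot cancel a peak. *)
Let eta := / 2 ^ (m + 4).
Let tf := tf p alpha m.
Hypothesis Hr0 : r 0%nat = 0.
Hypothesis HS0 : S 0%nat = 0.
Hypothesis Ha : forall k, inD (a k).
Hypothesis Hbig : forall k, delta <= (1 - Cmod (a k) ^ 2) * Cmod (C_derive g (a k)).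
Hypothesis Hrpos : forall k, 0 <= r k.
Hypothesis Har : forall k, r k < Cmod (a k) < r (k + 1)%nat.
Hypothesis Hr1 : forall k, r (k + 1)%nat < 1.
Hypothesis Hrlim : forall k, 1 - / 2 ^ k <= r (k + 1)%nat.
Hypothesis HSS : forall k, S (k + 1)%nat = S k + Rpower (1 - Cmod (a k)) (- gam).
Hypothesis Hin : forall k z, Cmod z <= r k -> Cmod (tf (a k) z) <= eta / 2 ^ k.
Hypothesis Hout : forall k x, r k <= x < 1 -> Rpower (1 - x) alpha * S k <= eta / 2 ^ k.

Lemma eta_pos : 0 < eta.
Proof. apply Rinv_0_lt_compat. apply two_pow_pos. Qed.

Lemma r_mono n j : r n <= r (n + j)%nat.
Proof.
  induction j. rewrite Nat.add_0_r. lra. replace (n + Datatypes.S j)%nat with (n + j + 1)%nat by lia.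
  specialize (Har (n + j)%nat). lra.
Qed.

Lemma r_le n k : (n <= k)%nat -> r n <= r k.
Proof. intro H. replace k with (n + (k - n))%nat by lia. apply r_mono. Qed.

Lemma r_exceeds x : x < 1 -> exists N, x < r N.
Proof.
  intro Hx. destruct (pow_small (1 / 2) 1 (1 - x)) as [n Hn]; try lra.
  exists (n + 1)%nat. specialize (Hrlim n). unfold Rdiv in Hn. rewrite Rmult_1_l, pow_inv in Hn. lra.
Qed.

Lemma shell K x : r K <= x < 1 -> exists k, (K <= k)%nat /\ r k <= x < r (k + 1)%nat.
Proof.
  intro Hx. destruct (r_exceeds x) as [N HN]. lra.
  assert (Hind : forall j, x < r (K + j)%nat -> exists k, (K <= k)%nat /\ r k <= x < r (k + 1)%nat).
  { induction j as [|j IH]; intro Hj. rewrite Nat.add_0_r in Hj. lra.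
    destruct (Rlt_le_dec x (r (K + j)%nat)) as [L|L]; auto.
    exists (K + j)%nat. split. lia. replace (K + j + 1)%nat with (K + Datatypes.S j)%nat by lia. lra. }
  apply (Hind N). eapply Rlt_le_trans. apply HN. rewrite Nat.add_comm. apply r_mono.
Qed.

Definition terms (x : nat -> C) (z : C) (n : nat) : C := (x n * tf (a n) z)%C.

(** The value 0 outside the disc makes additivity and homogeneity equalities of functions on all of
    C, as [fixes_copy] demands. *)
Definition Jmap (x : nat -> C) (z : C) : C := if Rlt_dec (Cmod z) 1 then CSeries (terms x z) else 0%C.

Lemma Jmap_inD x z : inD z -> Jmap x z = CSeries (terms x z).
Proof. intro Hz. unfold Jmap. destruct (Rlt_dec (Cmod z) 1); [auto|contradiction]. Qed.

Lemma terms_tail x M z N n : (forall n, Cmod (x n) <= M) -> Cmod z <= r N -> (N <= n)%nat ->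
  Cmod (terms x z n) <= M * eta / 2 ^ n.
Proof.
  intros HM Hz Hn. unfold terms. rewrite Cmod_mult. unfold Rdiv. rewrite Rmult_assoc.
  apply Rmult_le_compat; auto using Cmod_ge_0. apply Hin. eapply Rle_trans. apply Hz. now apply r_le.
Qed.

Lemma terms_ex x z : linf_seq x -> inD z ->
  ex_series (fun n => fst (terms x z n)) /\ ex_series (fun n => snd (terms x z n)).
Proof.
  intros [M HM] Hz. destruct (r_exceeds (Cmod z) Hz) as [N HN].
  destruct (CSeries_tail (terms x z) N (M * eta)) as [E1 [E2 _]]; auto.
  intros n Hn. apply (terms_tail x M z N n); auto. lra.
Qed.

Lemma Jmap_add x y : linf_seq x -> linf_seq y -> Jmap (sadd x y) = fadd (Jmap x) (Jmap y).
Proof.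
  intros Hx Hy. apply functional_extensionality. intro z. unfold fadd, Jmap.
  destruct (Rlt_dec (Cmod z) 1) as [Hz|Hz]; [|ring].
  destruct (terms_ex x z Hx Hz) as [X1 X2]. destruct (terms_ex y z Hy Hz) as [Y1 Y2].
  unfold CSeries, Cplus. simpl fst. simpl snd. f_equal; rewrite <- Series_plus by auto; apply Series_ext; intro n;
    unfold terms, sadd, Cmult, Cplus; simpl; ring.
Qed.

Lemma Jmap_scal l x : linf_seq x -> Jmap (sscal l x) = fscal l (Jmap x).
Proof.
  intros Hx. apply functional_extensionality. intro z. unfold fscal, Jmap.
  destruct (Rlt_dec (Cmod z) 1) as [Hz|Hz]; [|ring].
  destruct (terms_ex x z Hx Hz) as [X1 X2].
  unfold CSeries. apply injective_projections; cbn [fst snd Cmult].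
  - rewrite <- !Series_scal_l, <- Series_minus; [|first [exact (ex_series_scal_l (fst l) _ X1)|exact (ex_series_scal_l (snd l) _ X2)|exact (ex_series_scal_l (fst l) _ X2)|exact (ex_series_scal_l (snd l) _ X1)]..].
    apply Series_ext; intro n. unfold terms, sscal, Cmult; simpl; ring.
  - rewrite <- !Series_scal_l, <- Series_plus; [|first [exact (ex_series_scal_l (fst l) _ X1)|exact (ex_series_scal_l (snd l) _ X2)|exact (ex_series_scal_l (fst l) _ X2)|exact (ex_series_scal_l (snd l) _ X1)]..].
    apply Series_ext; intro n. unfold terms, sscal, Cmult; simpl; ring.
Qed.

Lemma Cpart_analytic x N : analytic_on_D (fun z => Cpart (terms x z) N).
Proof.
  induction N as [|N IH].
  - apply (analytic_const (0, 0)).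
  - apply (analytic_ext (fun z => Cpart (terms x z) N + x N * tf (a N) z)%C).
    intros z _. now rewrite Cpart_S.
    apply analytic_plus; auto. apply analytic_mult. apply analytic_const. now apply tf_analytic.
Qed.

Lemma Jmap_analytic x : linf_seq x -> analytic_on_D (Jmap x).
Proof.
  intros [M0 HM0]. set (M := Rabs M0). assert (HM : forall n, Cmod (x n) <= M).
  { intro n. eapply Rle_trans. apply HM0. apply Rle_abs. }
  assert (HMp : 0 <= M) by apply Rabs_pos. assert (Hep := eta_pos).
  apply analytic_uniform_limit. intros rho e Hrho He.
  destruct (r_exceeds rho Hrho) as [N1 HN1].
  destruct (pow_small (1 / 2) (4 * (M * eta)) e) as [N2 HN2]; try lra. nra.
  set (N := Nat.max N1 N2).
  exists (fun z => Cpart (terms x z) N). split. apply Cpart_analytic.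
  intros z Hz. rewrite Jmap_inD by (unfold inD; lra).
  destruct (CSeries_tail (terms x z) N (M * eta)) as [_ [_ HB]].
  { intros n Hn. apply (terms_tail x M z N n); auto. assert (K := r_le N1 N (Nat.le_max_l _ _)). lra. }
  eapply Rle_trans. apply HB.
  assert (Hle : / 2 ^ N <= / 2 ^ N2). { apply Rinv_le_contravar. apply two_pow_pos. apply Rle_pow. lra. apply Nat.le_max_r. }
  unfold Rdiv in HN2. rewrite Rmult_1_l, pow_inv in HN2.
  assert (0 <= 4 * (M * eta)) by nra. unfold Rdiv. nra.
Qed.

Lemma Cpart_le_S x M z k : (forall n, Cmod (x n) <= M) -> inD z -> Cmod (Cpart (terms x z) k) <= M * S k.
Proof.
  intros HM Hz. assert (HM0 : 0 <= M) by (eapply Rle_trans; [apply (Cmod_ge_0 (x 0%nat))|auto]).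
  induction k as [|k IH].
  - unfold Cpart; simpl. change (0, 0) with (RtoC 0). rewrite Cmod_0, HS0. lra.
  - rewrite Cpart_S. eapply Rle_trans. apply Cmod_triangle. replace (Datatypes.S k) with (k + 1)%nat by lia.
    rewrite HSS, Rmult_plus_distr_l. apply Rplus_le_compat; auto.
    unfold terms. rewrite Cmod_mult. apply Rmult_le_compat; auto using Cmod_ge_0. now apply tf_sup.
Qed.

(** Later humps are small by [Hin] and sum to at most 2 eta M/2^k; earlier ones are bounded by M S
    k, which [Hout] makes at most eta M/2^k times the growth factor. Hence the 3. *)
Lemma shell_estimate x M k z : (forall n, Cmod (x n) <= M) -> inD z -> r k <= Cmod z <= r (k + 1)%nat ->
  Cmod (Jmap x z - x k * tf (a k) z) <= 3 * eta * M / 2 ^ k * Rpower (1 - Cmod z) (- alpha).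
Proof.
  intros HM Hz Hk. assert (HM0 : 0 <= M) by (eapply Rle_trans; [apply (Cmod_ge_0 (x 0%nat))|auto]).
  assert (Hep := eta_pos). assert (H2 := two_pow_pos k). assert (Hz' := Hz). unfold inD in Hz'. assert (Hz0 := Cmod_ge_0 z).
  rewrite Jmap_inD by auto.
  destruct (CSeries_tail (terms x z) (k + 1) (M * eta)) as [_ [_ HB]].
  { intros n Hn. apply (terms_tail x M z (k + 1) n); auto. lra. }
  replace (k + 1)%nat with (Datatypes.S k) in HB at 1 by lia. rewrite Cpart_S in HB.
  assert (HC := Cpart_le_S x M z k HM Hz).
  assert (HO := Hout k (Cmod z) ltac:(lra)).
  apply Rpower_inv_mult in HO; [|lra|left; apply Rdiv_lt_0_compat; auto].
  set (y := Rpower (1 - Cmod z) (- alpha)) in *.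
  assert (Hy : 1 <= y) by (apply Rpower_neg_ge_1; lra).
  replace (CSeries (terms x z) - x k * tf (a k) z)%C with
    ((CSeries (terms x z) - (Cpart (terms x z) k + terms x z k)) + Cpart (terms x z) k)%C by (unfold terms; ring).
  eapply Rle_trans. apply Cmod_triangle.
  assert (E4 : 4 * (M * eta) / 2 ^ (k + 1) = 2 * (M * (eta / 2 ^ k))).
  { rewrite pow_add. simpl. field. apply pow_nonzero; lra. }
  rewrite E4 in HB. set (h := eta / 2 ^ k) in *. assert (Hh : 0 < h) by (apply Rdiv_lt_0_compat; auto).
  replace (3 * eta * M / 2 ^ k * y) with (2 * (M * h) * y + M * (h * y)) by (unfold h; field; apply pow_nonzero; lra).
  assert (0 <= M * h) by (apply Rmult_le_pos; lra).
  assert (2 * (M * h) <= 2 * (M * h) * y) by nra.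
  assert (M * S k <= M * (h * y)) by (apply Rmult_le_compat_l; auto). lra.
Qed.

(** On each circle [Jmap x] is one hump plus an error bounded by a constant there, so the
    quasi-triangle inequality is applied once with two terms, however many humps there are. The
    decay in k of the right side is what yields the [c0_seq] case. *)
Lemma Jmap_wMp : exists K, 1 <= K /\ forall x M k s, linf_seq x -> (forall n, Cmod (x n) <= M) ->
  0 <= s < 1 -> r k <= s < r (k + 1)%nat -> wMp p alpha s (Jmap x) <= K * (Cmod (x k) + 3 * eta * M / 2 ^ k).
Proof.
  destruct (Mp_quasi p Hp) as [K [HK1 HK]]. exists K. split; auto.
  intros x M k s Hx HM Hs Hk. assert (HM0 : 0 <= M) by (eapply Rle_trans; [apply (Cmod_ge_0 (x 0%nat))|auto]).
  assert (Hep := eta_pos). assert (H2 := two_pow_pos k).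
  assert (HJ := Jmap_analytic x Hx).
  set (y := Rpower (1 - s) (- alpha)). assert (Hy := Rpower_pos (1 - s) (- alpha)). fold y in Hy.
  set (c := 3 * eta * M / 2 ^ k). assert (Hc : 0 <= c).
  { unfold c. apply Rmult_le_pos. apply Rmult_le_pos; lra. left; now apply Rinv_0_lt_compat. }
  assert (Htf : ccont s (tf (a k))) by (apply ccont_analytic; auto; now apply tf_analytic).
  assert (Hu : ccont s (fun z => x k * tf (a k) z)%C).
  { intro t. apply Ccont_mult. apply Ccont_const. apply Htf. }
  assert (Hv : ccont s (fun _ => RtoC (c * y))) by (intro t; apply Ccont_const).
  assert (H := HK s (Jmap x) (fun z => x k * tf (a k) z)%C (fun _ => RtoC (c * y)) (ccont_analytic _ s HJ Hs) Hu Hv).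
  assert (HMp : Mp p s (Jmap x) <= K * (Mp p s (fun z => x k * tf (a k) z)%C + Mp p s (fun _ => RtoC (c * y)))).
  { apply H. intro t. rewrite (Cmod_RtoC_pos (c * y)) by nra.
    assert (Hsh := shell_estimate x M k (circ s t) HM). unfold inD in Hsh. rewrite Cmod_circ in Hsh by lra.
    specialize (Hsh ltac:(lra) ltac:(lra)). fold c y in Hsh.
    assert (HT := Cmod_triangle_minus (Jmap x (circ s t)) (x k * tf (a k) (circ s t))). lra. }
  assert (H3 : Mp p s (fun z => x k * tf (a k) z)%C <= Cmod (x k) * y).
  { eapply Rle_trans. apply (Mp_mono_scal p Hp (Cmod (x k)) s _ (tf (a k))); auto using Cmod_ge_0.
    intro t. rewrite Cmod_mult. lra. apply Rmult_le_compat_l. apply Cmod_ge_0. apply (tf_norm p Hp alpha Halpha m); auto. }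
  assert (H4 : Mp p s (fun _ => RtoC (c * y)) <= c * y).
  { apply (Mp_bound p Hp); auto. nra. intro t. rewrite Cmod_RtoC_pos by nra. lra. }
  unfold wMp. assert (P := Rpower_pos (1 - s) alpha).
  apply Rle_trans with (Rpower (1 - s) alpha * (K * (Cmod (x k) * y + c * y))).
  { apply Rmult_le_compat_l. lra. eapply Rle_trans. apply HMp. apply Rmult_le_compat_l; lra. }
  unfold y. rewrite Rpower_Ropp. right. field. lra.
Qed.

Lemma Jmap_upper : exists b, 0 < b /\ forall x, linf_seq x -> Hinf p alpha (Jmap x) /\ Hnorm p alpha (Jmap x) <= b * supnorm x.
Proof.
  destruct Jmap_wMp as [K [HK1 HK]]. assert (Hep := eta_pos). exists (K * (1 + 3 * eta)). split. nra. intros x Hx.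
  destruct (supnorm_spec x Hx) as [HM _]. set (M := supnorm x) in *.
  assert (HM0 : 0 <= M) by now apply supnorm_nonneg.
  assert (HB : forall s, 0 <= s < 1 -> wMp p alpha s (Jmap x) <= K * (1 + 3 * eta) * M).
  { intros s Hs. destruct (shell 0 s) as [k [_ Hk]]. rewrite Hr0; lra.
    eapply Rle_trans. apply (HK x M k s Hx HM Hs Hk). rewrite (Rmult_assoc K). apply Rmult_le_compat_l. lra.
    assert (Hle : 3 * eta * M / 2 ^ k <= 3 * eta * M).
    { apply Rle_div_l. apply two_pow_pos. assert (1 <= 2 ^ k) by (apply pow_R1_Rle; lra). assert (0 <= 3 * eta * M) by nra. nra. }
    specialize (HM k). lra. }
  assert (Hi : Hinf p alpha (Jmap x)) by (split; [now apply Jmap_analytic|eexists; apply HB]).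
  split; auto. now apply (Hnorm_spec p alpha (Jmap x) Hi).
Qed.

Lemma Jmap_c0 x : c0_seq x -> H0 p alpha (Jmap x).
Proof.
  intro Hx. assert (Hl := c0_linf x Hx). destruct Jmap_upper as [b [_ Hb]]. split. now apply Hb.
  destruct Jmap_wMp as [K [HK1 HK]]. assert (Hep := eta_pos).
  destruct (supnorm_spec x Hl) as [HM _]. set (M := supnorm x) in *.
  assert (HM0 : 0 <= M) by now apply supnorm_nonneg.
  intros eps He. apply is_lim_seq_spec in Hx.
  (* The coefficient and the error are each kept below eps/(4K), giving eps/2 and thus strict
     inequality. *)
  assert (He2 : 0 < eps / (4 * K)) by (apply Rdiv_lt_0_compat; lra).
  destruct (Hx (mkposreal _ He2)) as [N1 HN1]. simpl in HN1.
  destruct (pow_small (1 / 2) (3 * eta * M) (eps / (4 * K))) as [N2 HN2]; try lra. { assert (0 <= eta * M) by nra. lra. }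
  set (N := Nat.max N1 N2). assert (HrN := Hr1 N). assert (HrN' := Hrpos (N + 1)%nat).
  exists (1 - r (N + 1)%nat). split. lra. intros s Hs.
  destruct (shell (N + 1) s) as [k [HNk Hk]]. lra.
  eapply Rle_lt_trans. apply (HK x M k s Hl HM ltac:(lra) Hk).
  specialize (HN1 k ltac:(lia)). rewrite Rminus_0_r, Rabs_pos_eq in HN1 by apply Cmod_ge_0.
  assert (H3 : 3 * eta * M / 2 ^ k < eps / (4 * K)).
  { eapply Rle_lt_trans; [|apply HN2]. unfold Rdiv. rewrite Rmult_1_l, pow_inv, Rmult_comm. apply Rmult_le_compat_r. nra.
    apply Rinv_le_contravar. apply two_pow_pos. apply Rle_pow. lra. lia. }
  apply Rle_lt_trans with (K * (eps / (4 * K) + eps / (4 * K))). apply Rmult_le_compat_l; lra.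
  replace (K * (eps / (4 * K) + eps / (4 * K))) with (eps / 2) by (field; lra). lra.
Qed.

(** The supremum of |x| need not be attained, so an index reaching half of it is used; at its peak
    the corresponding hump outweighs all the others. *)
Lemma Jmap_peak x : linf_seq x -> exists k,
  / 2 ^ (m + 2) * supnorm x * Rpower (1 - Cmod (a k)) (- gam) <= Cmod (Jmap x (a k)).
Proof.
  intro Hx. destruct (supnorm_near x Hx) as [k Hk]. exists k.
  destruct (supnorm_spec x Hx) as [HM _]. set (M := supnorm x) in *.
  assert (HM0 : 0 <= M) by now apply supnorm_nonneg. assert (Hep := eta_pos).
  assert (Hsh := shell_estimate x M k (a k) HM (Ha k)). specialize (Har k). specialize (Hsh ltac:(lra)).
  assert (Hpk := tf_peak p alpha m (a k) (Ha k)). fold gam in Hpk. fold (tf (a k)) in Hpk. fold tf in Hpk.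
  assert (Hak := Ha k). unfold inD in Hak. assert (Hak0 := Cmod_ge_0 (a k)).
  set (y := Rpower (1 - Cmod (a k)) (- gam)) in *. assert (Hy : 0 < y) by apply Rpower_pos.
  assert (Hay : Rpower (1 - Cmod (a k)) (- alpha) <= y).
  { unfold y. apply Rle_trans with (Rpower (1 - Cmod (a k)) (- alpha) * Rpower (1 - Cmod (a k)) (- (gam - alpha))).
    - assert (P := Rpower_pos (1 - Cmod (a k)) (- alpha)).
      assert (Q := Rpower_neg_ge_1 (1 - Cmod (a k)) (gam - alpha) ltac:(lra)).
      assert (G := gexp_ge p Hp alpha). fold gam in G. specialize (Q ltac:(lra)). nra.
    - rewrite <- Rpower_plus. right. f_equal. ring. }
  assert (H1 : 3 * eta * M / 2 ^ k * Rpower (1 - Cmod (a k)) (- alpha) <= 3 * eta * M * y).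
  { assert (0 <= 3 * eta * M) by nra. assert (1 <= 2 ^ k) by (apply pow_R1_Rle; lra).
    assert (3 * eta * M / 2 ^ k <= 3 * eta * M) by (apply Rle_div_l; [apply two_pow_pos|nra]).
    apply Rmult_le_compat; auto. apply Rmult_le_pos; auto. left; apply Rinv_0_lt_compat, two_pow_pos. left; apply Rpower_pos. }
  assert (H2 : M / 2 * (y / 2 ^ m) <= Cmod (x k) * Cmod (tf (a k) (a k))).
  { apply Rmult_le_compat; auto. lra. left. apply Rdiv_lt_0_compat; auto. apply two_pow_pos. }
  rewrite <- Cmod_mult in H2.
  assert (H3 := Cmod_triangle_minus (x k * tf (a k) (a k)) (Jmap x (a k))). rewrite Cmod_minus_sym in H3.
  (* In units of M y/2^m the hump contributes at least 1/2, the error at most 3/16, and the claim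
     asks for 1/4. *)
  assert (E : 3 * eta * M * y = 3 / 16 * (M * y / 2 ^ m)).
  { unfold eta. rewrite pow_add. simpl. field. apply pow_nonzero; lra. }
  assert (E2 : / 2 ^ (m + 2) * M * y = 1 / 4 * (M * y / 2 ^ m)).
  { rewrite pow_add. simpl. field. apply pow_nonzero; lra. }
  assert (E3 : M / 2 * (y / 2 ^ m) = 1 / 2 * (M * y / 2 ^ m)) by (field; apply pow_nonzero; lra).
  assert (0 <= M * y / 2 ^ m). { apply Rmult_le_pos. nra. left; apply Rinv_0_lt_compat, two_pow_pos. }
  lra.
Qed.

Lemma Jmap_lower : exists c, 0 < c /\ forall x, linf_seq x -> c * supnorm x <= Hnorm p alpha (Jmap x).
Proof.
  destruct (pointwise_norm p Hp alpha Halpha) as [K [HK Hpt]]. destruct Jmap_upper as [b [_ Hb]].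
  exists (/ 2 ^ (m + 2) / K). split. { apply Rdiv_lt_0_compat; auto. apply Rinv_0_lt_compat, two_pow_pos. }
  intros x Hx. destruct (Jmap_peak x Hx) as [k Hk]. destruct (Hb x Hx) as [Hi _].
  assert (H := Hpt (Jmap x) Hi (a k) (Ha k)). fold gam in H.
  assert (P := Rpower_pos (1 - Cmod (a k)) (- gam)).
  assert (H' := Rle_trans _ _ _ Hk H). apply Rmult_le_reg_r in H'; auto.
  apply Rmult_le_reg_l with K; auto. replace (K * (/ 2 ^ (m + 2) / K * supnorm x)) with (/ 2 ^ (m + 2) * supnorm x); auto.
  field. split. apply pow_nonzero; lra. lra.
Qed.

(** At the peak the derivative (J x) g' has size (1 - |a_k|)^(-gexp - 1) times the supremum of |x|,
    which is exactly the growth allowed by [Hnorm_deriv_bound]. The powers cancel and leave a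
    constant independent of k. *)
Lemma TJmap_lower : exists c, 0 < c /\ forall x, linf_seq x -> c * supnorm x <= Hnorm p alpha (Tg g (Jmap x)).
Proof.
  destruct (Hnorm_deriv_bound p Hp alpha Halpha) as [K [HK Hpt]]. destruct Jmap_upper as [b [_ Hb]].
  assert (H2m := two_pow_pos (m + 2)).
  exists (/ 2 ^ (m + 2) * (delta / 2) / K). split.
  { apply Rdiv_lt_0_compat; auto. apply Rmult_lt_0_compat. now apply Rinv_0_lt_compat. lra. }
  intros x Hx. destruct (Jmap_peak x Hx) as [k Hk]. destruct (Hb x Hx) as [Hi _].
  assert (HT := Tg_bounded p alpha g (Jmap x) Hp Halpha Hg Hi).
  assert (H := Hpt _ HT (a k) (Ha k)). fold gam in H.
  rewrite Tg_derive, Cmod_mult in H; [|apply Hg|now apply Jmap_analytic|auto].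
  assert (Hak := Ha k). unfold inD in Hak. assert (Hak0 := Cmod_ge_0 (a k)).
  set (e := 1 - Cmod (a k)) in *. assert (He : 0 < e) by (unfold e; lra).
  assert (P := Rpower_pos e (- gam)).
  assert (HM0 : 0 <= supnorm x) by now apply supnorm_nonneg.
  (* The half comes from 1 - |a|^2 <= 2 (1 - |a|). *)
  assert (Hgl : delta / 2 * / e <= Cmod (C_derive g (a k))).
  { assert (HB := Hbig k). assert (Q := Cmod_ge_0 (C_derive g (a k))).
    apply Rle_div_l; auto. unfold e. 
    assert ((1 - Cmod (a k) ^ 2) * Cmod (C_derive g (a k)) <= 2 * (1 - Cmod (a k)) * Cmod (C_derive g (a k))).
    { apply Rmult_le_compat_r; auto. nra. } lra. }
  assert (Hl : / 2 ^ (m + 2) * supnorm x * Rpower e (- gam) * (delta / 2 * / e) <=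
     Cmod (Jmap x (a k)) * Cmod (C_derive g (a k))).
  { apply Rmult_le_compat; auto. apply Rmult_le_pos; [apply Rmult_le_pos; [left; now apply Rinv_0_lt_compat|auto]|lra].
    apply Rmult_le_pos. lra. left; now apply Rinv_0_lt_compat. }
  assert (H' := Rle_trans _ _ _ Hl H).
  rewrite Ropp_plus_distr, Rpower_plus, (Rpower_Ropp e 1), Rpower_1 in H' by auto.
  replace (/ 2 ^ (m + 2) * supnorm x * Rpower e (- gam) * (delta / 2 * / e)) with
    (/ 2 ^ (m + 2) * (delta / 2) * supnorm x * (Rpower e (- gam) * / e)) in H' by ring.
  assert (Hpos : 0 < Rpower e (- gam) * / e) by (apply Rmult_lt_0_compat; auto; now apply Rinv_0_lt_compat).
  apply Rmult_le_reg_r in H'; auto.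
  apply Rmult_le_reg_l with K; auto.
  replace (K * (/ 2 ^ (m + 2) * (delta / 2) / K * supnorm x)) with (/ 2 ^ (m + 2) * (delta / 2) * supnorm x); auto.
  field. split. apply pow_nonzero; lra. lra.
Qed.

End Embedding.

Lemma not_little_Bloch g : Bloch g -> ~ little_Bloch g -> exists delta, 0 < delta /\
  forall rho, rho < 1 -> exists z, inD z /\ rho < Cmod z /\ delta <= (1 - Cmod z ^ 2) * Cmod (C_derive g z).
Proof.
  intros Hg Hn. apply NNPP. intro H. apply Hn. split. apply Hg. intros eps He. apply NNPP. intro H1. apply H.
  exists eps. split; auto. intros rho Hrho. apply NNPP. intro H2. apply H1. exists (1 - rho). split. lra.
  intros z Hz Hzr. destruct (Rlt_le_dec ((1 - Cmod z ^ 2) * Cmod (C_derive g z)) eps); auto.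
  exfalso. apply H2. exists z. repeat split; auto. lra.
Qed.

(** One and the same [J] serves both sequence spaces; null sequences are merely sent into the
    smaller function space. *)
Lemma embedding p alpha g : Rbar_lt (Finite 0) p -> 0 < alpha -> Bloch g -> ~ little_Bloch g ->
  exists (J : (nat -> C) -> C -> C) (b c d : R), 0 < b /\ 0 < c /\ 0 < d /\
  (forall x y, linf_seq x -> linf_seq y -> J (sadd x y) = fadd (J x) (J y)) /\
  (forall l x, linf_seq x -> J (sscal l x) = fscal l (J x)) /\
  (forall x, linf_seq x -> Hinf p alpha (J x) /\ Hnorm p alpha (J x) <= b * supnorm x /\
     c * supnorm x <= Hnorm p alpha (J x) /\ d * supnorm x <= Hnorm p alpha (Tg g (J x))) /\
  (forall x, c0_seq x -> H0 p alpha (J x)).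
Proof.
  intros Hp Ha Hg Hn. destruct (not_little_Bloch g Hg Hn) as [delta [Hdelta Hbig]].
  (* m > gexp makes the humps vanish away from their peaks; m > 2/q makes room for the Szego kernel
     in the q-th power. *)
  destruct (nat_above (Rmax (gexp p alpha) (match p with Finite q => 2 / q | _ => 0 end))) as [m [Hm _]].
  assert (Hm1 := Rle_lt_trans _ _ _ (Rmax_l _ _) Hm). assert (Hm2 := Rle_lt_trans _ _ _ (Rmax_r _ _) Hm).
  assert (Hmp : match p with Finite q => 2 < INR m * q | _ => True end).
  { destruct p as [q| |]; auto. simpl in Hp. apply Rlt_div_l in Hm2; auto. }
  destruct (hump_sequence p alpha Ha m Hm1 (fun z => delta <= (1 - Cmod z ^ 2) * Cmod (C_derive g z)) Hbig (/ 2 ^ (m + 4)))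
    as [a [r [S [Hr0 [HS0 H]]]]].
  { apply Rinv_0_lt_compat, two_pow_pos. }
  assert (H1 := fun k => proj1 (H k)). assert (H2 := fun k => proj1 (proj2 (H k))).
  assert (H3 := fun k => proj1 (proj2 (proj2 (H k)))). assert (H4 := fun k => proj1 (proj2 (proj2 (proj2 (H k))))).
  assert (H5 := fun k => proj1 (proj2 (proj2 (proj2 (proj2 (H k)))))).
  assert (H6 := fun k => proj1 (proj2 (proj2 (proj2 (proj2 (proj2 (H k))))))).
  assert (H7 := fun k => proj1 (proj2 (proj2 (proj2 (proj2 (proj2 (proj2 (H k)))))))).
  assert (H8 := fun k => proj1 (proj2 (proj2 (proj2 (proj2 (proj2 (proj2 (proj2 (H k))))))))).
  assert (H9 := fun k => proj2 (proj2 (proj2 (proj2 (proj2 (proj2 (proj2 (proj2 (H k))))))))).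
  clear H. cbv beta in *.
  exists (Jmap p alpha m a).
  destruct (Jmap_upper p Hp alpha Ha m Hm1 Hmp a r S) as [b [Hb1 Hb2]]; auto.
  destruct (Jmap_lower p Hp alpha Ha m Hm1 Hmp a r S) as [c [Hc1 Hc2]]; auto.
  destruct (TJmap_lower p Hp alpha Ha g Hg delta Hdelta m Hm1 Hmp a r S) as [d [Hd1 Hd2]]; auto.
  exists b, c, d. repeat (split; [auto; fail|]). split; [|split; [|split]].
  - intros. apply (Jmap_add p alpha m a r); auto.
  - intros. apply (Jmap_scal p alpha m a r); auto.
  - intros x Hx. destruct (Hb2 x Hx). auto.
  - intros. apply (Jmap_c0 p Hp alpha Ha m Hm1 Hmp a r S); auto.
Qed.

(** * Fixed copies and non-separability *)

Lemma is_lim_seq_0_small (d : nat -> R) : is_lim_seq d 0 -> forall eps, 0 < eps -> exists N, forall n, (N <= n)%nat -> Rabs (d n) < eps.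
Proof.
  intros H eps He. apply is_lim_seq_spec in H. destruct (H (mkposreal eps He)) as [N HN].
  exists N. intros n Hn. specialize (HN n Hn). simpl in HN. now rewrite Rminus_0_r in HN.
Qed.

(** Letting k tend to infinity in the Cauchy bound removes d k and keeps an explicit rate, which is
    what makes coordinatewise limits uniform in the coordinate. *)
Lemma C_cauchy_limit (u : nat -> C) (d : nat -> R) K : 0 <= K -> is_lim_seq d 0 ->
  (forall n k, Cmod (u n - u k) <= K * (d n + d k)) -> exists l, forall n, Cmod (u n - l) <= K * d n.
Proof.
  intros HK Hd H.
  assert (Hsm : forall eps, 0 < eps -> exists N, forall n k, (N <= n)%nat -> (N <= k)%nat -> Cmod (u n - u k) < eps).
  { intros eps He. destruct (is_lim_seq_0_small d Hd (eps / (2 * (K + 1)))) as [N HN]. apply Rdiv_lt_0_compat; lra.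
    exists N. intros n k Hn Hk. eapply Rle_lt_trans. apply H.
    assert (A := HN n Hn). assert (B := HN k Hk). apply Rabs_lt_between in A. apply Rabs_lt_between in B.
    assert (E : (K + 1) * (eps / (2 * (K + 1)) + eps / (2 * (K + 1))) = eps) by (field; lra).
    set (q := eps / (2 * (K + 1))) in *. assert (0 < q) by lra. nra. }
  assert (Hf : ex_finite_lim_seq (fun n => fst (u n))).
  { apply ex_lim_seq_cauchy_corr. intros eps. destruct (Hsm eps (cond_pos eps)) as [N HN].
    exists N. intros n k Hn Hk. eapply Rle_lt_trans; [|apply (HN n k Hn Hk)].
    apply (fst_le_Cmod (u n - u k)). }
  assert (Hs : ex_finite_lim_seq (fun n => snd (u n))).
  { apply ex_lim_seq_cauchy_corr. intros eps. destruct (Hsm eps (cond_pos eps)) as [N HN].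
    exists N. intros n k Hn Hk. eapply Rle_lt_trans; [|apply (HN n k Hn Hk)].
    apply (snd_le_Cmod (u n - u k)). }
  destruct Hf as [l1 H1]. destruct Hs as [l2 H2]. exists (l1, l2). intro n.
  apply le_epsilon. intros e He.
  apply is_lim_seq_spec in H1. apply is_lim_seq_spec in H2.
  assert (He3 : 0 < e / 3) by lra.
  destruct (H1 (mkposreal _ He3)) as [N1 HN1]. destruct (H2 (mkposreal _ He3)) as [N2 HN2]. simpl in HN1, HN2.
  destruct (is_lim_seq_0_small d Hd (e / 3 / (K + 1))) as [N3 HN3]. apply Rdiv_lt_0_compat; lra.
  set (k := Nat.max N1 (Nat.max N2 N3)).
  specialize (HN1 k ltac:(lia)). specialize (HN2 k ltac:(lia)). specialize (HN3 k ltac:(lia)).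
  replace (u n - (l1, l2))%C with ((u n - u k) + (u k - (l1, l2)))%C by ring.
  eapply Rle_trans. apply Cmod_triangle. specialize (H n k).
  assert (Hk2 : Cmod (u k - (l1, l2)) <= Rabs (fst (u k) - l1) + Rabs (snd (u k) - l2)) by apply Cmod_pair_le.
  assert (HKd : K * d k <= e / 3).
  { apply Rabs_lt_between in HN3. assert (E : (K + 1) * (e / 3 / (K + 1)) = e / 3) by (field; lra).
    set (q := e / 3 / (K + 1)) in *. nra. }
  lra.
Qed.

Section Consequences.

Variable p : Rbar.
Hypothesis Hp : Rbar_lt (Finite 0) p.
Variable alpha : R.
Hypothesis Halpha : 0 < alpha.
Variable g : C -> C.
Hypothesis Hg : Bloch g.

Lemma Hnorm_zero f : Hinf p alpha f -> Hnorm p alpha f <= 0 -> forall z, inD z -> f z = 0%C.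
Proof.
  intros Hf H z Hz. destruct (pointwise_norm p Hp alpha Halpha) as [K [HK Hpt]].
  specialize (Hpt f Hf z Hz). assert (P := Rpower_pos (1 - Cmod z) (- gexp p alpha)).
  assert (H0 := Hnorm_nonneg p Hp alpha f Hf). replace (Hnorm p alpha f) with 0 in Hpt by lra.
  apply Cmod_eq_0. apply Rle_antisym; [|apply Cmod_ge_0]. lra.
Qed.

Lemma fsub_analytic u v : analytic_on_D u -> analytic_on_D v -> analytic_on_D (fsub u v).
Proof.
  intros Hu Hv. apply (analytic_ext (fun z => u z + (- (1)) * v z)%C). intros; unfold fsub; ring.
  apply analytic_plus; auto. apply analytic_mult; auto. apply analytic_const.
Qed.

(* Hnorm is real-valued with junk value 0 on unbounded means, so membership in Hinf is carried along. *)
Lemma Hinf_fsub : exists K, 1 <= K /\ forall u v, Hinf p alpha u -> Hinf p alpha v ->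
  Hinf p alpha (fsub u v) /\ Hnorm p alpha (fsub u v) <= K * (Hnorm p alpha u + Hnorm p alpha v).
Proof.
  destruct (Hinf_quasi_plus p Hp alpha) as [K [HK1 HK]]. exists K. split; auto. intros u v Hu Hv.
  apply HK; auto. apply fsub_analytic; [apply Hu|apply Hv].
  intros z _. unfold fsub, Cminus. eapply Rle_trans. apply Cmod_triangle. rewrite Cmod_opp. lra.
Qed.

Lemma Tg_ext f h z : (forall w, inD w -> f w = h w) -> inD z -> Tg g f z = Tg g h z.
Proof.
  intros E Hz. apply CI_ext. intros t. rewrite Rmin_left, Rmax_right by lra. intro Ht.
  rewrite E; auto. apply scale_inD; auto; lra.
Qed.

Lemma Tg_fsub f h z : analytic_on_D f -> analytic_on_D h -> inD z ->
  Tg g (fsub f h) z = fsub (Tg g f) (Tg g h) z.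
Proof.
  intros Hf Hh Hz. unfold fsub at 2.
  assert (Hgd := analytic_derive g (proj1 Hg)).
  assert (Hc : forall k t, analytic_on_D k -> 0 <= t <= 1 -> Ccont (fun t => k (RtoC t * z) * C_derive g (RtoC t * z) * z)%C t).
  { intros k t Hk Ht. apply Ccont_mult; [|apply Ccont_const].
    apply Ccont_mult; apply Ccont_scale; apply analytic_CCcont; auto; apply scale_inD; auto. }
  unfold Tg. change (@RInt C_R_CompleteNormedModule) with CI.
  rewrite <- CI_minus.
  - apply CI_ext. intros; unfold fsub; ring.
  - intros t. rewrite Rmin_left, Rmax_right by lra. auto.
  - intros t. rewrite Rmin_left, Rmax_right by lra. auto.
Qed.

Variable J : (nat -> C) -> C -> C.
Variables b c d : R.
Hypothesis Hb : 0 < b.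
Hypothesis Hc : 0 < c.
Hypothesis Hd : 0 < d.
Hypothesis Jadd : forall x y, linf_seq x -> linf_seq y -> J (sadd x y) = fadd (J x) (J y).
Hypothesis Jscal : forall l x, linf_seq x -> J (sscal l x) = fscal l (J x).
Hypothesis Jnorm : forall x, linf_seq x -> Hinf p alpha (J x) /\ Hnorm p alpha (J x) <= b * supnorm x /\
     c * supnorm x <= Hnorm p alpha (J x) /\ d * supnorm x <= Hnorm p alpha (Tg g (J x)).

Definition ssub (x y : nat -> C) : nat -> C := sadd x (sscal (- (1)) y).

Lemma ssub_at x y n : ssub x y n = (x n - y n)%C.
Proof. unfold ssub, sadd, sscal. ring. Qed.

Lemma sscal_linf l x : linf_seq x -> linf_seq (sscal l x).
Proof.
  intros [K HK]. exists (Cmod l * K). intro n. unfold sscal. rewrite Cmod_mult.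
  apply Rmult_le_compat_l; auto. apply Cmod_ge_0.
Qed.

Lemma sadd_linf x y : linf_seq x -> linf_seq y -> linf_seq (sadd x y).
Proof.
  intros [K HK] [L HL]. exists (K + L). intro n. eapply Rle_trans. apply Cmod_triangle.
  specialize (HK n). specialize (HL n). lra.
Qed.

Lemma ssub_linf x y : linf_seq x -> linf_seq y -> linf_seq (ssub x y).
Proof. intros. apply sadd_linf; auto. now apply sscal_linf. Qed.

Lemma J_ssub x y : linf_seq x -> linf_seq y -> J (ssub x y) = fsub (J x) (J y).
Proof.
  intros Hx Hy. unfold ssub. rewrite Jadd, Jscal; auto. 2: now apply sscal_linf.
  apply functional_extensionality. intro z. unfold fadd, fscal, fsub. ring.
Qed.

(** The subspace is the range of [J], read up to equality on the disc. Only its closedness takes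
    work: the lower bound on [J] makes the coordinates Cauchy, [Yclosed] places their limit in the
    sequence space, and the upper bound identifies its image with the given limit h. *)
Lemma fixes_from_embedding (inZ : (C -> C) -> Prop) (inY : (nat -> C) -> Prop) :
  (forall h, inZ h -> Hinf p alpha h) ->
  (forall f h, (forall z, inD z -> f z = h z) -> inZ f -> inZ h) ->
  (forall x, inY x -> linf_seq x) -> (forall x, inY x -> inZ (J x)) ->
  inY (fun _ => RtoC 0) -> (forall x y, inY x -> inY y -> inY (sadd x y)) -> (forall l x, inY x -> inY (sscal l x)) ->
  (forall (xs : nat -> nat -> C) x e, (forall n, inY (xs n)) -> is_lim_seq e 0 ->
     (forall n i, Cmod (xs n i - x i) <= e n) -> inY x) ->
  fixes_copy inZ (Hnorm p alpha) (Tg g) inY.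
Proof.
  intros ZH Zext YL YZ Y0 Yadd Yscal Yclosed.
  exists (fun h => exists x, inY x /\ forall z, inD z -> h z = J x z).
  split; [|split; [|split; [|split; [|split; [|split]]]]].
  - intros h [x [Hx E]]. apply (Zext (J x)). intros; now rewrite E. auto.
  - exists (fun _ => RtoC 0). split; auto. intros z _.
    assert (E : (fun _ : nat => RtoC 0) = sscal 0 (fun _ => RtoC 0)).
    { apply functional_extensionality. intro. unfold sscal. ring. }
    rewrite E, Jscal by auto. unfold fscal. ring.
  - intros h k [x [Hx E]] [y [Hy F]]. exists (sadd x y). split; auto. intros z Hz.
    rewrite Jadd by auto. unfold fadd. now rewrite E, F.
  - intros l h [x [Hx E]]. exists (sscal l x). split; auto. intros z Hz.
    rewrite Jscal by auto. unfold fscal. now rewrite E.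
  - intros hs h Hhs Hh Hlim.
    apply choice in Hhs. destruct Hhs as [xs Hxs].
    assert (HhI := ZH h Hh).
    assert (Hxl : forall n, linf_seq (xs n)) by (intro n; apply YL, Hxs).
    assert (HhsI : forall n, Hinf p alpha (hs n)).
    { intro n. apply (Hinf_ext p alpha (J (xs n))). intros z Hz. symmetry. now apply Hxs. now apply Jnorm. }
    destruct Hinf_fsub as [K [HK1 HK]].
    set (e := fun n => Hnorm p alpha (fsub (hs n) h)) in *.
    assert (Hd0 : forall n, Hinf p alpha (fsub (hs n) h)) by (intro n; now apply HK).
    (* Both approximants are compared with h: J(xs n - xs k) = (hs n - h) - (hs k - h), at a cost K,
       and dividing by [c] passes to coordinates. *)
    assert (Hcau : forall n k i, Cmod (xs n i - xs k i) <= K / c * (e n + e k)).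
    { intros n k i. assert (HL := ssub_linf _ _ (Hxl n) (Hxl k)).
      assert (H1 : Cmod (xs n i - xs k i) <= supnorm (ssub (xs n) (xs k))).
      { rewrite <- ssub_at. now apply supnorm_spec. }
      destruct (Jnorm _ HL) as [_ [_ [H2 _]]].
      assert (H3 : Hnorm p alpha (J (ssub (xs n) (xs k))) <= K * (e n + e k)).
      { rewrite (Hnorm_ext p alpha _ (fsub (fsub (hs n) h) (fsub (hs k) h))).
        apply HK; auto. intros z Hz. rewrite J_ssub by auto. unfold fsub.
        rewrite (proj2 (Hxs n) z Hz), (proj2 (Hxs k) z Hz). ring. }
      replace (K / c * (e n + e k)) with (K * (e n + e k) / c) by (field; lra).
      eapply Rle_trans. apply H1. apply Rle_div_r; lra. }
    assert (HKc : 0 <= K / c) by (left; apply Rdiv_lt_0_compat; lra).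
    assert (Hex : forall i, exists l, forall n, Cmod (xs n i - l) <= K / c * e n).
    { intro i. apply (C_cauchy_limit (fun n => xs n i) e); auto. }
    apply choice in Hex. destruct Hex as [x Hx].
    assert (Hlim' : is_lim_seq (fun n => K / c * e n) 0).
    { replace (Finite 0) with (Rbar_mult (K / c) 0) by (simpl; f_equal; ring). now apply is_lim_seq_scal_l. }
    assert (HYx : inY x) by (apply (Yclosed xs x (fun n => K / c * e n)); auto; intro n; apply Hxs).
    exists x. split; auto.
    assert (HxL := YL x HYx). assert (HJx := proj1 (Jnorm x HxL)).
    assert (Hz0 : Hnorm p alpha (fsub (J x) h) <= 0).
    { apply le_epsilon. intros eps He. rewrite Rplus_0_l.
      (* From J x - h = J(x - xs N) - (h - hs N): the first norm is at most b (K/c) e N, the second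
         e N, and the quasi-triangle inequality adds the outer K. *)
      set (Q := K * (b * (K / c) + 1)). assert (HQ : 0 < Q). { unfold Q. assert (0 <= b * (K / c)) by (apply Rmult_le_pos; lra). nra. }
      destruct (is_lim_seq_0_small e Hlim (eps / Q)) as [N HN]. apply Rdiv_lt_0_compat; auto.
      specialize (HN N (Nat.le_refl _)). assert (HeN : 0 <= e N) by now apply Hnorm_nonneg.
      rewrite Rabs_pos_eq in HN by auto.
      assert (HL := ssub_linf _ _ HxL (Hxl N)). destruct (Jnorm _ HL) as [HJI [HJ1 _]].
      assert (Hsn : supnorm (ssub x (xs N)) <= K / c * e N).
      { apply supnorm_spec; auto. intro i. rewrite ssub_at, Cmod_minus_sym. apply Hx. }
      assert (HhI2 : Hinf p alpha (fsub h (hs N))) by now apply HK.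
      assert (Hsym : Hnorm p alpha (fsub h (hs N)) <= e N).
      { apply (Hnorm_spec p alpha _ HhI2). intros r Hr.
        apply Rle_trans with (wMp p alpha r (fsub (hs N) h)); [|now apply (Hnorm_spec p alpha _ (Hd0 N))].
        unfold wMp. apply Rmult_le_compat_l. left; apply Rpower_pos. rewrite <- (Rmult_1_l (Mp p r (fsub (hs N) h))).
        apply (Mp_mono_scal p Hp). lra. now apply (Hinf_ccont p alpha). apply (Hinf_ccont p alpha); auto.
        intro t. unfold fsub. rewrite Cmod_minus_sym. lra. }
      rewrite (Hnorm_ext p alpha _ (fsub (J (ssub x (xs N))) (fsub h (hs N)))).
      2:{ intros z Hz. rewrite J_ssub by auto. unfold fsub. rewrite (proj2 (Hxs N) z Hz). ring. }
      eapply Rle_trans. apply HK; auto.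
      apply Rle_trans with (K * (b * (K / c * e N) + e N)).
      { apply Rmult_le_compat_l. lra. apply Rplus_le_compat; auto. eapply Rle_trans. apply HJ1. apply Rmult_le_compat_l; lra. }
      replace (K * (b * (K / c * e N) + e N)) with (Q * e N) by (unfold Q; ring).
      apply Rlt_div_r in HN; auto. lra. }
    intros z Hz.
    assert (E := Hnorm_zero _ (proj1 (HK _ _ HJx HhI)) Hz0 z Hz). unfold fsub in E.
    symmetry. now apply Ceq_minus.
  - exists J, c, b. split; auto. split; auto. split; [|split; [|split]].
    + intros; apply Jadd; auto.
    + intros; apply Jscal; auto.
    + intros x Hx. split. now exists x. destruct (Jnorm x (YL x Hx)) as [_ [A [B _]]]. auto.
    + intros h Hh. exact Hh.
  (* The norm of J x is at most b times the supremum of |x|, which is at most b/d times the norm of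
     its image under [Tg g]. *)
  - exists (d / b). split. now apply Rdiv_lt_0_compat. intros h [x [Hx E]].
    rewrite (Hnorm_ext p alpha h (J x) E).
    rewrite (Hnorm_ext p alpha (Tg g h) (Tg g (J x))) by (intros; now apply Tg_ext).
    destruct (Jnorm x (YL x Hx)) as [_ [A [_ B]]].
    eapply Rle_trans; [|apply B].
    replace (d * supnorm x) with (d / b * (b * supnorm x)) by (field; lra).
    apply Rmult_le_compat_l; auto. left. now apply Rdiv_lt_0_compat.
Qed.

Definition indic (x : nat -> bool) (n : nat) : C := if x n then 1%C else 0%C.

Lemma indic_linf x : linf_seq (indic x).
Proof. exists 1. intro n. unfold indic. destruct (x n); rewrite ?Cmod_1, ?Cmod_0; lra. Qed.

(* The images of the 0-1 sequences are uniformly separated; assigning to each of them a nearby member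
   of a dense sequence would enumerate them, against Cantor's diagonal. *)
Lemma range_nonseparable :
  ~ separable_set (fun h => exists f, Hinf p alpha f /\ forall z, inD z -> h z = Tg g f z) (Hnorm p alpha).
Proof.
  intros [s [Hs Hdense]].
  destruct Hinf_fsub as [K [HK1 HK]].
  set (h := fun x => Tg g (J (indic x))).
  (* Two images near the same s n are at quasi-distance at most 2 K e = d/2, whereas images of
     distinct 0-1 sequences are at distance at least d. *)
  set (e := d / (4 * K)). assert (He : 0 < e) by (apply Rdiv_lt_0_compat; lra).
  set (P := fun x n => Hnorm p alpha (fsub (h x) (s n)) < e).
  assert (HJI : forall x, Hinf p alpha (J (indic x))) by (intro x; apply Jnorm, indic_linf).
  assert (HhI : forall x, Hinf p alpha (h x)) by (intro x; exact (Tg_bounded p alpha g _ Hp Halpha Hg (HJI x))).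
  assert (HsI : forall n, Hinf p alpha (s n)).
  { intro n. destruct (Hs n) as [f [Hf E]]. apply (Hinf_ext p alpha (Tg g f)). intros; now rewrite E. exact (Tg_bounded p alpha g f Hp Halpha Hg Hf). }
  assert (Hex : forall x, exists n, P x n).
  { intro x. apply (Hdense (h x)); auto. exists (J (indic x)). auto. }
  assert (Huniq : forall x y n, P x n -> P y n -> forall i, x i = y i).
  { intros x y n Px Py i. apply NNPP. intro Hne.
    assert (HL := ssub_linf _ _ (indic_linf x) (indic_linf y)).
    destruct (Jnorm _ HL) as [_ [_ [_ B]]].
    assert (H1 : 1 <= supnorm (ssub (indic x) (indic y))).
    { eapply Rle_trans; [|apply (proj1 (supnorm_spec _ HL) i)]. rewrite ssub_at. unfold indic.
      destruct (x i), (y i); try (exfalso; now apply Hne).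
      - replace (1 - 0)%C with (RtoC 1) by ring. rewrite Cmod_1. lra.
      - replace (0 - 1)%C with (- RtoC 1)%C by ring. rewrite Cmod_opp, Cmod_1. lra. }
    rewrite (Hnorm_ext p alpha _ (fsub (fsub (h x) (s n)) (fsub (h y) (s n)))) in B.
    2:{ intros z Hz. rewrite J_ssub by apply indic_linf. rewrite Tg_fsub; auto; try apply HJI.
        unfold fsub, h. ring. }
    assert (H2 : Hnorm p alpha (fsub (fsub (h x) (s n)) (fsub (h y) (s n))) <= K * (e + e)).
    { eapply Rle_trans. apply HK; apply HK; auto. unfold P in *. apply Rmult_le_compat_l; lra. }
    replace (K * (e + e)) with (d / 2) in H2 by (unfold e; field; lra). nra. }
  (* Diagonal sequence: y n is true exactly when some sequence attached to n is false there. By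
     [Huniq] all sequences attached to one index agree, so y contradicts itself at any index
     attached to it. *)
  set (y := fun n => if excluded_middle_informative (exists x, P x n /\ x n = false) then true else false).
  destruct (Hex y) as [n Hn].
  assert (Ey : y n = if excluded_middle_informative (exists x, P x n /\ x n = false) then true else false) by reflexivity.
  destruct (excluded_middle_informative (exists x, P x n /\ x n = false)) as [[x [Px Ex]]|H].
  - rewrite (Huniq x y n Px Hn n) in Ex. congruence.
  - apply H. exists y. auto.
Qed.

End Consequences.

Theorem theorem5p5 (p : Rbar) (alpha : R) (g : C -> C) :
  Rbar_lt (Finite 0) p -> 0 < alpha ->
  Bloch g -> ~ little_Bloch g ->
  fixes_copy (H0 p alpha) (Hnorm p alpha) (Tg g) c0_seq /\
  fixes_copy (Hinf p alpha) (Hnorm p alpha) (Tg g) linf_seq /\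
  ~ separable_set (fun h => exists f, Hinf p alpha f /\ forall z, inD z -> h z = Tg g f z)
                  (Hnorm p alpha).
Proof.
  intros Hp Ha Hg Hn.
  destruct (embedding p alpha g Hp Ha Hg Hn) as [J [b [c [d [Hb [Hc [Hd [Jadd [Jscal [Jnorm J0]]]]]]]]]].
  split; [|split].
  - apply (fixes_from_embedding p Hp alpha Ha g J b c d); auto.
    + intros h H. apply H.
    + apply H0_ext.
    + apply c0_linf.
    + unfold c0_seq. apply (is_lim_seq_ext (fun _ => 0)). intros; now rewrite Cmod_0. apply is_lim_seq_const.
    + intros x y Hx Hy. unfold c0_seq in *.
      apply (is_lim_seq_le_le (fun _ => 0) _ (fun n => Cmod (x n) + Cmod (y n))).
      * intro n. split. apply Cmod_ge_0. apply Cmod_triangle.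
      * apply is_lim_seq_const.
      * replace (Finite 0) with (Finite (0 + 0)) by (f_equal; ring). now apply is_lim_seq_plus'.
    + intros l x Hx. unfold c0_seq in *. apply (is_lim_seq_ext (fun n => Cmod l * Cmod (x n))).
      intro n. unfold sscal. now rewrite Cmod_mult.
      replace (Finite 0) with (Rbar_mult (Cmod l) 0) by (simpl; f_equal; ring). now apply is_lim_seq_scal_l.
    (* A uniform limit of null sequences is null: one N with e N < eps/2 suffices, followed by the
       tail of xs N. *)
    + intros xs x e Hxs He Hle. unfold c0_seq in *. apply is_lim_seq_spec. intro eps. assert (Hpe := cond_pos eps).
      destruct (is_lim_seq_0_small e He (eps / 2)) as [N HN]. lra. specialize (HN N (Nat.le_refl _)).
      destruct (is_lim_seq_0_small _ (Hxs N) (eps / 2)) as [M HM]. lra.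
      exists M. intros i Hi. specialize (HM i Hi). specialize (Hle N i).
      rewrite Rminus_0_r. rewrite Rabs_pos_eq in * by apply Cmod_ge_0. apply Rabs_lt_between in HN.
      assert (HT := Cmod_triangle_minus (x i) (xs N i)). rewrite Cmod_minus_sym in HT. lra.
  - apply (fixes_from_embedding p Hp alpha Ha g J b c d); auto.
    + apply Hinf_ext.
    + intros x Hx. now apply Jnorm.
    + exists 0. intro. rewrite Cmod_0. lra.
    + apply sadd_linf.
    + apply sscal_linf.
    + intros xs x e Hxs _ Hle. destruct (Hxs 0%nat) as [K HK]. exists (K + e 0%nat). intro i.
      specialize (HK i). specialize (Hle 0%nat i).
      assert (HT := Cmod_triangle_minus (x i) (xs 0%nat i)). rewrite Cmod_minus_sym in HT. lra.
  - apply (range_nonseparable p Hp alpha Ha g Hg J b c d); auto.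
Qed.
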